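(* Let $k$ be an algebraically closed field and let $A$ be a noetherian AS-Gorenstein Hopf $k$-algebra of injective dimension $d$ with bijective antipode $S$. Let $\xi$ be the left winding automorphism of $A$ determined by the left integral of $A$. Then the Nakayama automorphism $\nu$ of $A$ is $S^2\xi$ (equality being understood up to composition with an inner automorphism of $A$, since $\nu$ is only defined up to inner automorphisms); that is, ${}^{S^2\xi}A^1[d]$ is a rigid dualising complex of $A$.
   Context: Algebras are associative unital $k$-algebras; noetherian means left and right noetherian. $A^{\mathrm{op}}$ is the opposite algebra and $A^e=A\otimes_k A^{\mathrm{op}}$, so $A^e$-modules are $A$-bimodules. $k$ also denotes the trivial module $A/\ker\epsilon$, $\epsilon$ the counit. Coproduct: $\Delta(a)=\sum a_1\otimes a_2$. AS-Gorenstein: a noetherian algebra $A$ with augmentation $\epsilon:A\to k$ is AS-Gorenstein (of injective dimension $d$) if (AS1) $\operatorname{injdim}({}_AA)=d<\infty$; (AS2) $\dim_k\operatorname{Ext}^d_A({}_Ak,{}_AA)=1$ and $\operatorname{Ext}^i_A({}_Ak,{}_AA)=0$ for all $i\ne d$; (AS3) the right-module versions of (AS1), (AS2) hold. Left integral and winding automorphism: $\int^l_A:=\operatorname{Ext}^d_A({}_Ak,{}_AA)$, a one-dimensional right $A$-module (action induced by right multiplication on $A$). Let $\pi_0:A\to A/\mathrm{r.ann}(\int^l_A)=k$ be the algebra homomorphism through which $A$ acts on it. Then $\xi(a)=\sum\pi_0(a_1)a_2$. Twisting: for a bimodule $M$ and algebra automorphisms $\sigma,\tau$ of $A$, ${}^{\sigma}M^{\tau}$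 is $M$ with $a\cdot m\cdot b=\sigma(a)m\tau(b)$; the superscript $1$ denotes the identity. Dualising complex: $R\in D^b(A^e\text{-Mod})$ is a dualising complex over the noetherian algebra $A$ if (i) $R$ has finite injective dimension over $A$ and over $A^{\mathrm{op}}$; (ii) $\bigoplus_i H^i(R)$ is finitely generated over $A$ and over $A^{\mathrm{op}}$; (iii) the canonical morphisms $A\to \operatorname{RHom}_A(R,R)$ and $A\to\operatorname{RHom}_{A^{\mathrm{op}}}(R,R)$ are isomorphisms in $D(A^e\text{-Mod})$. It is rigid if $R\cong\operatorname{RHom}_{A^e}(A,R\otimes R^{\mathrm{op}})$ in $D(A^e\text{-Mod})$, where $R^{\mathrm{op}}$ is $R$ viewed as a complex of $A^{\mathrm{op}}$-bimodules via $a\cdot r\cdot b=bra$; the left $A^e$-structure of $R\otimes R^{\mathrm{op}}$ comes from the left $A$-structure of $R$ and the left $A^{\mathrm{op}}$-structure of $R^{\mathrm{op}}$, and the remaining right structures give the bimodule structure of the result. Nakayama automorphism: an algebra automorphism $\nu$ of $A$ such that ${}^{\nu}A^1[d]$ is a rigid dualising complex of $A$; equivalently (Van den Bergh) $\operatorname{Ext}^i_{A^e}(A,A^e)=0$ for $i\neq d$ and $\operatorname{Ext}^d_{A^e}(A,A^e)\cong {}^1A^{\nu}$ as bimodules. It is unique up to an inner automorphism. *)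

(* Defs.v *)
From HB Require Import structures.
From mathcomp Require Import all_boot all_order all_algebra generic_quotient.
From mathcomp Require Import boolp classical_sets.

Set Implicit Arguments.
Unset Strict Implicit.
Unset Printing Implicit Defensive.

Import Order.TTheory GRing.Theory Num.Theory.
Local Open Scope ring_scope.

(* Modules given by generators and a universal property: [univ adm] is the    *)
(* k-module of formal combinations of generators g : G, two combinations     *)
(* being identified when every admissible map G -> U gives them the same     *)
(* value.                                                                     *)
Section Univ.
Local Open Scope quotient_scope.
Variables (k : fieldType) (G : choiceType).
Variable adm : forall U : lmodType k, (G -> U) -> Prop.

Definition ev (U : lmodType k) (phi : G -> U) (s : seq (k * G)) : U :=
  \sum_(x <- s) x.1 *: phi x.2.

Definition ueq : rel (seq (k * G)) := fun s t =>
  `[< forall (U : lmodType k) (phi : G -> U), adm phi -> ev phi s = ev phi t >].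

Lemma ueq_refl : reflexive ueq.
Proof. by move=> s; apply/asboolP. Qed.

Lemma ueq_sym : symmetric ueq.
Proof.
by move=> s t; apply/asboolP/asboolP => H U phi a; rewrite (H U phi a).
Qed.

Lemma ueq_trans : transitive ueq.
Proof.
move=> t s u /asboolP st /asboolP tu; apply/asboolP => U phi a.
by rewrite (st U phi a) tu.
Qed.

Canonical ueq_equiv := EquivRel ueq ueq_refl ueq_sym ueq_trans.

Definition univ : Type := {eq_quot ueq_equiv}.
HB.instance Definition _ := Choice.on univ.

Definition upi (s : seq (k * G)) : univ := \pi_{eq_quot ueq_equiv} s.
Definition urepr (x : univ) : seq (k * G) :=
  repr (x : {eq_quot ueq_equiv}).

Lemma ureprK x : upi (urepr x) = x.
Proof. exact: (@reprK _ {eq_quot ueq_equiv}). Qed.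

Lemma upi_eq s t :
  (forall (U : lmodType k) (phi : G -> U), adm phi -> ev phi s = ev phi t) ->
  upi s = upi t.
Proof. by move=> H; apply/eqmodP/asboolP. Qed.

Lemma ev_urepr (U : lmodType k) (phi : G -> U) s :
  adm phi -> ev phi (urepr (upi s)) = ev phi s.
Proof.
have : ueq (urepr (upi s)) s by apply/eqmodP; rewrite reprK.
by move=> /asboolP H a; exact: H.
Qed.

Definition fscale (c : k) (s : seq (k * G)) := [seq (c * x.1, x.2) | x <- s].

Lemma ev_nil (U : lmodType k) (phi : G -> U) : ev phi [::] = 0.
Proof. exact: big_nil. Qed.

Lemma ev_cat (U : lmodType k) (phi : G -> U) s t :
  ev phi (s ++ t) = ev phi s + ev phi t.
Proof. exact: big_cat. Qed.

Lemma ev_fscale (U : lmodType k) (phi : G -> U) c s :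
  ev phi (fscale c s) = c *: ev phi s.
Proof.
rewrite /ev big_map scaler_sumr; apply: eq_bigr => x _.
by rewrite scalerA.
Qed.

Definition uzero : univ := upi [::].
Definition uadd (x y : univ) : univ := upi (urepr x ++ urepr y).
Definition uopp (x : univ) : univ := upi (fscale (- 1) (urepr x)).
Definition uscale (c : k) (x : univ) : univ := upi (fscale c (urepr x)).

Let evE := (ev_cat, ev_fscale, ev_nil).

Fact uaddA : associative uadd.
Proof.
by move=> x y z; apply: upi_eq => U phi a; rewrite !(evE, ev_urepr) // addrA.
Qed.

Fact uaddC : commutative uadd.
Proof. by move=> x y; apply: upi_eq => U phi a; rewrite !evE addrC. Qed.

Fact uadd0 : left_id uzero uadd.
Proof.
move=> x; rewrite -[RHS]ureprK; apply: upi_eq => U phi a.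
by rewrite !(evE, ev_urepr) // add0r.
Qed.

Fact uaddN : left_inverse uzero uopp uadd.
Proof.
move=> x; apply: upi_eq => U phi a.
by rewrite !(evE, ev_urepr) // scaleN1r addNr.
Qed.

HB.instance Definition _ := GRing.isZmodule.Build univ uaddA uaddC uadd0 uaddN.

Fact uscaleA a b (x : univ) : uscale a (uscale b x) = uscale (a * b) x.
Proof. by apply: upi_eq => U phi h; rewrite !(evE, ev_urepr) // scalerA. Qed.

Fact uscale1 : left_id 1 uscale.
Proof.
move=> x; rewrite -[RHS]ureprK; apply: upi_eq => U phi a.
by rewrite evE scale1r.
Qed.

Fact uscaleDr : right_distributive uscale +%R.
Proof.
by move=> c x y; apply: upi_eq => U phi a; rewrite !(evE, ev_urepr) // scalerDr.
Qed.

Fact uscaleDl (x : univ) : {morph uscale^~ x : a b / a + b}.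
Proof.
by move=> c d; apply: upi_eq => U phi a; rewrite !(evE, ev_urepr) // scalerDl.
Qed.

HB.instance Definition _ :=
  GRing.Zmodule_isLmodule.Build k univ uscaleA uscale1 uscaleDr uscaleDl.

Definition ugen (g : G) : univ := upi [:: (1, g)].

Definition ulift (U : lmodType k) (phi : G -> U) (x : univ) : U :=
  ev phi (urepr x).

Section Lift.
Variables (U : lmodType k) (phi : G -> U).
Hypothesis a : adm phi.

Lemma ulift_gen g : ulift phi (ugen g) = phi g.
Proof. by rewrite /ulift ev_urepr // /ev big_seq1 scale1r. Qed.

Lemma ulift_linear : linear (ulift phi).
Proof. by move=> c x y; rewrite /ulift !(evE, ev_urepr). Qed.

End Lift.

Lemma ugen_span x : x = ev ugen (urepr x).
Proof.
rewrite -{1}(ureprK x); elim: (urepr x) => [|[c g] s IH]; first by rewrite ev_nil.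
rewrite /ev big_cons -/(ev ugen s) -IH /=; apply: upi_eq => U phi a.
by rewrite !(evE, ev_urepr) // /ev big_cons big_seq1 scale1r.
Qed.

Lemma univ_ind (P : univ -> Prop) :
  P 0 -> (forall c g x, P x -> P (c *: ugen g + x)) -> forall x, P x.
Proof.
move=> P0 PD x; rewrite (ugen_span x).
elim: (urepr x) => [|[c g] s IH]; first by rewrite ev_nil.
by rewrite /ev big_cons; apply: PD.
Qed.

Lemma univ_ext (U : lmodType k) (f g : univ -> U) :
  linear f -> linear g -> (forall x, f (ugen x) = g (ugen x)) -> f =1 g.
Proof.
move=> lf lg fg; have f0 h : linear h -> h 0 = 0 :> U.
  by move=> lh; have := lh (-1) 0 0; rewrite scaler0 addr0 scaleN1r addNr.
by elim/univ_ind => [|c x y IH]; rewrite ?f0 // lf lg IH fg.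
Qed.

(* An identity among generators holds in [univ adm] as soon as every         *)
(* admissible map satisfies it.                                              *)
Lemma ugen_rel (c : k) (g g1 g2 : G) :
  (forall (U : lmodType k) (phi : G -> U),
     adm phi -> phi g = c *: phi g1 + phi g2) ->
  ugen g = c *: ugen g1 + ugen g2.
Proof.
move=> H; apply: upi_eq => U phi a; rewrite !(evE, ev_urepr) //.
by rewrite /ev !big_seq1 !scale1r H.
Qed.

Lemma ugen_rel0 (g : G) :
  (forall (U : lmodType k) (phi : G -> U), adm phi -> phi g = 0) -> ugen g = 0.
Proof.
by move=> H; apply: upi_eq => U phi a; rewrite evE /ev big_seq1 scale1r H.
Qed.

End Univ.

Lemma linear0f (k : pzRingType) (U V : lmodType k) (f : U -> V) :
  linear f -> f 0 = 0.
Proof.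
by move=> lf; have := lf (-1) 0 0; rewrite scaler0 addr0 scaleN1r addNr.
Qed.

Section LinearPred.
Variables (R : pzRingType) (U V : lmodType R) (f : U -> V).
Hypothesis lf : linear f.
Lemma linearDf x y : f (x + y) = f x + f y.
Proof. by have := lf 1 x y; rewrite !scale1r. Qed.
Lemma linearMzf (z : int) x : f (x *~ z) = f x *~ z.
Proof.
rewrite -[in LHS]scaler_int -[in RHS]scaler_int.
by have := lf z%:~R x 0; rewrite (linear0f lf) !addr0.
Qed.
End LinearPred.

Section Tensor.
Variables (k : fieldType) (V W : lmodType k).

Definition bilin (U : lmodType k) (f : V -> W -> U) : Prop :=
  (forall w, linear (f^~ w)) /\ (forall v, linear (f v)).

Definition tensor : Type :=
  univ (fun (U : lmodType k) (phi : V * W -> U) =>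
    bilin (fun v w => phi (v, w))).
HB.instance Definition _ := GRing.Lmodule.on tensor.

Definition tens (v : V) (w : W) : tensor := ugen _ (v, w).

Definition tlift (U : lmodType k) (f : V -> W -> U) (x : tensor) : U :=
  ulift (fun p => f p.1 p.2) x.

Lemma tens_bilin : bilin tens.
Proof.
split=> [w c v v'|v c w w']; apply: ugen_rel => U phi [l1 l2].
- exact: (l1 w).
- exact: (l2 v).
Qed.

Lemma tensDl v v' w : tens (v + v') w = tens v w + tens v' w.
Proof. by have := tens_bilin.1 w 1 v v'; rewrite !scale1r. Qed.

Lemma tensDr v w w' : tens v (w + w') = tens v w + tens v w'.
Proof. by have := tens_bilin.2 v 1 w w'; rewrite !scale1r. Qed.

Lemma tensZl c v w : tens (c *: v) w = c *: tens v w.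
Proof.
by have := tens_bilin.1 w c v 0; rewrite (linear0f (tens_bilin.1 w)) !addr0.
Qed.

Lemma tensZr c v w : tens v (c *: w) = c *: tens v w.
Proof.
by have := tens_bilin.2 v c w 0; rewrite (linear0f (tens_bilin.2 v)) !addr0.
Qed.

Section TLift.
Variables (U : lmodType k) (f : V -> W -> U).
Hypothesis bf : bilin f.

Lemma tliftE v w : tlift f (tens v w) = f v w.
Proof. exact: (ulift_gen (adm := fun U phi => bilin (fun v w => phi (v, w)))). Qed.

Lemma tlift_linear : linear (tlift f).
Proof.
exact: (ulift_linear (adm := fun U phi => bilin (fun v w => phi (v, w)))).
Qed.
End TLift.

Lemma tensor_ind (P : tensor -> Prop) :
  P 0 -> (forall c v w x, P x -> P (c *: tens v w + x)) -> forall x, P x.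
Proof. by move=> P0 PD; apply: univ_ind => // c [v w] x; apply: PD. Qed.

Lemma tens_ext (U : lmodType k) (f g : tensor -> U) :
  linear f -> linear g -> (forall v w, f (tens v w) = g (tens v w)) -> f =1 g.
Proof. by move=> lf lg fg; apply: univ_ext => // -[v w]; apply: fg. Qed.

End Tensor.

Section Lift2.
Variables (k : fieldType) (V W V' W' U : lmodType k).
Variable f : V -> W -> V' -> W' -> U.
Hypothesis fl : forall v' w', bilin (fun v w => f v w v' w').
Hypothesis fr : forall v w, bilin (f v w).

Definition tlift2 (x : tensor V W) (y : tensor V' W') : U :=
  tlift (fun v w => tlift (f v w) y) x.

Let tlift2_bilin1 y : bilin (fun v w => tlift (f v w) y).
Proof.
split=> [w c v1 v2|v c w1 w2]; elim/tensor_ind: y => [|d v' w' y IH];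
  rewrite ?(linear0f (tlift_linear (fr _ _))) ?scaler0 ?addr0 //;
  rewrite !(tlift_linear (fr _ _)) !(tliftE (fr _ _)) IH.
- by rewrite (fl v' w').1 !scalerDr !scalerA (mulrC d) addrACA.
- by rewrite (fl v' w').2 !scalerDr !scalerA (mulrC d) addrACA.
Qed.

Lemma tlift2E v w v' w' : tlift2 (tens v w) (tens v' w') = f v w v' w'.
Proof. by rewrite /tlift2 (tliftE (tlift2_bilin1 _)) (tliftE (fr _ _)). Qed.

Lemma tlift2_bilin : bilin tlift2.
Proof.
split=> [y|x c y y']; first exact: tlift_linear (tlift2_bilin1 y).
have lin z : linear (tlift2^~ z) := tlift_linear (tlift2_bilin1 z).
elim/tensor_ind: x => [|d v w x IH].
  by rewrite !(linear0f (lin _)) scaler0 addr0.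
rewrite !lin IH /tlift2 !(tliftE (tlift2_bilin1 _)).
by rewrite (tlift_linear (fr _ _)) !scalerDr !scalerA (mulrC d) addrACA.
Qed.

End Lift2.

Section Functional.
Local Open Scope classical_set_scope.
Variables (k : fieldType) (V : lmodType k).

Lemma separating_form (v : V) : v != 0 ->
  exists phi : V -> k^o, linear phi /\ phi v = 1.
Proof.
move=> v0; pose cl (W : set V) := forall c x y, W x -> W y -> W (c *: x + y).
pose P (W : set V) := cl W /\ ~ W v.
have [F FP tF|W [[Wc Wv] Wmax]] := @Zorn_bigcup V P.
  split=> [c x y [X FX Xx] [Y FY Yy]|[X /FP[_ Xv]]//].
  case: (tF X Y FX FY) => XY.
    by exists Y => //; apply: (FP Y FY).1 => //; apply: XY.
  by exists X => //; apply: (FP X FX).1 => //; apply: XY.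
have W0 : W 0.
  apply: contrapT => nW0; apply: (Wmax [set 0]).
    split=> [x Wx|/(_ 0 erefl)//]; exfalso; apply: nW0.
    by have := Wc (-1) x x Wx Wx; rewrite scaleN1r addNr.
  split=> [c x y -> ->|]; first by rewrite /= scaler0 addr0.
  by move=> /= v0'; rewrite v0' eqxx in v0.
have ex x : exists c, W (x - c *: v).
  apply: contrapT => /forallNP nx.
  pose W' := [set y | exists w d, W w /\ y = w + d *: x].
  apply: (Wmax W').
    split=> [w Ww|WW']; first by exists w, 0; rewrite scale0r addr0.
    apply: (nx 0); rewrite scale0r subr0; apply: WW'.
    by exists 0, 1; rewrite scale1r add0r.
  split=> [c y z [w [d [Ww ->]]] [w' [d' [Ww' ->]]]|[w [d [Ww vE]]]].
    exists (c *: w + w'), (c * d + d'); split; first exact: Wc.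
    by rewrite scalerDr scalerDl scalerA addrACA.
  have d0 : d != 0.
    by apply/eqP => d0; apply: Wv; rewrite vE d0 scale0r addr0.
  apply: (nx d^-1); rewrite vE scalerDr scalerA mulVf // scale1r opprD addrCA.
  by rewrite subrr addr0 -scaleNr -[X in W X]addr0; apply: Wc.
have uq c d x : W (x - c *: v) -> W (x - d *: v) -> c = d.
  move=> H1 H2; apply/eqP; rewrite -subr_eq0; apply/negPn/negP => cd; apply: Wv.
  have := Wc (-1) _ _ H1 H2; rewrite scaleN1r opprB addrA addrNK.
  rewrite -scalerBl => Hcd.
  have := Wc (c - d)^-1 _ _ Hcd W0.
  by rewrite scalerA mulVf // scale1r addr0.
have [phi phiP] := choice ex.
exists phi; split=> [c x y|].
  apply: (uq _ _ (c *: x + y)) => //.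
  suff -> : c *: x + y - (c * phi x + phi y) *: v
            = c *: (x - phi x *: v) + (y - phi y *: v) by exact: Wc.
  by rewrite scalerDl opprD addrACA -scalerA -scalerBr.
by apply: (uq _ _ v) => //; rewrite scale1r subrr.
Qed.

End Functional.

Section ConverseAlgebra.
Variables (k : fieldType) (A : algType k).
Local Notation scalec := ( *:%R : k -> A -> A).
HB.instance Definition _ := GRing.Zmodule_isLmodule.Build k A^c
  (@scalerA k A : forall a b v, scalec a (scalec b v) = scalec (a * b) v)
  (@scale1r k A) (@scalerDr k A) (fun v a b => @scalerDl k A v a b).
Fact converse_scalerAl (c : k) (x y : A^c) :
  c *: (x * y) = (c *: x : A^c) * y.
Proof. exact: (@scalerAr k A c y x). Qed.
HB.instance Definition _ :=
  GRing.Lmodule_isLalgebra.Build k A^c converse_scalerAl.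
Fact converse_scalerAr (c : k) (x y : A^c) :
  c *: (x * y) = x * (c *: y : A^c).
Proof. exact: (@scalerAl k A c y x). Qed.
HB.instance Definition _ :=
  GRing.Lalgebra_isAlgebra.Build k A^c converse_scalerAr.
End ConverseAlgebra.

Section TensorAlgebra.
Variables (k : fieldType) (A B : algType k).
Definition talg : Type := tensor A B.
HB.instance Definition _ := GRing.Lmodule.on talg.
Local Notation T := talg.

Let tm (a : A) (b : B) (a' : A) (b' : B) : T := tens (a * a') (b * b').

Let tmr a b : bilin (tm a b).
Proof.
by split=> [b' c x y|a' c x y]; rewrite /tm mulrDr -scalerAr
  ?(tensDl, tensDr, tensZl, tensZr).
Qed.

Let tml a' b' : bilin (fun a b => tm a b a' b').
Proof.
by split=> [b c x y|a c x y]; rewrite /tm mulrDl -scalerAl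
  ?(tensDl, tensDr, tensZl, tensZr).
Qed.

Definition tmul : T -> T -> T := tlift2 tm.

Let tmul_bilin : bilin tmul. Proof. exact: tlift2_bilin. Qed.
Let tmul_linl y : linear (tmul^~ y). Proof. exact: tmul_bilin.1. Qed.
Let tmul_linr x : linear (tmul x). Proof. exact: tmul_bilin.2. Qed.

Let tmulE a b a' b' : tmul (tens a b) (tens a' b') = tens (a * a') (b * b').
Proof. exact: tlift2E. Qed.

Fact tmulA : associative tmul.
Proof.
move=> x y z; move: x; apply: tens_ext => [c x x'|c x x'|a b].
- by rewrite tmul_linl.
- by rewrite !tmul_linl.
move: y; apply: tens_ext => [c y y'|c y y'|a' b'].
- by rewrite tmul_linl tmul_linr.
- by rewrite tmul_linr tmul_linl.
move: z; apply: tens_ext => [c z z'|c z z'|a2 b2].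
- by rewrite !tmul_linr.
- by rewrite tmul_linr.
by rewrite !tmulE !mulrA.
Qed.

Fact tmul1 : left_id (tens 1 1) tmul.
Proof.
by apply: tens_ext => [c x y|//|a b]; rewrite ?tmul_linr // tmulE !mul1r.
Qed.

Fact tmulr1 : right_id (tens 1 1) tmul.
Proof.
by apply: tens_ext => [c x y|//|a b]; rewrite ?tmul_linl // tmulE !mulr1.
Qed.

Fact tmulDl : left_distributive tmul +%R.
Proof. by move=> x y z; have := tmul_linl z 1 x y; rewrite !scale1r. Qed.

Fact tmulDr : right_distributive tmul +%R.
Proof. by move=> z x y; have := tmul_linr z 1 x y; rewrite !scale1r. Qed.

Fact tens1_neq0 : tens 1 1 != 0 :> T.
Proof.
have [f [lf f1]] := separating_form (oner_neq0 A).
have [g [lg g1]] := separating_form (oner_neq0 B).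
have bfg : bilin (fun a b => f a * g b : k^o).
  split=> [b c x y|a c x y]; first by rewrite lf mulrDl scalerAl.
  by rewrite lg mulrDr -[c *: g x]/(c * g x) mulrCA.
apply/eqP => /(congr1 (tlift (fun a b => f a * g b : k^o))).
rewrite (tliftE bfg) f1 g1 mulr1 (linear0f (tlift_linear bfg)).
by apply/eqP; rewrite oner_neq0.
Qed.

HB.instance Definition _ := GRing.Zmodule_isNzRing.Build T
  tmulA tmul1 tmulr1 tmulDl tmulDr tens1_neq0.

Fact tscalerAl (c : k) (x y : T) : c *: (x * y) = (c *: x : T) * y.
Proof.
have := tmul_linl y c x 0; rewrite (linear0f (tmul_linl y)) !addr0.
exact: esym.
Qed.
HB.instance Definition _ := GRing.Lmodule_isLalgebra.Build k T tscalerAl.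

Fact tscalerAr (c : k) (x y : T) : c *: (x * y) = x * (c *: y : T).
Proof.
have := tmul_linr x c y 0; rewrite (linear0f (tmul_linr x)) !addr0.
exact: esym.
Qed.
HB.instance Definition _ := GRing.Lalgebra_isAlgebra.Build k T tscalerAr.

Definition aten (a : A) (b : B) : talg := tens a b.
Local Notation "x \ox y" := (aten x y) (at level 40, left associativity).

Lemma aten_bilin : bilin aten. Proof. exact: tens_bilin. Qed.

Lemma atenDl a a' b : (a + a') \ox b = a \ox b + a' \ox b.
Proof. exact: tensDl. Qed.
Lemma atenDr a b b' : a \ox (b + b') = a \ox b + a \ox b'.
Proof. exact: tensDr. Qed.
Lemma atenZl c a b : (c *: a) \ox b = c *: (a \ox b).
Proof. exact: tensZl. Qed.
Lemma atenZr c a b : a \ox (c *: b) = c *: (a \ox b).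
Proof. exact: tensZr. Qed.
Lemma atenM a a' b b' : (a \ox b) * (a' \ox b') = (a * a') \ox (b * b').
Proof. exact: tmulE. Qed.
Lemma aten1 : 1 \ox 1 = 1. Proof. by []. Qed.

Definition alift (U : lmodType k) (f : A -> B -> U) : talg -> U := tlift f.

Lemma aliftE (U : lmodType k) (f : A -> B -> U) a b :
  bilin f -> alift f (a \ox b) = f a b.
Proof. by move=> bf; exact: tliftE. Qed.

Lemma alift_linear (U : lmodType k) (f : A -> B -> U) :
  bilin f -> linear (alift f).
Proof. exact: tlift_linear. Qed.

Lemma talg_ind (P : talg -> Prop) :
  P 0 -> (forall c a b x, P x -> P (c *: (a \ox b) + x)) -> forall x, P x.
Proof. exact: tensor_ind. Qed.

End TensorAlgebra.

Notation "x \ox y" := (aten x y) (at level 40, left associativity) : ring_scope.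

Section TensorMorphisms.
Variables (k : fieldType).

Section Lift.
Variables (A B C : algType k) (f : A -> B -> C).
Hypothesis bf : bilin f.
Hypothesis f1 : f 1 1 = 1.
Hypothesis fM : forall a a' b b', f (a * a') (b * b') = f a b * f a' b'.

Lemma alift_monoid : monoid_morphism (alift f).
Proof.
split; first by rewrite -aten1 (aliftE _ _ bf).
have lf := alift_linear bf.
move=> x y; elim/talg_ind: x => [|c a b x IH].
  by rewrite mul0r (linear0f lf) mul0r.
rewrite mulrDl -scalerAl !lf mulrDl IH -scalerAl; congr (_ *: _ + _).
elim/talg_ind: y {x IH} => [|d a' b' y IHy].
  by rewrite mulr0 (linear0f lf) mulr0.
by rewrite mulrDr -scalerAr !lf mulrDr IHy -scalerAr atenM !(aliftE _ _ bf) fM.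
Qed.
End Lift.

Section Inl.
Variables A B : algType k.
Definition tinl (a : A) : talg A B := a \ox 1.
Definition tinr (b : B) : talg A B := 1 \ox b.
Fact tinl_linear : linear tinl. Proof. exact: (aten_bilin A B).1. Qed.
Fact tinr_linear : linear tinr. Proof. exact: (aten_bilin A B).2. Qed.
Fact tinl_monoid : monoid_morphism tinl.
Proof. by split=> // a a'; rewrite /tinl atenM mulr1. Qed.
Fact tinr_monoid : monoid_morphism tinr.
Proof. by split=> // b b'; rewrite /tinr atenM mulr1. Qed.
HB.instance Definition _ :=
  GRing.isLinear.Build k A (talg A B) _ tinl tinl_linear.
HB.instance Definition _ :=
  GRing.isMonoidMorphism.Build A (talg A B) tinl tinl_monoid.
HB.instance Definition _ :=
  GRing.isLinear.Build k B (talg A B) _ tinr tinr_linear.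
HB.instance Definition _ :=
  GRing.isMonoidMorphism.Build B (talg A B) tinr tinr_monoid.
End Inl.

Section Map.
Variables (A B A' B' : algType k).
Variables (f : {lrmorphism A -> A'}) (g : {lrmorphism B -> B'}).
Definition tmap : talg A B -> talg A' B' :=
  alift (fun a b => f a \ox g b).
Lemma tmap_bilin : bilin (fun a b => f a \ox g b).
Proof.
by split=> [b c x y|a c x y]; rewrite linearP ?(atenDl, atenDr, atenZl, atenZr).
Qed.
Fact tmap_linear : linear tmap. Proof. exact: alift_linear tmap_bilin. Qed.
Fact tmap_monoid : monoid_morphism tmap.
Proof.
apply: alift_monoid tmap_bilin _ _ => [|a a' b b']; first by rewrite !rmorph1.
by rewrite !rmorphM atenM.
Qed.
HB.instance Definition _ :=
  GRing.isLinear.Build k (talg A B) (talg A' B') _ tmap tmap_linear.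
HB.instance Definition _ :=
  GRing.isMonoidMorphism.Build (talg A B) (talg A' B') tmap tmap_monoid.
Lemma tmapE a b : tmap (a \ox b) = f a \ox g b.
Proof. exact: aliftE tmap_bilin. Qed.
End Map.

Section Swap.
Variables A B : algType k.
Definition tswap : talg A B -> talg B A :=
  alift (fun a b => b \ox a).
Lemma tswap_bilin : bilin (fun (a : A) (b : B) => b \ox a : talg B A).
Proof.
by split=> [b c x y|a c x y]; rewrite ?(atenDl, atenDr, atenZl, atenZr).
Qed.
Fact tswap_linear : linear tswap. Proof. exact: alift_linear tswap_bilin. Qed.
Fact tswap_monoid : monoid_morphism tswap.
Proof.
by apply: alift_monoid tswap_bilin _ _ => // a a' b b'; rewrite atenM.
Qed.
HB.instance Definition _ :=
  GRing.isLinear.Build k (talg A B) (talg B A) _ tswap tswap_linear.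
HB.instance Definition _ :=
  GRing.isMonoidMorphism.Build (talg A B) (talg B A) tswap tswap_monoid.
Lemma tswapE a b : tswap (a \ox b) = b \ox a.
Proof. exact: aliftE tswap_bilin. Qed.
End Swap.

Section Interchange.
Variables A B C D : algType k.
Local Notation T := (talg (talg A D) (talg C B)).
Let f (a : A) (b : B) (c : C) (d : D) : T := (a \ox d) \ox (c \ox b).

Let f1 (x : talg A B) (y : talg C D) : T := tlift2 f x y.

Definition tinterchange : talg (talg A B) (talg C D) -> T := alift f1.

Let fr a b : bilin (f a b).
Proof.
split=> [d c x y|a' c x y]; rewrite /f;
by rewrite ?(atenDl, atenDr, atenZl, atenZr).
Qed.
Let fl c d : bilin (fun a b => f a b c d).
Proof.
split=> [b e x y|a e x y]; rewrite /f;
by rewrite ?(atenDl, atenDr, atenZl, atenZr).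
Qed.
Let b0 : bilin f1. Proof. exact: tlift2_bilin. Qed.
Let f1E a b c d : f1 (a \ox b) (c \ox d) = f a b c d.
Proof. exact: tlift2E. Qed.

Lemma tinterchangeE a b c d :
  tinterchange ((a \ox b) \ox (c \ox d)) = (a \ox d) \ox (c \ox b).
Proof. by rewrite [LHS](aliftE _ _ b0) f1E. Qed.

Fact tinterchange_linear : linear tinterchange.
Proof. exact: alift_linear b0. Qed.

Let f1M x x' y y' : f1 (x * x') (y * y') = f1 x y * f1 x' y'.
Proof.
have l1 z := b0.1 z; have l2 z := b0.2 z.
have z1 z : f1 0 z = 0 := linear0f (l1 z).
have z2 z : f1 z 0 = 0 := linear0f (l2 z).
have D1 c u v z : f1 (c *: u + v) z = c *: f1 u z + f1 v z by exact: l1.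
have D2 c u v z : f1 z (c *: u + v) = c *: f1 z u + f1 z v by exact: l2.
elim/talg_ind: x => [|e a b x IH]; first by rewrite mul0r !z1 mul0r.
rewrite mulrDl -scalerAl !D1 mulrDl IH -scalerAl; congr (_ *: _ + _).
elim/talg_ind: x' {x IH} => [|e' a' b' x' IH'].
  by rewrite mulr0 !z1 mulr0.
rewrite mulrDr -scalerAr !D1 mulrDr IH' -scalerAr; congr (_ *: _ + _).
elim/talg_ind: y {x' IH'} => [|g c d y IHy]; first by rewrite mul0r !z2 mul0r.
rewrite mulrDl -scalerAl !D2 mulrDl IHy -scalerAl; congr (_ *: _ + _).
elim/talg_ind: y' {y IHy} => [|g' c' d' y' IHy'].
  by rewrite mulr0 !z2 mulr0.
rewrite mulrDr -scalerAr !D2 mulrDr IHy' -scalerAr; congr (_ *: _ + _).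
by rewrite !atenM !f1E !atenM.
Qed.

Fact tinterchange_monoid : monoid_morphism tinterchange.
Proof. by apply: alift_monoid b0 _ f1M; rewrite -!aten1 f1E. Qed.

HB.instance Definition _ :=
  GRing.isLinear.Build k (talg (talg A B) (talg C D)) T _
    tinterchange tinterchange_linear.
HB.instance Definition _ :=
  GRing.isMonoidMorphism.Build (talg (talg A B) (talg C D)) T
    tinterchange tinterchange_monoid.
End Interchange.

End TensorMorphisms.

Arguments tinl {k} A B a.
Arguments tinr {k} A B b.
Arguments tswap {k} A B x.
Arguments tinterchange {k} A B C D x.

Definition restr (E F : pzRingType) (f : {rmorphism E -> F})
  (M : lmodType F) : Type := M.

Section Restriction.
Variables (E F : pzRingType) (f : {rmorphism E -> F}).

Section Obj.
Variable M : lmodType F.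
HB.instance Definition _ := GRing.Zmodule.on (restr f M).
Local Notation scalef := (fun (e : E) (m : restr f M) => f e *: (m : M) : restr f M).
Fact restrA a b v : scalef a (scalef b v) = scalef (a * b) v.
Proof. by rewrite /= scalerA rmorphM. Qed.
Fact restr1 : left_id 1 scalef.
Proof. by move=> v; rewrite /= rmorph1 scale1r. Qed.
Fact restrDr : right_distributive scalef +%R.
Proof. by move=> e u v; exact: scalerDr. Qed.
Fact restrDl v : {morph scalef^~ v : a b / a + b}.
Proof. by move=> a b; rewrite /= rmorphD scalerDl. Qed.
HB.instance Definition _ := GRing.Zmodule_isLmodule.Build E (restr f M)
  restrA restr1 restrDr restrDl.
End Obj.

Definition restr_map (M N : lmodType F) (g : {linear M -> N}) :
  restr f M -> restr f N := g.
Fact restr_map_linear (M N : lmodType F) (g : {linear M -> N}) : linear (restr_map g).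
Proof. by move=> e x y; exact: (linearP g (f e)). Qed.
HB.instance Definition _ (M N : lmodType F) (g : {linear M -> N}) :=
  GRing.isLinear.Build E (restr f M) (restr f N) _ (restr_map g)
    (restr_map_linear g).
End Restriction.

(* Two commuting k-linear left actions on a k-module are the same thing as   *)
(* a module over the tensor product algebra.                                 *)
Section Biaction.
Variables (k : fieldType) (E F : algType k).

Record biaction (M : lmodType k) := Biaction {
  act1 : E -> M -> M;
  act2 : F -> M -> M;
  act1_bilin : bilin act1;
  act2_bilin : bilin act2;
  act1_1 : forall m, act1 1 m = m;
  act2_1 : forall m, act2 1 m = m;
  act1_M : forall e e' m, act1 (e * e') m = act1 e (act1 e' m);
  act2_M : forall f f' m, act2 (f * f') m = act2 f (act2 f' m);
  act_comm : forall e f m, act1 e (act2 f m) = act2 f (act1 e m) }.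

Definition bimod (M : lmodType k) (b : biaction M) : Type := M.

Section Instance.
Variables (M : lmodType k) (b : biaction M).
HB.instance Definition _ := GRing.Zmodule.on (bimod b).

Definition biact (t : talg E F) (m : bimod b) : bimod b :=
  alift (fun e f => act1 b e (act2 b f m)) t.

Fact biact_bilin (m : M) : bilin (fun e f => act1 b e (act2 b f m)).
Proof.
split=> [f c x y|e c x y]; first by rewrite (act1_bilin b).1.
by rewrite (act2_bilin b).1 (act1_bilin b).2.
Qed.

Let lin m : linear (fun t => biact t m : M).
Proof. exact: alift_linear (biact_bilin m). Qed.
Let pureE e f (m : M) : biact (e \ox f) m = act1 b e (act2 b f m).
Proof. exact: aliftE (biact_bilin m). Qed.

Let linm t : linear (biact t : M -> M).
Proof.
elim/talg_ind: t => [|d e f t IH] c x y.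
  by rewrite !(linear0f (lin _)) scaler0 addr0.
rewrite !lin IH !pureE (act2_bilin b).2 (act1_bilin b).2.
by rewrite !scalerDr !scalerA (mulrC d) addrACA.
Qed.

Fact biactA s t m : biact s (biact t m) = biact (s * t) m.
Proof.
elim/talg_ind: s => [|c e f s IH].
  by rewrite mul0r !(linear0f (lin _)).
rewrite mulrDl -scalerAl !lin IH; congr (_ *: (_ : M) + _).
elim/talg_ind: t {s IH} => [|d e' f' t IHt].
  by rewrite mulr0 (linear0f (lin _)) (linear0f (linm _)).
rewrite mulrDr -scalerAr !lin linm IHt atenM !pureE act1_M act2_M.
by congr (_ *: (_ : M) + _); rewrite -act_comm.
Qed.
Fact biact1 : left_id 1 biact.
Proof. by move=> m; rewrite -aten1 pureE act2_1 act1_1. Qed.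
Fact biactDr : right_distributive biact +%R.
Proof. by move=> t x y; have := linm t 1 x y; rewrite !scale1r. Qed.
Fact biactDl m : {morph biact^~ m : s t / s + t}.
Proof. by move=> s t; have := lin m 1 s t; rewrite !scale1r. Qed.
HB.instance Definition _ := GRing.Zmodule_isLmodule.Build (talg E F) (bimod b)
  biactA biact1 biactDr biactDl.

Lemma bimod_scaleE e f (m : bimod b) :
  (e \ox f) *: m = act1 b e (act2 b f m).
Proof. exact: pureE. Qed.
End Instance.

Lemma tens_linear (M N : lmodType (talg E F)) (g : M -> N) :
  (forall x y, g (x + y) = g x + g y) ->
  (forall e f x, g ((e \ox f) *: x) = (e \ox f) *: g x) -> linear g.
Proof.
move=> gD gZ t x y; rewrite gD; congr (_ + _).
elim/talg_ind: t => [|c e f t IH].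
  have := gD 0 0; rewrite addr0 !scale0r => /eqP.
  by rewrite -subr_eq0 opprD addrA subrr sub0r oppr_eq0 => /eqP.
by rewrite !scalerDl gD IH -atenZl gZ.
Qed.
End Biaction.

Section RegularBimodule.
Variables (k : fieldType) (A : algType k).

Fact regbim_bilin1 : bilin (fun a m : A => a * m).
Proof.
split=> [m c x y|a c x y]; first by rewrite mulrDl scalerAl.
by rewrite mulrDr scalerAr.
Qed.
Fact regbim_bilin2 : bilin (fun (b : A^c) (m : A) => m * (b : A)).
Proof.
split=> [m c x y|a c x y]; first by rewrite /= mulrDr -scalerAr.
by rewrite mulrDl scalerAl.
Qed.

Definition regbim_action : biaction A A^c A.
Proof.
apply: (Biaction regbim_bilin1 regbim_bilin2) => [m|m|a a' m|b b' m|a b m].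
- exact: mul1r.
- exact: mulr1.
- exact/esym/mulrA.
- exact: mulrA.
- exact: mulrA.
Defined.

Definition regbim : lmodType (talg A A^c) := bimod regbim_action.
End RegularBimodule.

(* Cochain complexes.  The differential is given between all pairs of        *)
(* degrees and vanishes unless the second is the successor of the first;     *)
(* this avoids transports along equations between degrees.                   *)
Record complex (E : pzRingType) := Complex {
  cobj :> int -> lmodType E;
  cdiff : forall i j, {linear cobj i -> cobj j};
  cdiff_shape : forall i j x, j != i + 1 -> cdiff i j x = 0;
  cdiffK : forall i j l x, cdiff j l (cdiff i j x) = 0 }.

Section Complexes.
Variable E : pzRingType.
Implicit Types X Y : complex E.

Definition cocycle X (i : int) (x : X i) : Prop := cdiff X i (i + 1) x = 0.

Definition coboundary X (i : int) (x : X i) : Prop :=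
  exists y : X (i - 1), cdiff X (i - 1) i y = x.

Record cmap X Y := CMap {
  cmap_fun :> forall i, {linear X i -> Y i};
  cmapC : forall i j x,
    cmap_fun j (cdiff X i j x) = cdiff Y i j (cmap_fun i x) }.

Definition qiso X Y (f : cmap X Y) : Prop := forall i,
  (forall x : X i, cocycle x -> coboundary (f i x) -> coboundary x) /\
  (forall y : Y i, cocycle y ->
     exists x : X i, cocycle x /\ coboundary (y - f i x)).

Definition derived_iso X Y : Prop :=
  exists (Z : complex E) (f : cmap Z X) (g : cmap Z Y), qiso f /\ qiso g.

Definition acyclic_at X (i : int) : Prop :=
  forall x : X i, cocycle x -> coboundary x.

Definition zero_at X (i : int) : Prop := forall x : X i, x = 0.

Definition injective_module (I : lmodType E) : Prop :=
  forall (M N : lmodType E) (f : {linear M -> N}) (g : {linear M -> I}),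
    injective f -> exists h : {linear N -> I}, forall x, h (f x) = g x.

Definition projective_module (P : lmodType E) : Prop :=
  forall (M N : lmodType E) (f : {linear M -> N}) (g : {linear P -> N}),
    (forall y, exists x, f x = y) ->
    exists h : {linear P -> M}, forall x, f (h x) = g x.

Section Stalk.
Variables (m : int) (M : lmodType E).

Section Obj.
Variable i : int.
Definition stalk_pred : pred M := fun x => (i == m) || (x == 0).
Record stalk_obj := StalkObj { stalk_val : M; stalk_valP : stalk_pred stalk_val }.
Fact stalk_submod : submod_closed stalk_pred.
Proof.
split=> [|e x y]; rewrite !unfold_in ?eqxx ?orbT //.
by case: (i == m) => //= /eqP-> /eqP->; rewrite scaler0 addr0.
Qed.
HB.instance Definition _ := GRing.isSubmodClosed.Build E M stalk_pred stalk_submod.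
HB.instance Definition _ := [isSub of stalk_obj for stalk_val].
HB.instance Definition _ := [Choice of stalk_obj by <:].
HB.instance Definition _ := [SubChoice_isSubLmodule of stalk_obj by <:].
End Obj.

Definition stalk : complex E.
Proof.
by exists (fun i => stalk_obj i : lmodType E) (fun i j => \0 : {linear _ -> _}).
Defined.
End Stalk.

End Complexes.

Definition crestr (E F : pzRingType) (f : {rmorphism E -> F}) (X : complex F) :
  complex E.
Proof.
exists (fun i => restr f (X i)) (fun i j => restr_map (f := f) (cdiff X i j)).
- by move=> i j x; exact: cdiff_shape.
- by move=> i j l x; exact: cdiffK.
Defined.

Definition csign (n : int) : int := (-1) ^+ `|n|%N.

Lemma csignS n : csign (n + 1) = - csign n.
Proof.
case: n => [n|[|n]]; rewrite /csign //.
  by rewrite -PoszD absz_nat addn1 exprS mulN1r.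
have -> : Negz n.+1 + 1 = Negz n by rewrite !NegzE -addn1 PoszD opprD addrNK.
by rewrite !NegzE !abszN !absz_nat [in RHS]exprS mulN1r opprK.
Qed.

(* The total tensor product over k of a complex of E-modules and a complex   *)
(* of F-modules.  Its degree n part is presented by the generators (i, j; x, *)
(* y), which are bilinear in x, y and zero unless i + j = n.                 *)
Section TensorComplex.
Variables (k : fieldType) (E F : algType k) (X : complex E) (Y : complex F).

Definition ct_gen : choiceType := {p : int * int & (X p.1 * Y p.2)%type}.
Definition ct_mk i j (x : X i) (y : Y j) : ct_gen :=
  existT (fun p : int * int => (X p.1 * Y p.2)%type) (i, j) (x, y).

Definition ct_adm (n : int) (U : lmodType k) (phi : ct_gen -> U) : Prop :=
  (forall i j, bilin (fun (x : restr (in_alg E) (X i))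
                          (y : restr (in_alg F) (Y j)) => phi (ct_mk x y))) /\
  (forall i j (x : X i) (y : Y j), i + j <> n -> phi (ct_mk x y) = 0).

Definition ct_obj (n : int) : Type := univ (@ct_adm n).
HB.instance Definition _ n := GRing.Lmodule.on (ct_obj n).
Definition ct_ten n i j (x : X i) (y : Y j) : ct_obj n := ugen _ (ct_mk x y).

Lemma ct_ten_adm n : @ct_adm n _ (ugen (@ct_adm n)).
Proof.
split=> [i j|i j x y ij]; last first.
  by apply: ugen_rel0 => U phi [_ ph0]; exact: ph0.
split=> [y c x x'|x c y y']; apply: ugen_rel => U phi [/(_ i j)[l1 l2] _].
- exact: (l1 y).
- exact: (l2 x).
Qed.

Lemma ct_tenPl n i j c (x x' : X i) (y : Y j) :
  ct_ten n (c%:A *: x + x') y = c *: ct_ten n x y + ct_ten n x' y.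
Proof. exact: ((ct_ten_adm n).1 i j).1. Qed.

Lemma ct_tenPr n i j c (x : X i) (y y' : Y j) :
  ct_ten n x (c%:A *: y + y') = c *: ct_ten n x y + ct_ten n x y'.
Proof. exact: ((ct_ten_adm n).1 i j).2. Qed.

Lemma ct_ten0 n i j (x : X i) (y : Y j) : i + j <> n -> ct_ten n x y = 0.
Proof. exact: (ct_ten_adm n).2. Qed.

Lemma ct_ind n (P : ct_obj n -> Prop) :
  P 0 -> (forall c i j (x : X i) (y : Y j) t,
            P t -> P (c *: ct_ten n x y + t)) -> forall t, P t.
Proof.
move=> P0 PD; apply: univ_ind => // c [[i j] [x y]] t; exact: PD.
Qed.

Lemma ct_ten_0l n i j (y : Y j) : ct_ten n (0 : X i) y = 0.
Proof.
have := ct_tenPl n 1 (0 : X i) 0 y.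
rewrite scaler0 addr0 scale1r => /eqP.
by rewrite -subr_eq0 opprD addrA subrr sub0r oppr_eq0 => /eqP.
Qed.

Lemma ct_ten_0r n i j (x : X i) : ct_ten n x (0 : Y j) = 0.
Proof.
have := ct_tenPr n 1 x (0 : Y j) 0.
rewrite scaler0 addr0 scale1r => /eqP.
by rewrite -subr_eq0 opprD addrA subrr sub0r oppr_eq0 => /eqP.
Qed.

Section CLift.
Variables (n : int) (U : lmodType k).
Variable phi : forall i j, X i -> Y j -> U.
Arguments phi {i j}.

Definition ct_multi : Prop :=
  [/\ forall i j c (x x' : X i) (y : Y j),
        phi (c%:A *: x + x') y = c *: phi x y + phi x' y,
      forall i j c (x : X i) (y y' : Y j),
        phi x (c%:A *: y + y') = c *: phi x y + phi x y' &
      forall i j (x : X i) (y : Y j), i + j <> n -> phi x y = 0].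

Definition ct_lift : ct_obj n -> U :=
  ulift (fun g : ct_gen => phi (tagged g).1 (tagged g).2).

Hypothesis H : ct_multi.

Fact ct_multi_adm :
  @ct_adm n _ (fun g : ct_gen => phi (tagged g).1 (tagged g).2).
Proof.
by case: H => h1 h2 h3; split=> // i j; split=> [y c x x'|x c y y'] /=;
  [exact: h1|exact: h2].
Qed.

Lemma ct_lift_linear : linear ct_lift.
Proof. exact: ulift_linear ct_multi_adm. Qed.

Lemma ct_liftE i j (x : X i) (y : Y j) : ct_lift (ct_ten n x y) = phi x y.
Proof. exact: (ulift_gen ct_multi_adm). Qed.
End CLift.

Lemma ct_ext n (U : lmodType k) (f g : ct_obj n -> U) :
  linear f -> linear g ->
  (forall i j (x : X i) (y : Y j), f (ct_ten n x y) = g (ct_ten n x y)) ->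
  f =1 g.
Proof. by move=> lf lg fg; apply: univ_ext => // -[[i j] [x y]]; exact: fg. Qed.

Section Action.
Variable n : int.

Definition ct_act1 (e : E) : ct_obj n -> ct_obj n :=
  ct_lift (fun i j (x : X i) (y : Y j) => ct_ten n (e *: x) y).
Definition ct_act2 (f : F) : ct_obj n -> ct_obj n :=
  ct_lift (fun i j (x : X i) (y : Y j) => ct_ten n x (f *: y)).

Fact ct_multi1 e :
  ct_multi n (fun i j (x : X i) (y : Y j) => ct_ten n (e *: x) y).
Proof.
split=> [i j c x x' y|i j c x y y'|i j x y] /=.
- rewrite scalerDr scalerA -scalerAr mulr1 -[e in c *: e]mul1r scalerAl.
  by rewrite -scalerA ct_tenPl.
- exact: ct_tenPr.
- exact: ct_ten0.
Qed.

Fact ct_multi2 f :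
  ct_multi n (fun i j (x : X i) (y : Y j) => ct_ten n x (f *: y)).
Proof.
split=> [i j c x x' y|i j c x y y'|i j x y] /=.
- exact: ct_tenPl.
- rewrite scalerDr scalerA -scalerAr mulr1 -[f in c *: f]mul1r scalerAl.
  by rewrite -scalerA ct_tenPr.
- exact: ct_ten0.
Qed.

Let lin1 e : linear (ct_act1 e) := ct_lift_linear (ct_multi1 e).
Let lin2 f : linear (ct_act2 f) := ct_lift_linear (ct_multi2 f).

Lemma ct_act1E e i j (x : X i) (y : Y j) :
  ct_act1 e (ct_ten n x y) = ct_ten n (e *: x) y.
Proof. exact: (ct_liftE (ct_multi1 e)). Qed.
Lemma ct_act2E f i j (x : X i) (y : Y j) :
  ct_act2 f (ct_ten n x y) = ct_ten n x (f *: y).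
Proof. exact: (ct_liftE (ct_multi2 f)). Qed.

Fact ct_act1_bilin : bilin ct_act1.
Proof.
split=> [m c e e'|e]; last exact: lin1.
elim/ct_ind: m => [|d i j x y t IH].
  by rewrite !(linear0f (lin1 _)) scaler0 addr0.
rewrite !lin1 IH !ct_act1E scalerDl.
rewrite -[c *: e]mul1r -scalerAr scalerAl -scalerA ct_tenPl.
by rewrite !scalerDr !scalerA (mulrC d) addrACA.
Qed.

Fact ct_act2_bilin : bilin ct_act2.
Proof.
split=> [m c e e'|e]; last exact: lin2.
elim/ct_ind: m => [|d i j x y t IH].
  by rewrite !(linear0f (lin2 _)) scaler0 addr0.
rewrite !lin2 IH !ct_act2E scalerDl.
rewrite -[c *: e]mul1r -scalerAr scalerAl -scalerA ct_tenPr.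
by rewrite !scalerDr !scalerA (mulrC d) addrACA.
Qed.

Lemma act1_lin e : linear (ct_act1 e). Proof. exact: lin1. Qed.
Lemma act2_lin f : linear (ct_act2 f). Proof. exact: lin2. Qed.

Definition ct_action : biaction E F (ct_obj n).
Proof.
apply: (Biaction ct_act1_bilin ct_act2_bilin) => [m|m|e e' m|e e' m|e f m].
- move: m; apply: ct_ext => [|//|i j x y]; first exact: lin1.
  by rewrite ct_act1E scale1r.
- move: m; apply: ct_ext => [|//|i j x y]; first exact: lin2.
  by rewrite ct_act2E scale1r.
- move: m; apply: ct_ext => [|c u v|i j x y]; first exact: lin1.
    by rewrite (lin1 e') (lin1 e).
  by rewrite !ct_act1E scalerA.
- move: m; apply: ct_ext => [|c u v|i j x y]; first exact: lin2.
    by rewrite (lin2 e') (lin2 e).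
  by rewrite !ct_act2E scalerA.
- move: m; apply: ct_ext => [c u v|c u v|i j x y].
  + by rewrite (lin2 f) (lin1 e).
  + by rewrite (lin1 e) (lin2 f).
  by rewrite ct_act1E !ct_act2E ct_act1E.
Defined.

Definition ct_mod : lmodType (talg E F) := bimod ct_action.

Lemma ct_scaleE e f i j (x : X i) (y : Y j) :
  (e \ox f) *: (ct_ten n x y : ct_mod) = ct_ten n (e *: x) (f *: y).
Proof. by rewrite bimod_scaleE /= ct_act2E ct_act1E. Qed.
End Action.

(* d(x (x) y) = dx (x) y + (-1)^i x (x) dy for x of degree i. *)
Definition ct_phi n m i j (x : X i) (y : Y j) : ct_obj m :=
  if m == n + 1 then
    ct_ten m (cdiff X i (i + 1) x) y + ct_ten m x (cdiff Y j (j + 1) y) *~ csign i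
  else 0.

Fact ct_phi_multi n m : ct_multi n (@ct_phi n m).
Proof.
rewrite /ct_phi; case: eqP => [->|_]; last first.
  by split=> *; rewrite ?scaler0 ?addr0.
split=> [i j c x x' y|i j c x y y'|i j x y ij].
- rewrite linearP !ct_tenPl mulrzDl scalerDr -scalerMzr addrACA.
  by [].
- rewrite linearP !ct_tenPr mulrzDl scalerDr -scalerMzr addrACA.
  by [].
rewrite !ct_ten0 ?mul0rz ?addr0 // => H; apply: ij.
  by apply: (@addIr _ 1); rewrite -H addrA.
by apply: (@addIr _ 1); rewrite -H addrAC.
Qed.

Definition ct_diff n m : ct_mod n -> ct_mod m := ct_lift (@ct_phi n m).

Let dlin n m : linear (@ct_diff n m : ct_obj n -> ct_obj m) :=
  ct_lift_linear (ct_phi_multi n m).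

Lemma ct_diffE n m i j (x : X i) (y : Y j) :
  ct_diff m (ct_ten n x y) = ct_phi n m x y.
Proof. exact: (ct_liftE (ct_phi_multi n m)). Qed.

Fact ct_diff_linear n m : linear (@ct_diff n m).
Proof.
apply: tens_linear => [x y|e f].
  by have := @dlin n m 1 x y; rewrite !scale1r.
move=> t; rewrite !bimod_scaleE /=.
move: t; apply: ct_ext => [c u v|c u v|i j x y].
- by rewrite (act2_lin f) (act1_lin e) (@dlin n m).
- by rewrite (@dlin n m) (act2_lin f) (act1_lin e).
rewrite ct_act2E ct_act1E !ct_diffE /ct_phi; case: eqP => _; last first.
  by rewrite (linear0f (act2_lin f)) (linear0f (act1_lin e)).
rewrite !linearZ /= (linearDf (act2_lin f)) (linearDf (act1_lin e)).
rewrite (linearMzf (act2_lin f)) (linearMzf (act1_lin e)).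
by rewrite !ct_act2E !ct_act1E.
Qed.

HB.instance Definition _ n m := GRing.isLinear.Build (talg E F)
  (ct_mod n) (ct_mod m) _ (@ct_diff n m) (@ct_diff_linear n m).

Definition ctensor : complex (talg E F).
Proof.
exists ct_mod (fun n m => @ct_diff n m : {linear _ -> _}).
  move=> n m t /negPf nm /=; move: t; apply: ct_ext => [|c u v|i j x y].
  - exact: dlin.
  - by rewrite scaler0 addr0.
  by rewrite ct_diffE /ct_phi nm.
move=> n m l /=; apply: ct_ext => [c u v|c u v|i j x y].
- by rewrite !dlin.
- by rewrite scaler0 addr0.
rewrite ct_diffE /ct_phi; case: eqP => _; last exact: (linear0f (@dlin m l)).
rewrite (linearDf (@dlin m l)) (linearMzf (@dlin m l)) !ct_diffE /ct_phi.
case: eqP => _; last by rewrite mul0rz addr0.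
rewrite !cdiffK !ct_ten_0l ?ct_ten_0r csignS.
by rewrite mulrNz mul0rz add0r addr0 addNr.
Defined.
End TensorComplex.

(* Hom_E(X, Y) for a complex X of left E-modules and a complex Y of          *)
(* E (x) F-modules: a cochain of degree n is a family of E-linear maps       *)
(* X^i -> Y^(i + n), and F acts through its action on Y.                     *)
Section HomComplex.
Variables (k : fieldType) (E F : algType k).
Variables (X : complex E) (Y : complex (talg E F)).

Record cochain (n : int) := Cochain {
  cochain_fun :> forall i j, X i -> Y j;
  cochain_lin : forall i j e x x',
    @cochain_fun i j (e *: x + x')
      = (e \ox 1) *: @cochain_fun i j x + @cochain_fun i j x';
  cochain_deg : forall i j x, j != i + n -> @cochain_fun i j x = 0 }.

Section Degree.
Variable n : int.
Implicit Types f g h : cochain n.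

Lemma cochainP f g : (forall i j x, f i j x = g i j x) -> f = g.
Proof.
case: f g => [f fl fd] [g gl gd] /= fg.
have {}fg : f = g.
  by apply: functional_extensionality_dep => i;
     apply: functional_extensionality_dep => j;
     apply: functional_extensionality_dep => x; apply: fg.
by subst g; congr Cochain; apply: Prop_irrelevance.
Qed.

HB.instance Definition _ := gen_eqMixin (cochain n).
HB.instance Definition _ := gen_choiceMixin (cochain n).

Definition cochain0 : cochain n.
Proof.
by exists (fun i j x => 0) => [i j e x x'|//]; rewrite scaler0 addr0.
Defined.

Definition cochain_add f g : cochain n.
Proof.
exists (fun i j x => f i j x + g i j x) => [i j e x x'|i j x ij].
  by rewrite !cochain_lin scalerDr addrACA.
by rewrite !cochain_deg // addr0.
Defined.

Definition cochain_opp f : cochain n.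
Proof.
exists (fun i j x => - f i j x) => [i j e x x'|i j x ij].
  by rewrite cochain_lin opprD scalerN.
by rewrite cochain_deg // oppr0.
Defined.

Definition cochain_scale (t : F) f : cochain n.
Proof.
exists (fun i j x => (1 \ox t) *: f i j x) => [i j e x x'|i j x ij].
  by rewrite cochain_lin scalerDr !scalerA !atenM !mulr1 !mul1r.
by rewrite cochain_deg // scaler0.
Defined.

Fact cochain_addA : associative cochain_add.
Proof. by move=> f g h; apply: cochainP => i j x; exact: addrA. Qed.
Fact cochain_addC : commutative cochain_add.
Proof. by move=> f g; apply: cochainP => i j x; exact: addrC. Qed.
Fact cochain_add0 : left_id cochain0 cochain_add.
Proof. by move=> f; apply: cochainP => i j x; exact: add0r. Qed.
Fact cochain_addN : left_inverse cochain0 cochain_opp cochain_add.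
Proof. by move=> f; apply: cochainP => i j x; exact: addNr. Qed.
HB.instance Definition _ := GRing.isZmodule.Build (cochain n)
  cochain_addA cochain_addC cochain_add0 cochain_addN.

Fact cochain_scaleA s t f :
  cochain_scale s (cochain_scale t f) = cochain_scale (s * t) f.
Proof. by apply: cochainP => i j x /=; rewrite scalerA atenM mul1r. Qed.
Fact cochain_scale1 : left_id 1 cochain_scale.
Proof. by move=> f; apply: cochainP => i j x /=; rewrite aten1 scale1r. Qed.
Fact cochain_scaleDr : right_distributive cochain_scale +%R.
Proof. by move=> t f g; apply: cochainP => i j x; exact: scalerDr. Qed.
Fact cochain_scaleDl f : {morph cochain_scale^~ f : s t / s + t}.
Proof.
by move=> s t; apply: cochainP => i j x /=; rewrite atenDr scalerDl.
Qed.
HB.instance Definition _ := GRing.Zmodule_isLmodule.Build F (cochain n)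
  cochain_scaleA cochain_scale1 cochain_scaleDr cochain_scaleDl.
End Degree.

Lemma cochainD n (f g : cochain n) i j x : (f + g) i j x = f i j x + g i j x.
Proof. by []. Qed.
Lemma cochainZ n (t : F) (f : cochain n) i j x :
  (t *: f) i j x = (1 \ox t) *: f i j x.
Proof. by []. Qed.
Lemma cochain_zero n i j x : (0 : cochain n) i j x = 0.
Proof. by []. Qed.

Lemma cochain_map0 n (f : cochain n) i j : f i j 0 = 0.
Proof.
have := cochain_lin f (i := i) j 1 0 0.
rewrite scaler0 addr0 aten1 scale1r => /eqP.
by rewrite -subr_eq0 opprD addrA subrr sub0r oppr_eq0 => /eqP.
Qed.

(* df = d o f - (-1)^n f o d. *)
Definition hom_diff_fun n m (f : cochain n) i j (x : X i) : Y j :=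
  if m == n + 1 then
    cdiff Y (j - 1) j (f i (j - 1) x)
      - f (i + 1) j (cdiff X i (i + 1) x) *~ csign n
  else 0.

Definition hom_diff n m (f : cochain n) : cochain m.
Proof.
exists (hom_diff_fun m f) => [i j e x x'|i j x ij]; rewrite /hom_diff_fun.
  case: eqP => _; last by rewrite scaler0 addr0.
  rewrite linearP !cochain_lin linearP mulrzDl opprD addrACA.
  by rewrite scalerBr scalerMzr.
case: eqP => // mn; rewrite mn in ij.
rewrite !cochain_deg ?linear0 ?mul0rz ?subr0 //.
  by rewrite -addrA [1 + n]addrC.
by apply: contraNneq ij => H; rewrite addrA -H addrNK.
Defined.

Fact hom_diff_linear n m : linear (@hom_diff n m).
Proof.
move=> t f g; apply: cochainP => i j x.
rewrite cochainD cochainZ /= /hom_diff_fun; case: eqP => _; last first.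
  by rewrite scaler0 addr0.
rewrite !cochainD !cochainZ linearP mulrzDl opprD addrACA.
by rewrite scalerBr scalerMzr.
Qed.
HB.instance Definition _ n m := GRing.isLinear.Build F
  (cochain n) (cochain m) _ (@hom_diff n m) (@hom_diff_linear n m).

Definition hom_complex : complex F.
Proof.
exists (fun n => cochain n : lmodType F)
       (fun n m => @hom_diff n m : {linear _ -> _}).
  move=> n m f /negPf nm; apply: cochainP => i j x /=.
  by rewrite /hom_diff_fun nm.
move=> n m l f; apply: cochainP => i j x /=; rewrite /hom_diff_fun /=.
case: eqP => // _; rewrite /hom_diff_fun; case: eqP => [->|_]; last first.
  by rewrite linear0 mul0rz subr0.
rewrite linearB /= !cdiffK cochain_map0 mul0rz sub0r subr0 csignS.
by rewrite mulrNz opprK raddfMz addNr.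
Defined.
End HomComplex.

Section Resolutions.
Variable E : pzRingType.

Definition proj_resolution (M : lmodType E) (P : complex E)
    (f : cmap P (stalk 0 M)) : Prop :=
  [/\ qiso f, forall i, projective_module (P i) &
      forall i : int, 0 < i -> zero_at P i].

Definition inj_resolution (X I : complex E) (f : cmap X I) : Prop :=
  [/\ qiso f, forall i, injective_module (I i) &
      exists a : int, forall i, i < a -> zero_at I i].

Definition finite_injdim (X : complex E) : Prop :=
  exists (I : complex E) (f : cmap X I) (b : int),
    inj_resolution f /\ forall i, b < i -> zero_at I i.

Definition injdim_le (M : lmodType E) (n : nat) : Prop :=
  exists (I : complex E) (f : cmap (stalk 0 M) I),
    [/\ inj_resolution f, forall i, i < 0 -> zero_at I i &
        forall i, n%:Z < i -> zero_at I i].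

Definition injdim_eq (M : lmodType E) (n : nat) : Prop :=
  injdim_le M n /\ forall m, (m < n)%N -> ~ injdim_le M m.

Definition bounded_cohomology (X : complex E) : Prop :=
  exists a b : int, forall i, i < a \/ b < i -> acyclic_at X i.

Definition fg_cohomology_at (X : complex E) (i : int) : Prop :=
  exists (n : nat) (g : 'I_n -> X i), (forall j, cocycle (g j)) /\
    forall x : X i, cocycle x ->
      exists c : 'I_n -> E, coboundary (x - \sum_j c j *: g j).

(* For X with bounded cohomology this says that \bigoplus_i H^i(X) is        *)
(* finitely generated.                                                       *)
Definition fg_cohomology (X : complex E) : Prop :=
  forall i, fg_cohomology_at X i.

Definition left_noetherian : Prop :=
  forall J : E -> Prop,
    J 0 -> (forall x y, J x -> J y -> J (x + y)) ->
    (forall e x, J x -> J (e * x)) ->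
    exists (n : nat) (g : 'I_n -> E), (forall j, J (g j)) /\
      forall x, J x -> exists c : 'I_n -> E, x = \sum_j c j * g j.
End Resolutions.

Definition noetherian (E : pzRingType) : Prop :=
  left_noetherian E /\ left_noetherian E^c.

(* [eps : B -> k] is a character; [triv eps] is the left module B / ker eps. *)
Definition triv (k : fieldType) (B : algType k) (eps : {lrmorphism B -> k^o}) :
  lmodType B := restr eps (k^o)^o.
Arguments triv {k} B eps.

Section ConverseMorphism.
Variables (k : fieldType) (A : algType k) (eps : {lrmorphism A -> k^o}).
Definition conv_fun : A^c -> k^o := eps.
Fact conv_fun_linear : linear conv_fun.
Proof. by move=> c x y; exact: (linearP eps). Qed.
Fact conv_fun_monoid : monoid_morphism conv_fun.
Proof.
split=> [|x y]; first exact: (rmorph1 eps).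
by rewrite mulrC; exact: (rmorphM eps).
Qed.
HB.instance Definition _ :=
  GRing.isLinear.Build k A^c k^o _ conv_fun conv_fun_linear.
HB.instance Definition _ :=
  GRing.isMonoidMorphism.Build A^c k^o conv_fun conv_fun_monoid.
Definition conv_char : {lrmorphism A^c -> k^o} := conv_fun.
End ConverseMorphism.

(* Explicit, since A^c and A have convertible carriers and unification could *)
(* otherwise confuse the two.                                                *)
Arguments conv_char {k} A eps.

Section Gorenstein.
Variables (k : fieldType) (B : algType k) (eps : {lrmorphism B -> k^o}).

(* The complex of right B-modules computing Ext_B(k, B) from a projective    *)
(* resolution P of k, with the action induced by right multiplication on B.  *)
(* Below P ranges over all such resolutions: they exist and are homotopy     *)
(* equivalent, so the choice does not matter.                                *)
Definition ext_complex (P : complex B) : complex B^c :=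
  hom_complex (E := B) (F := B^c) P (stalk 0 (regbim B)).

Definition one_dim_cohomology_at (X : complex B^c) (i : int) : Prop :=
  exists z : X i, [/\ cocycle z, ~ coboundary z &
    forall x : X i, cocycle x ->
      exists c : k, coboundary (x - (c%:A : B^c) *: z)].

Definition left_AS (d : nat) : Prop :=
  injdim_eq (B^o : lmodType B) d /\
  forall (P : complex B) (f : cmap P (stalk 0 (triv B eps))),
    proj_resolution f ->
    one_dim_cohomology_at (ext_complex P) d%:Z /\
    forall i : int, i <> d%:Z -> acyclic_at (ext_complex P) i.

(* The right B-module Ext^d_B(k, B) is annihilated by b - chi b for all b.   *)
Definition left_integral_char (d : nat) (chi : {lrmorphism B -> k^o}) : Prop :=
  forall (P : complex B) (f : cmap P (stalk 0 (triv B eps))),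
    proj_resolution f ->
    forall z : ext_complex P d%:Z, cocycle z ->
    forall b : B,
      coboundary ((b : B^c) *: z - ((chi b : k)%:A : B^c) *: z).
End Gorenstein.

Arguments left_AS {k} B eps d.
Arguments left_integral_char {k} B eps d chi.

Definition AS_Gorenstein (k : fieldType) (A : algType k)
    (eps : {lrmorphism A -> k^o}) (d : nat) : Prop :=
  [/\ noetherian A, left_AS A eps d & left_AS A^c (conv_char A eps) d].

Section Hopf.
Variables (k : fieldType) (A : algType k).

Definition tassoc (U V W : lmodType k) :
    tensor (tensor U V) W -> tensor U (tensor V W) :=
  tlift (fun t w => tlift (fun u v => tens u (tens v w)) t).

Record hopf := Hopf {
  comul : {lrmorphism A -> talg A A};
  counit : {lrmorphism A -> k^o};
  antipode : {linear A -> A};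
  hopf_coassoc : forall a,
    tassoc (alift (fun x y => tens (comul x : tensor A A) y) (comul a))
      = alift (fun x y => tens x (comul y : tensor A A)) (comul a);
  hopf_counitl : forall a, alift (fun x y => (counit x : k) *: y) (comul a) = a;
  hopf_counitr : forall a, alift (fun x y => (counit y : k) *: x) (comul a) = a;
  hopf_antipodel : forall a,
    alift (fun x y => antipode x * y) (comul a) = (counit a : k)%:A;
  hopf_antipoder : forall a,
    alift (fun x y => x * antipode y) (comul a) = (counit a : k)%:A }.

(* xi(a) = sum chi(a_1) a_2. *)
Definition left_winding (H : hopf) (chi : {lrmorphism A -> k^o}) (a : A) : A :=
  alift (fun x y => (chi x : k) *: y) (comul H a).
End Hopf.

Section Dualising.
Variables (k : fieldType) (A : algType k).
Local Notation Ae := (talg A A^c).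

Definition left_part (X : complex Ae) : complex A := crestr (tinl A A^c) X.
Definition right_part (X : complex Ae) : complex A^c := crestr (tinr A A^c) X.

(* A -> RHom_A(R, R) sends a to r |-> r a, and A -> RHom_{A^op}(R, R) sends  *)
(* a to r |-> a r; both Homs are computed with an injective resolution       *)
(* f : R -> I by bimodules.  A morphism of complexes is invertible in the    *)
(* derived category iff it is a quasi-isomorphism.                           *)
Definition left_canonical_iso (R I : complex Ae) (f : cmap R I) : Prop :=
  exists c : cmap (stalk 0 (A^c^o : lmodType A^c))
         (hom_complex (E := A) (F := A^c) (left_part R) I),
    (forall (a : stalk 0 (A^c^o : lmodType A^c) 0) i (r : R i),
       (c 0 a : cochain _ _ _) i i r = f i ((1 \ox (stalk_val a : A^c)) *: r))
    /\ qiso c.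

Definition right_canonical_iso (R I : complex Ae) (f : cmap R I) : Prop :=
  exists c : cmap (stalk 0 (A^o : lmodType A))
         (hom_complex (E := A^c) (F := A)
            (right_part R) (crestr (tswap A^c A) I)),
    (forall (a : stalk 0 (A^o : lmodType A) 0) i (r : R i),
       (c 0 a : cochain _ _ _) i i r = f i (((stalk_val a : A) \ox 1) *: r))
    /\ qiso c.

Definition dualising (R : complex Ae) : Prop :=
  [/\ bounded_cohomology R,
      finite_injdim (left_part R) /\ finite_injdim (right_part R),
      fg_cohomology (left_part R) /\ fg_cohomology (right_part R) &
      exists (I : complex Ae) (f : cmap R I),
        [/\ inj_resolution f, left_canonical_iso f & right_canonical_iso f]].

(* R (x) R^op, with (a (x) b) (x) (b' (x) a') in A^e (x) A^e acting by       *)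
(* r (x) s |-> a r a' (x) b' s b: the first A^e is the left A^e-structure,   *)
(* and the second one turns the remaining right structures into the          *)
(* structure b' (-) a' of an A-bimodule.                                     *)
Definition tensor_op (R : complex Ae) : complex (talg Ae Ae) :=
  crestr (tinterchange A A^c A A^c) (ctensor R R).

Definition rigid (R : complex Ae) : Prop :=
  exists (I : complex (talg Ae Ae)) (f : cmap (tensor_op R) I),
    inj_resolution f /\
    derived_iso R (hom_complex (E := Ae) (F := Ae) (stalk 0 (regbim A)) I).

(* The bimodule a . m . b = nu(a) m b. *)
Definition twist (nu : {lrmorphism A -> A}) (M : lmodType Ae) : lmodType Ae :=
  restr (tmap nu (idfun : {lrmorphism A^c -> A^c})) M.

Definition nakayama (d : nat) (nu : {lrmorphism A -> A}) : Prop :=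
  bijective nu /\
  let R := stalk (- d%:Z) (twist nu (regbim A)) in dualising R /\ rigid R.
End Dualising.

(* Main.v *)
(* Along delta : a |-> sum a_1 (x) S(a_2) the algebra A^e is a free right      *)
(* A-module and A = A^e (x)_A k, so a resolution P of k by free modules of    *)
(* finite rank, which exists as A is noetherian, induces one of A over A^e,   *)
(* and Ext_{A^e}(A, A (x) A) is computed by Hom_A(P, A (x) A) for the adjoint *)
(* action a . (r (x) s) = a_1 r (x) s S(a_2).  The map                        *)
(* x (x) y |-> x_1 (x) y S(x_2) identifies the adjoint module with copies of  *)
(* A indexed by the vector space A; since P has finite rank, Ext is           *)
(* Ext_A(k, A) (x) A, and the Gorenstein condition leaves one copy of A in    *)
(* degree d.  Transporting right multiplication by a through the map gives    *)
(* y |-> pi0(a_1) y S^2(a_2) = y nu(a) with nu = S^2 xi.  With coefficients   *)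
(* R (x) R^op, R the twist of A by mu, the bimodule becomes A with            *)
(* b . y . a = mu(b) y nu(mu^-1(a)).  For mu = nu it is R itself, so R is     *)
(* rigid; and if it is isomorphic to R then the image c of 1 is a unit with   *)
(* mu(b) c = c nu(b), which is uniqueness up to inner automorphisms.          *)
Require Import Defs.
From HB Require Import structures.
From mathcomp Require Import all_boot all_order all_algebra.
From mathcomp Require Import boolp classical_sets.

Set Implicit Arguments.
Unset Strict Implicit.
Unset Printing Implicit Defensive.

Import Order.TTheory GRing.Theory Num.Theory.
Local Open Scope ring_scope.

(** * Linear algebra over a field *)

(** Rigidity is a statement about the bimodule Ext_{A^e}(A, R (x) R^op), and the Hopf structure
    reduces Ext over A^e to Ext over A of the trivial module. A^e is free as a right A-module along
    [delta] ([env_isoK], [env_iso_invK], [env_iso_mulr]) and A is A^e modulo A^e delta(ker eps)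
    ([annihilatedP]), so the matrices of a finite rank free resolution of k also resolve A over A^e
    ([env_mx_exact]). Restricted along [delta], R (x) R^op is free over A on the vector space A
    ([adjK], [adj_invK], [adj_ten_compatible]). Cohomology over it is therefore Ext_A(k, A) (x) A,
    because over a field a complex stays exact, and a nontrivial class stays nontrivial, after
    tensoring ([opm_exact], [opm_cokernel]). The Gorenstein condition leaves one class z in degree
    d, with coefficients y in A.

    The automorphism nu comes from the bimodule structure that remains. By [adj_mulr], right
    multiplication becomes right multiplication by a_1 on z and by S^2(a_2) on y; modulo
    coboundaries the first is the scalar pi0(a_1), and the sum of pi0(a_1) S^2(a_2) is S^2 xi(a).
    This is [col_act], and it gives [ext_twisted] for the twist by any automorphism mu. For mu = nu
    the result is R itself; for a general mu, an isomorphism with R produces the unit that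
    conjugates nu into mu ([ext_class_unique]).

    Rigidity is formulated with injective resolutions, whereas z (x) y lives on the projective side.
    The two computations of Ext are matched by a staircase argument ([zigzag_hom_col],
    [zigzag_col_hom], [zigzag_cobound]), packaged in [transfer_exists]. That R is dualising is
    easier: on each side it is free of rank one ([twist_dualising]). *)

Section LinearComplement.
Variables (k : fieldType) (V : lmodType k).

Definition lclosed (S : V -> Prop) :=
  forall (c : k) x y, S x -> S y -> S (c *: x + y).

(** By Zorn, W is maximal among the subspaces that meet S trivially: if x were outside S + W, the
    span of W and x would still meet S trivially. *)
Lemma complement_exists (S : V -> Prop) : S 0 -> lclosed S ->
  exists W : V -> Prop, [/\ W 0, lclosed W, forall x, S x -> W x -> x = 0 &
    forall x, exists2 s, S s & W (x - s)].
Proof.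
move=> S0 Sc.
pose P (W : set V) := lclosed W /\ forall x, S x -> W x -> x = 0.
have [F FP tF|W [[Wc WS] Wmax]] := @Zorn_bigcup V P.
  split=> [c x y [X FX Xx] [Y FY Yy]|x Sx [X /FP[_ XS] Xx]]; last exact: XS.
  case: (tF X Y FX FY) => XY.
    by exists Y => //; apply: (FP Y FY).1 => //; apply: XY.
  by exists X => //; apply: (FP X FX).1 => //; apply: XY.
have Sop c x : S x -> S (c *: x) by move=> Sx; rewrite -[_ *: _]addr0; apply: Sc.
(* [lclosed] admits the empty predicate; maximality against the zero subspace excludes it. *)
have W0 : W 0.
  apply: contrapT => nW0; apply: (Wmax [set 0]%classic).
    split=> [x Wx|/(_ 0 erefl)//]; exfalso; apply: nW0.
    by have := Wc (-1) x x Wx Wx; rewrite scaleN1r addNr.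
  by split=> [c x y -> ->|//]; rewrite /= scaler0 addr0.
have Wop c x : W x -> W (c *: x) by move=> Wx; rewrite -[_ *: _]addr0; apply: Wc.
exists W; split=> // x.
apply: contrapT => /forall2NP nx.
pose W' : set V := fun y => exists w c, W w /\ y = w + c *: x.
apply: (Wmax W').
  split=> [w Ww|WW']; first by exists w, 0; rewrite scale0r addr0.
  case: (nx 0) => //; apply; rewrite subr0; apply: WW'.
  by exists 0, 1; rewrite scale1r add0r.
split=> [c y z [w [e [Ww ->]]] [w' [e' [Ww' ->]]]|y Sy [w [c [Ww yE]]]].
  exists (c *: w + w'), (c * e + e'); split; first exact: Wc.
  by rewrite scalerDr scalerDl scalerA addrACA.
have [c0|c0] := eqVneq c 0.
  by apply: WS => //; rewrite yE c0 scale0r addr0.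
exfalso; case: (nx (c^-1 *: y)) => [|]; first by apply; apply: Sop.
apply; rewrite yE scalerDr scalerA mulVf // scale1r opprD addrCA subrr addr0.
by rewrite -scaleNr; apply: Wop.
Qed.

End LinearComplement.

Lemma linearBf (R : pzRingType) (U V : lmodType R) (f : U -> V) x y :
  linear f -> f (x - y) = f x - f y.
Proof.
by move=> lf; rewrite addrC -scaleN1r lf scaleN1r addrC.
Qed.

Lemma linearZf (R : pzRingType) (U V : lmodType R) (f : U -> V) c x :
  linear f -> f (c *: x) = c *: f x.
Proof. by move=> lf; rewrite -[c *: x]addr0 lf (linear0f lf) addr0. Qed.

(** With C a complement of the kernel and D one of the image, r sends w to the unique v in C with w
    - g v in D. Splittings over k enter later proofs through such an r. *)
Lemma generalised_inverse (k : fieldType) (V W : lmodType k) (g : V -> W) :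
  linear g -> exists r : {linear W -> V}, forall x, g (r (g x)) = g x.
Proof.
move=> lg; have g0 := linear0f lg.
have kerc : lclosed (fun x => g x = 0).
  by move=> c x y gx gy; rewrite lg gx gy scaler0 addr0.
have [C [C0 Cc Ck CP]] := complement_exists g0 kerc.
have imc : lclosed (fun w => exists x, w = g x).
  by move=> c _ _ [x ->] [y ->]; exists (c *: x + y); rewrite lg.
have im0 : exists x, 0 = g x by exists 0; rewrite g0.
have [D [D0 Dc DS DP]] := complement_exists im0 imc.
have ex w : exists v, C v /\ D (w - g v).
  have [_ [x ->] Dx] := DP w; have [y gy Cy] := CP x.
  by exists (x - y); split => //; rewrite (linearBf _ _ lg) gy subr0.
have sub (U : lmodType k) (X : U -> Prop) x y :
    lclosed X -> X x -> X y -> X (x - y).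
  by move=> Xc Xx Xy; have := Xc (-1) y x Xy Xx; rewrite scaleN1r addrC.
have uq w v v' : C v -> C v' -> D (w - g v) -> D (w - g v') -> v = v'.
  move=> Cv Cv' Dv Dv'; apply/eqP; rewrite -subr_eq0; apply/eqP.
  apply: Ck (sub _ _ _ _ Cc Cv Cv'); apply: DS; first by exists (v - v').
  have := sub _ _ _ _ Dc Dv' Dv.
  by rewrite opprB addrC addrA addrNK (linearBf _ _ lg).
have [r rP] := choice ex.
have lr : linear r.
  move=> c x y; have [C1 D1] := rP (c *: x + y).
  have [C2 D2] := rP x; have [C3 D3] := rP y.
  apply: (uq (c *: x + y)) => //; first exact: Cc.
  rewrite lg opprD addrACA -scalerBr; exact: Dc.
have H := GRing.isLinear.Build k W V _ r lr.
pose r' : {linear W -> V} := HB.pack r H.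
exists r' => x /=; have [Cr Dr] := rP (g x).
apply/eqP; rewrite eq_sym -subr_eq0; apply/eqP; apply: DS => //.
by exists (x - r (g x)); rewrite (linearBf _ _ lg).
Qed.

Section TensorMap.
Variables (k : fieldType) (U U' V : lmodType k).

Definition tmapl (f : U -> U') : tensor U V -> tensor U' V :=
  tlift (fun u v => tens (f u) v).

Lemma tmapl_bilin (f : U -> U') :
  linear f -> bilin (fun u v => tens (f u) v : tensor U' V).
Proof.
by move=> lf; split=> [v c x y|u c x y];
  rewrite ?lf ?(tensDl, tensDr, tensZl, tensZr).
Qed.

Lemma tmapl_linear (f : U -> U') : linear f -> linear (tmapl f).
Proof. by move=> lf; apply: tlift_linear (tmapl_bilin lf). Qed.

Lemma tmaplE (f : U -> U') u v :
  linear f -> tmapl f (tens u v) = tens (f u) v.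
Proof. by move=> lf; rewrite [LHS](tliftE (tmapl_bilin lf)). Qed.
End TensorMap.

(** * Matrices of operators acting on columns over A (x) V *)

Section OperatorMatrices.

Definition opm (N : zmodType) m n (G : 'I_m -> 'I_n -> N -> N)
    (u : {ffun 'I_n -> N}) : {ffun 'I_m -> N} :=
  [ffun i => \sum_j G i j (u j)].

Lemma opm_linear (k : fieldType) (N : lmodType k) m n
    (G : 'I_m -> 'I_n -> N -> N) :
  (forall i j, linear (G i j)) -> linear (opm G).
Proof.
move=> lG c u v; apply/ffunP => i; rewrite !ffunE scaler_sumr -big_split /=.
by apply: eq_bigr => j _; rewrite !ffunE lG.
Qed.

Variables (k : fieldType) (A V : lmodType k) (T : zmodType).
Variables (Phi : tensor A V -> T) (Psi : T -> tensor A V).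
Hypothesis PhiD : forall x y, Phi (x + y) = Phi x + Phi y.
Hypotheses (PhiK : cancel Phi Psi) (PsiK : cancel Psi Phi).

Lemma Phi_zero : Phi 0 = 0.
Proof. by apply: (addIr (Phi 0)); rewrite -PhiD !add0r. Qed.

Definition colten n (x : tensor {ffun 'I_n -> A} V) : {ffun 'I_n -> T} :=
  [ffun i => Phi (tmapl (fun u : {ffun 'I_n -> A} => u i) x)].

Lemma proj_linear n (i : 'I_n) : linear (fun u : {ffun 'I_n -> A} => u i).
Proof. by move=> c u v; rewrite !ffunE. Qed.

Definition single n (i : 'I_n) (a : A) : {ffun 'I_n -> A} :=
  [ffun j => if j == i then a else 0].

Lemma single_linear n (i : 'I_n) : linear (single i).
Proof.
move=> c u v; apply/ffunP=> j; rewrite !ffunE.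
by case: ifP; rewrite // scaler0 addr0.
Qed.

Lemma sum_single n (u : {ffun 'I_n -> A}) : u = \sum_i single i (u i).
Proof.
apply/ffunP=> j; rewrite sum_ffunE (bigD1 j) //= ffunE eqxx big1 ?addr0 // => i.
by rewrite ffunE eq_sym => /negPf->.
Qed.

Lemma coltenE n (z : {ffun 'I_n -> A}) y :
  colten (tens z y) = [ffun i => Phi (tens (z i) y)].
Proof.
by apply/ffunP=> i; rewrite !ffunE (tmaplE _ _ (@proj_linear n i)).
Qed.

Lemma coltenD n (x y : tensor {ffun 'I_n -> A} V) :
  colten (x + y) = colten x + colten y.
Proof.
apply/ffunP=> i; rewrite !ffunE -PhiD; congr Phi.
exact: (linearDf (tmapl_linear (@proj_linear n i))).
Qed.

Lemma colten0 n : @colten n 0 = 0.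
Proof. by apply: (addIr (colten 0)); rewrite -coltenD !add0r. Qed.

Definition uncol n (t : {ffun 'I_n -> T}) : tensor {ffun 'I_n -> A} V :=
  \sum_i tmapl (single i) (Psi (t i)).

Lemma tmapl_comp (U U' U'' : lmodType k) (f : U' -> U'') (g : U -> U') :
  linear f -> linear g ->
  tmapl (V := V) (f \o g) =1 tmapl (V := V) f \o tmapl (V := V) g.
Proof.
move=> lf lg; have lfg : linear (f \o g) by move=> c x y /=; rewrite lg lf.
apply: tens_ext => [|c x y|x y /=]; first exact: tmapl_linear.
  by rewrite /= !tmapl_linear.
by rewrite !tmaplE.
Qed.

Lemma coltenK n : cancel (@colten n) (@uncol n).
Proof.
move=> x; elim/tensor_ind: x => [|c z y x IH].
  rewrite colten0 /uncol big1 // => i _.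
  by rewrite ffunE -Phi_zero PhiK (linear0f (tmapl_linear (single_linear i))).
have uD s t : uncol (colten s + colten t) = uncol (colten s) + uncol (@colten n t).
  rewrite /uncol -big_split; apply: eq_bigr => i _; rewrite -coltenD !ffunE !PhiK.
  rewrite (linearDf (tmapl_linear (@proj_linear n i))).
  by rewrite (linearDf (tmapl_linear (single_linear i))).
rewrite coltenD uD IH -tensZl; congr (_ + _).
rewrite /uncol coltenE; under eq_bigr => i _ do
  rewrite ffunE PhiK (tmaplE _ _ (single_linear i)).
rewrite -(big_morph (fun u => tens u y) (fun u v => tensDl u v y)
  (linear0f ((tens_bilin _ _).1 y))).
by rewrite -sum_single.
Qed.

Lemma uncolK n : cancel (@uncol n) (@colten n).
Proof.
move=> t; apply/ffunP=> j; rewrite ffunE -[RHS]PsiK; congr Phi.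
have lj := tmapl_linear (V := V) (@proj_linear n j).
rewrite (big_morph _ (linearDf lj) (linear0f lj)) (bigD1 j) //=.
rewrite -[X in X + _](tmapl_comp (@proj_linear n j) (single_linear j)).
rewrite big1 => [|i ij].
  rewrite addr0; move: (Psi _); apply: tens_ext => [| |a v].
  - by apply: tmapl_linear => c x y; rewrite /= !ffunE eqxx.
  - by move=> c x y.
  rewrite tmaplE /= ?ffunE ?eqxx // => c x y.
  by rewrite /= !ffunE eqxx.
rewrite -[LHS](tmapl_comp (@proj_linear n j) (single_linear i)).
move: (Psi _); apply: tens_ext => [| |a v].
- by apply: tmapl_linear => c x y; rewrite /= single_linear proj_linear.
- by move=> c x y; rewrite scaler0 addr0.
rewrite tmaplE /=; last by move=> c x y; rewrite /= single_linear proj_linear.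
by rewrite ffunE eq_sym (negPf ij) (linear0f ((tens_bilin _ _).1 v)).
Qed.

(** [g'] is g (x) id transported along [Phi]. Additivity is enough because a scalar can be absorbed
    into the first tensor factor. *)
Definition compatible (g : A -> A) (g' : T -> T) : Prop :=
  (forall s t, g' (s + t) = g' s + g' t) /\
  (forall a v, g' (Phi (tens a v)) = Phi (tens (g a) v)).

Lemma colten_opm m n (G : 'I_m -> 'I_n -> A -> A) (G' : 'I_m -> 'I_n -> T -> T) x :
  (forall i j, linear (G i j)) -> (forall i j, compatible (G i j) (G' i j)) ->
  colten (tmapl (opm G) x) = opm G' (colten x).
Proof.
move=> lG GG'; have lo := opm_linear lG; have lt := tmapl_linear (V := V) lo.
elim/tensor_ind: x => [|c z y x IH].
  rewrite (linear0f lt) colten0; apply/ffunP=> i; rewrite !ffunE big1 // => j _.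
  by rewrite colten0 ffunE; apply: (addIr (G' i j 0)); rewrite -(GG' i j).1 !add0r.
rewrite lt !coltenD IH tmaplE // -!tensZl.
have oD s t : opm G' (s + t) = opm G' s + opm G' t.
  apply/ffunP=> i; rewrite !ffunE -big_split; apply: eq_bigr => j _.
  by rewrite ffunE (GG' i j).1.
rewrite oD; congr (_ + _); have -> : c *: opm G z = opm G (c *: z).
  by rewrite (linearZf _ _ lo).
rewrite !coltenE; apply/ffunP=> i; rewrite !ffunE.
under [RHS]eq_bigr => j _ do rewrite !ffunE (GG' i j).2.
rewrite -(big_morph Phi PhiD Phi_zero).
rewrite -(big_morph (fun u => tens u y) (fun u v => tensDl u v y)
  (linear0f ((tens_bilin _ _).1 y))).
by under [X in Phi (tens X y) = _]eq_bigr do rewrite ffunE.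
Qed.

Variables (l m n : nat).
Variables (G : 'I_l -> 'I_m -> A -> A) (F : 'I_m -> 'I_n -> A -> A).
Variables (G' : 'I_l -> 'I_m -> T -> T) (F' : 'I_m -> 'I_n -> T -> T).
Hypotheses (lG : forall i j, linear (G i j)) (lF : forall i j, linear (F i j)).
Hypothesis GG' : forall i j, compatible (G i j) (G' i j).
Hypothesis FF' : forall i j, compatible (F i j) (F' i j).
Variable z : {ffun 'I_m -> A}.

(** Exactness over a field is split. The map e = 1 - rG projects onto the kernel of G, and a
    generalised inverse s of h : (w, c) |-> F w + c z satisfies e = h s e. This k-linear identity
    survives tensoring with V; its c-component contracts the given tensor to y. *)
Lemma opm_exact :
  (forall u, opm G u = 0 -> exists c w, u = c *: z + opm F w) ->
  forall t, opm G' t = 0 -> exists y w, t = colten (tens z y) + opm F' w.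
Proof.
move=> ex t; rewrite -(uncolK t); move: (uncol t) => x {t}.
rewrite -(colten_opm _ lG GG') -(colten0 l) => /(can_inj (@coltenK _)) Gx.
have lg := opm_linear lG; have lf := opm_linear lF.
have [r rP] := generalised_inverse lg.
pose h (p : {ffun 'I_n -> A} * k^o) := opm F p.1 + p.2 *: z.
have lh : linear h.
  move=> c p q; rewrite /h /= lf scalerDr scalerDl scalerA addrACA.
  by [].
have [s sP] := generalised_inverse lh.
pose e u := u - r (opm G u).
have le : linear e.
  by move=> c u v; rewrite /e lg linearP opprD addrACA -scalerBr.
have eP u : e u = h (s (e u)).
  have : opm G (e u) = 0 by rewrite (linearBf _ _ lg) rP subrr.
  by case/ex => c [w ew]; rewrite ew addrC -[_ + _]/(h (w, c)) sP.
pose f1 u := (s (e u)).1; pose f2 u : k^o := (s (e u)).2.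
have l1 : linear f1 by move=> c u v; rewrite /f1 le linearP.
have l2 : linear f2 by move=> c u v; rewrite /f2 le linearP.
pose y := tlift (fun u v => (f2 u : k) *: v) x.
have ly : bilin (fun u (v : V) => (f2 u : k) *: v).
  split=> [v c u u'|u c v v'] /=.
    by rewrite l2 scalerDl scalerA.
  by rewrite scalerDr !scalerA mulrC.
exists y, (colten (tmapl f1 x)).
rewrite -(colten_opm _ lF FF') -coltenD; congr colten.
transitivity (x - tmapl r (tmapl (opm G) x)).
  by rewrite Gx (linear0f (tmapl_linear (linearP r))) subr0.
rewrite /y {Gx y}; elim/tensor_ind: x => [|c u v x IH].
  rewrite (linear0f (tmapl_linear lg)) (linear0f (tmapl_linear (linearP r))).
  rewrite (linear0f (tmapl_linear l1)) (linear0f (tmapl_linear lf)).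
  by rewrite (linear0f (tlift_linear ly)) (linear0f ((tens_bilin _ _).2 z)) subrr addr0.
rewrite !(tmapl_linear lg) !(tmapl_linear (linearP r)) !(tmapl_linear l1).
rewrite (tmapl_linear lf) (tlift_linear ly) opprD addrACA IH.
rewrite tensDr tensZr [RHS]addrACA; congr (_ + _).
rewrite (tliftE ly) !tmaplE //; last exact: linearP.
rewrite -scalerBr -scalerDr; congr (_ *: _).
rewrite tensZr -tensZl -tensDl.
have -> : f2 u *: z + opm F (f1 u) = e u by rewrite eP addrC.
by apply/eqP; rewrite subr_eq -tensDl subrK.
Qed.

(** A linear form that vanishes on the image of F and is 1 at z, applied to the first tensor factor,
    turns the equation into y = 0. *)
Lemma opm_cokernel y w :
  (forall w, z <> opm F w) -> colten (tens z y) = opm F' w -> y = 0.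
Proof.
move=> nz; rewrite -(uncolK w) -(colten_opm _ lF FF') => /(can_inj (@coltenK _)).
move: (uncol w) => x {w} zx; have lf := opm_linear lF.
have [s sP] := generalised_inverse lf.
pose q u := u - opm F (s u).
have lq : linear q.
  by move=> c u v; rewrite /q linearP lf opprD addrACA -scalerBr.
have qz : q z != 0 by apply/eqP => /eqP; rewrite subr_eq0 => /eqP; exact: nz.
have [lam [ll lz]] := separating_form qz.
have ly : bilin (fun u (v : V) => (lam (q u) : k) *: v).
  split=> [v c u u'|u c v v'] /=.
    by rewrite lq ll scalerDl scalerA.
  by rewrite scalerDr !scalerA mulrC.
have := congr1 (tlift (fun u v => (lam (q u) : k) *: v)) zx.
rewrite (tliftE ly) lz scale1r => ->; elim/tensor_ind: x {zx} => [|c u v x IH].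
  by rewrite (linear0f (tmapl_linear lf)) (linear0f (tlift_linear ly)).
rewrite (tmapl_linear lf) (tlift_linear ly) IH addr0 tmaplE // (tliftE ly).
by rewrite /q sP subrr (linear0f ll) scale0r scaler0.
Qed.

End OperatorMatrices.

(** * Injective resolutions over an algebra *)

Section Transport.
Variables (E : pzRingType) (I : eqType) (N : I -> lmodType E).

Definition tr_fun i j : N i -> N j :=
  match @eqP I i j with
  | ReflectT e => fun x => ecast l (N l) e x
  | ReflectF _ => fun _ => 0
  end.

Lemma tr_fun_linear i j : linear (@tr_fun i j).
Proof.
rewrite /tr_fun; case: eqP => [e|_] c x y; last by rewrite scaler0 addr0.
by move: x y; case: j / e.
Qed.
HB.instance Definition _ i j := GRing.isLinear.Build E (N i) (N j) _
  (@tr_fun i j) (@tr_fun_linear i j).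

(* Transport along [i = j], made total so that no proof has to be carried. *)
Definition tr i j : {linear N i -> N j} := @tr_fun i j.

Lemma trE i (x : N i) : tr i i x = x.
Proof.
by rewrite /tr /= /tr_fun; case: eqP => // e; rewrite eq_axiomK.
Qed.

Lemma tr0 i j (x : N i) : i != j -> tr i j x = 0.
Proof. by rewrite /tr /= /tr_fun; case: eqP. Qed.

Lemma trK i j l (x : N i) : i = j -> tr j l (tr i j x) = tr i l x.
Proof. by move=> ij; subst j; rewrite trE. Qed.

End Transport.
Arguments tr {E I} N i j.

Section Coinduced.
Variables (k : fieldType) (L : algType k) (V : lmodType k).

(** The coinduced module Hom_k(L, V), on which l acts by (l f)(x) = f(x l). *)
Record coind := Coind {
  coind_fun :> L -> V;
  coind_lin : linear coind_fun }.

Lemma coindP (f g : coind) : f =1 g -> f = g.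
Proof.
case: f g => [f lf] [g lg] /= /funext fg; subst g; congr Coind.
exact: Prop_irrelevance.
Qed.

HB.instance Definition _ := gen_eqMixin coind.
HB.instance Definition _ := gen_choiceMixin coind.

Implicit Types f g h : coind.

Fact coind0_lin : linear (fun _ : L => 0 : V).
Proof. by move=> c x y; rewrite scaler0 addr0. Qed.
Fact coind_add_lin f g : linear (fun x => f x + g x).
Proof. by move=> c x y; rewrite !coind_lin scalerDr addrACA. Qed.
Fact coind_opp_lin f : linear (fun x => - f x).
Proof. by move=> c x y; rewrite coind_lin opprD scalerN. Qed.
Fact coind_scale_lin (l : L) f : linear (fun x => f (x * l)).
Proof. by move=> c x y; rewrite mulrDl -scalerAl coind_lin. Qed.

Definition coind0 := Coind coind0_lin.
Definition coind_add f g := Coind (coind_add_lin f g).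
Definition coind_opp f := Coind (coind_opp_lin f).
Definition coind_scale l f := Coind (coind_scale_lin l f).

Fact coind_addA : associative coind_add.
Proof. by move=> f g h; apply: coindP => x; exact: addrA. Qed.
Fact coind_addC : commutative coind_add.
Proof. by move=> f g; apply: coindP => x; exact: addrC. Qed.
Fact coind_add0 : left_id coind0 coind_add.
Proof. by move=> f; apply: coindP => x; exact: add0r. Qed.
Fact coind_addN : left_inverse coind0 coind_opp coind_add.
Proof. by move=> f; apply: coindP => x; exact: addNr. Qed.
HB.instance Definition _ := GRing.isZmodule.Build coind
  coind_addA coind_addC coind_add0 coind_addN.

Fact coind_scaleA a b f : coind_scale a (coind_scale b f) = coind_scale (a * b) f.
Proof. by apply: coindP => x /=; rewrite mulrA. Qed.
Fact coind_scale1 : left_id 1 coind_scale.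
Proof. by move=> f; apply: coindP => x /=; rewrite mulr1. Qed.
Fact coind_scaleDr : right_distributive coind_scale +%R.
Proof. by move=> a f g; apply: coindP. Qed.
Fact coind_scaleDl f : {morph coind_scale^~ f : a b / a + b}.
Proof.
by move=> a b; apply: coindP => x /=; rewrite mulrDr (linearDf (coind_lin f)).
Qed.
HB.instance Definition _ := GRing.Zmodule_isLmodule.Build L coind
  coind_scaleA coind_scale1 coind_scaleDr coind_scaleDl.

End Coinduced.

Lemma restr_in_algE (k : fieldType) (L : algType k) (M : lmodType L) c
    (x : restr (in_alg L) M) : c *: x = (c%:A : L) *: (x : M).
Proof. by []. Qed.

(** Evaluation at 1 identifies L-linear maps M -> Hom_k(L, V) with k-linear maps M -> V, and the
    latter extend because an injection of vector spaces splits. *)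
Lemma coind_injective (k : fieldType) (L : algType k) (V : lmodType k) :
  injective_module (coind L V : lmodType L).
Proof.
move=> M N i g i_inj.
pose i0 : restr (in_alg L) M -> restr (in_alg L) N := i.
have li0 : linear i0 by move=> c x y; exact: linearP.
have [r rP] := generalised_inverse li0.
have rK x : r (i0 x) = x by apply: i_inj; exact: rP.
pose g0 (x : restr (in_alg L) M) : V := g x 1.
have lg0 : linear g0.
  move=> c x y; rewrite /g0 linearP /= mul1r.
  by rewrite (linearZf _ _ (coind_lin _)).
have lh n : linear (fun x : L => g0 (r (x *: n : N))).
  move=> c x y; rewrite scalerDl -[in LHS]mulr_algl -scalerA.
  by rewrite -lg0 -linearP.
pose h n := Coind (lh n).
have lih : linear h.
  move=> l m n; apply: coindP => x /=.
  rewrite scalerDr scalerA.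
  by rewrite (raddfD r) (linearDf lg0).
have H := GRing.isLinear.Build L N (coind L V) _ h lih.
pose h' : {linear N -> coind L V} := HB.pack h H.
exists h' => x; apply: coindP => l /=.
by rewrite -linearZ rK /g0 linearZ /= mul1r.
Qed.

Section Resolve.
Variables (k : fieldType) (L : algType k).

Definition coindm (M : lmodType L) : lmodType L :=
  coind L (restr (in_alg L) M).

Section Unit.
Variable M : lmodType L.
Fact unit_lin (m : M) : linear (fun x : L => x *: m : restr (in_alg L) M).
Proof. by move=> c x y; rewrite scalerDl -[in LHS]mulr_algl -scalerA. Qed.
Definition coind_unit_fun (m : M) : coindm M := Coind (unit_lin m).
Fact coind_unit_linear : linear coind_unit_fun.
Proof. by move=> l m n; apply: coindP => x /=; rewrite scalerDr scalerA. Qed.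
HB.instance Definition _ := GRing.isLinear.Build L M (coindm M) _
  coind_unit_fun coind_unit_linear.
Definition coind_unit : {linear M -> coindm M} := coind_unit_fun.
Lemma coind_unit_inj x : coind_unit x = 0 -> x = 0.
Proof.
move=> /(congr1 (fun f : coindm M => (f : L -> _) 1)) /=.
by rewrite scale1r.
Qed.
End Unit.

(* [d] is the unit composed with a k-linear projection of C whose kernel is   *)
(* the image of [e].                                                         *)
Lemma coind_step (B C : lmodType L) (e : {linear B -> C}) :
  exists d : {linear C -> coindm C}, forall c, d c = 0 <-> exists b, c = e b.
Proof.
pose e0 : restr (in_alg L) B -> restr (in_alg L) C := e.
have le0 : linear e0 by move=> c x y; exact: linearP.
have [r rP] := generalised_inverse le0.
pose p (c : restr (in_alg L) C) := c - e0 (r c).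
have lp : linear p.
  by move=> a x y; rewrite /p linearP le0 opprD addrACA -scalerBr.
have lh c : linear (fun x : L => p (x *: c : C)).
  by move=> a x y; rewrite scalerDl -[in LHS]mulr_algl -scalerA -lp.
pose d c : coindm C := Coind (lh c).
have ld : linear d.
  move=> l x y; apply: coindP => a /=.
  by rewrite scalerDr scalerA (linearDf lp).
have H := GRing.isLinear.Build L C (coindm C) _ d ld.
pose d' : {linear C -> coindm C} := HB.pack d H.
exists d' => c; split=> [|[b ->]].
  move=> /(congr1 (fun f : coindm C => (f : L -> _) 1)) /=.
  by rewrite scale1r => /eqP; rewrite subr_eq0 => /eqP cE; exists (r c).
by apply: coindP => a /=; rewrite -linearZ; apply/eqP; rewrite subr_eq0 eq_sym;
  apply/eqP; exact: rP.
Qed.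

Definition coind_next (B C : lmodType L) (e : {linear B -> C}) :
  {linear C -> coindm C} := sval (cid (coind_step e)).
Lemma coind_nextP (B C : lmodType L) (e : {linear B -> C}) c :
  coind_next e c = 0 <-> exists b, c = e b.
Proof. exact: (svalP (cid (coind_step e))). Qed.

Variable M : lmodType L.
Fixpoint coind_obj (n : nat) : lmodType L :=
  if n is n'.+1 then coindm (coind_obj n') else M.
Fixpoint coind_diff (n : nat) : {linear coind_obj n -> coind_obj n.+1} :=
  if n is n'.+1 then coind_next (coind_diff n') else coind_unit M.

(** M itself is dropped: index 0 is the zero module, standing for all degrees before the start, and
    index n.+1 is the n-th injective term. *)
Definition res_obj (n : nat) : lmodType L :=
  if n is n'.+1 then coind_obj n else 'rV[L]_0.
Definition res_diff (n : nat) : {linear res_obj n -> res_obj n.+1} :=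
  if n is n'.+1 then coind_diff n'.+1 else \0.

End Resolve.

Section Concentrated.
Variable (E : pzRingType).

Definition concentrated (t : int) (X : complex E) : Prop :=
  forall i, i != t -> zero_at X i.

(** Together with [coboundaryE] this frees witnesses from the literal degree i - 1. If j does not
    precede i the differential vanishes and 0 is the witness. *)
Lemma coboundaryP (X : complex E) i j (x : X i) (y : X j) :
  cdiff X j i y = x -> coboundary x.
Proof.
move=> <-; have [e|ij] := eqVneq i (j + 1).
  have {e} : j = i - 1 by rewrite e addrK.
  by move=> e; subst j; exists y.
by rewrite (cdiff_shape _ ij); exists 0; rewrite linear0.
Qed.

Lemma coboundaryE (X : complex E) i j (x : X i) : i = j + 1 ->
  coboundary x -> exists y : X j, cdiff X j i y = x.
Proof. by move=> e; have {e} -> : j = i - 1 by rewrite e addrK. Qed.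

Lemma cocycleE (X : complex E) i (x : X i) :
  cocycle x -> forall j, cdiff X i j x = 0.
Proof.
move=> cx j; have [-> //|/cdiff_shape->//] := eqVneq j (i + 1).
Qed.

Lemma cocycleP (X : complex E) i j (x : X i) :
  j = i + 1 -> cdiff X i j x = 0 -> cocycle x.
Proof. by move=> ->. Qed.

Lemma stalk_concentrated (m : int) (M : lmodType E) : concentrated m (stalk m M).
Proof.
move=> i im x; suff x0 : stalk_val x = 0 by exact: val_inj.
by have := stalk_valP x; rewrite /stalk_pred (negPf im) => /eqP.
Qed.

End Concentrated.

Section Existence.
Variables (k : fieldType) (L : algType k) (t : int) (X : complex L).
Hypothesis Xt : concentrated t X.

Definition res_idx (i : int) : nat := if (i - t)%R is Posz n then n.+1 else 0%N.

Let N := res_obj (X t).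

Lemma res_diffK a b c (x : N a) :
  tr N b.+1 c (res_diff (X t) b (tr N a.+1 b (res_diff (X t) a x))) = 0.
Proof.
have [->|ab] := eqVneq b a.+1; last by rewrite (tr0 _ (i := a.+1)) 1?eq_sym // !linear0.
rewrite trE; suff -> : res_diff (X t) a.+1 (res_diff (X t) a x) = 0.
  exact: linear0.
case: a x => [|a] x; first exact: linear0.
by apply/coind_nextP; exists x.
Qed.

Definition res_cdiff (i j : int) : {linear N (res_idx i) -> N (res_idx j)} :=
  if j == i + 1 then
    (tr N (res_idx i).+1 (res_idx j) \o res_diff (X t) (res_idx i))%FUN
      : {linear N (res_idx i) -> N (res_idx j)}
  else \0.

Definition res_complex : complex L.
Proof.
exists (fun i => N (res_idx i)) res_cdiff; rewrite /res_cdiff.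
  by move=> i j x /negPf ->.
move=> i j l x; case: ifP => _ //; case: ifP => _ /=; last by rewrite !linear0.
exact: res_diffK.
Defined.

Lemma res_idx_add (n : nat) : res_idx (t + n%:Z) = n.+1.
Proof. by rewrite /res_idx addrAC subrr add0r. Qed.

Lemma res_idxP (i : int) :
  (res_idx i = 0%N /\ i != t) \/ exists n : nat, i = t + n%:Z.
Proof.
rewrite /res_idx; case e: (i - t) => [n|n].
  by right; exists n; rewrite -e addrC subrK.
by left; split=> //; rewrite -subr_eq0 e.
Qed.

Lemma res_idx_pred : res_idx (t - 1) = 0%N.
Proof. by rewrite /res_idx addrAC subrr. Qed.

Lemma res_obj0 a (x : N a) : a = 0%N -> x = 0.
Proof. by move=> a0; subst a; exact: thinmx0. Qed.

Lemma tr_inj a b (x : N a) : a = b -> tr N a b x = 0 -> x = 0.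
Proof. by move=> ab; subst b; rewrite trE. Qed.

Lemma res_diff_unit b c (x : X t) :
  tr N b.+1 c (res_diff (X t) b (tr N 1 b (coind_unit (X t) x))) = 0.
Proof.
have [->|b1] := eqVneq b 1%N; last by rewrite (tr0 _ (i := 1%N)) 1?eq_sym // !linear0.
rewrite trE; suff -> : res_diff (X t) 1 (coind_unit (X t) x) = 0.
  exact: linear0.
by apply/coind_nextP; exists x.
Qed.

Lemma res_cocycle0 a b (y : N a) : a = 1%N -> b = a.+1 ->
  tr N a.+1 b (res_diff (X t) a y) = 0 ->
  exists x, y = tr N 1 a (coind_unit (X t) x).
Proof.
move=> a1 ba; subst b a; rewrite !trE => /coind_nextP[x ->].
by exists x; rewrite trE.
Qed.

Lemma res_cocycleS n a b c (y : N a) : a = n.+2 -> b = a.+1 -> c = n.+1 ->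
  tr N a.+1 b (res_diff (X t) a y) = 0 ->
  exists z : N c, tr N c.+1 a (res_diff (X t) c z) = y.
Proof.
move=> an ba cn; subst b c a; rewrite !trE => /coind_nextP[x ->].
by exists x; rewrite trE.
Qed.

Definition res_map_fun (i : int) (x : X i) : N (res_idx i) :=
  tr N 1 (res_idx i) (coind_unit (X t) (tr (cobj X) i t x)).
Fact res_map_linear i : linear (@res_map_fun i).
Proof. by move=> c x y; rewrite /res_map_fun !linearP. Qed.
HB.instance Definition _ i := GRing.isLinear.Build L (X i) (N (res_idx i)) _
  (@res_map_fun i) (@res_map_linear i).

Definition res_map : cmap X res_complex.
Proof.
exists (fun i => @res_map_fun i : {linear X i -> res_complex i}) => i j x.
have [e|it] := eqVneq i t; last by rewrite (Xt it x) !linear0.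
rewrite /= /res_cdiff; case: eqP => [ej|/eqP ij]; last first.
  by rewrite cdiff_shape // linear0.
subst i; rewrite /= /res_map_fun res_diff_unit.
rewrite (Xt _ (cdiff X t j x)) ?linear0 // ej -subr_eq0 addrAC subrr add0r.
by [].
Defined.

Lemma res_mapP : inj_resolution res_map.
Proof.
split=> [i|i|].
- split=> [x _ fx|y].
    have [e|it] := eqVneq i t; last first.
      by exists 0; rewrite linear0 (Xt it x).
    subst i; case: fx => y; rewrite (res_obj0 (a := res_idx (t - 1)) y); last first.
      exact: res_idx_pred.
    rewrite linear0 => /esym /= /tr_inj /=.
    have -> : res_idx t = 1%N by rewrite -[t]addr0 (res_idx_add 0).
    move=> /(_ erefl) /coind_unit_inj; rewrite trE => ->.
    by exists 0; rewrite linear0.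
  case: (res_idxP i) => [[i0 it] _|[n e]].
    exists 0; split; first by rewrite /cocycle linear0.
    by exists 0; rewrite linear0 (res_obj0 (a := res_idx i) (y - _)).
  subst i; rewrite /cocycle /= /res_cdiff eqxx /=.
  have en := res_idx_add n; have eS : res_idx (t + n%:Z + 1) = (res_idx (t + n%:Z)).+1.
    by rewrite -addrA -PoszD addn1 !res_idx_add.
  case: n y en eS => [|n] y en eS.
    case/(res_cocycle0 en eS) => x ->.
    exists (tr (cobj X) t (t + 0%:Z) x); split.
      by apply: Xt; rewrite addr0 -subr_eq0 addrAC subrr.
    exists 0; rewrite linear0 /= /res_map_fun trK ?addr0 // trE subrr.
    by [].
  case/(res_cocycleS en eS (res_idx_add n)) => z <-.
  exists 0; split; first by rewrite linear0.
  apply: (@coboundaryP _ res_complex _ (t + n%:Z) _ z) => /=.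
  by rewrite /res_cdiff -addrA -PoszD addn1 eqxx linear0 subr0.
- rewrite /=; case: (res_idx i) => [|n]; last exact: coind_injective.
  move=> A B f g _; exists \0 => x; rewrite /=.
  exact/esym/thinmx0.
exists t => i it x; case: (res_idxP i) => [[i0 _]|[n e]].
  exact: (res_obj0 (a := res_idx i)).
by subst i; move: it; rewrite gtrDl.
Qed.

End Existence.

Lemma inj_resolution_exists (k : fieldType) (L : algType k) (t : int)
    (X : complex L) :
  concentrated t X -> exists (I : complex L) (f : cmap X I), inj_resolution f.
Proof.
by move=> Xt; exists (res_complex t X), (res_map Xt); exact: res_mapP.
Qed.

(** * Comparing a projective and an injective resolution *)

Lemma ffun_choice n (U : Type) (P : 'I_n -> U -> Prop) :
  (forall i, exists y, P i y) -> exists f : {ffun 'I_n -> U}, forall i, P i (f i).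
Proof.
by move=> /choice[f fP]; exists [ffun i => f i] => i; rewrite ffunE.
Qed.

Section ColumnAction.
Variable L : pzRingType.

Section Fmap.
Variables (M N : lmodType L) (d : {linear M -> N}) (n : nat).
Definition fmap (u : {ffun 'I_n -> M}) : {ffun 'I_n -> N} := [ffun i => d (u i)].
Fact fmap_linear : linear fmap.
Proof. by move=> c u v; apply/ffunP=> i; rewrite !ffunE linearP. Qed.
HB.instance Definition _ := GRing.isLinear.Build L
  {ffun 'I_n -> M} {ffun 'I_n -> N} _ fmap fmap_linear.
End Fmap.

Section Mact.
Variables (N : lmodType L) (m n : nat) (D : 'M[L]_(m, n)).
Definition mact (u : {ffun 'I_n -> N}) : {ffun 'I_m -> N} :=
  [ffun i => \sum_j D i j *: u j].
Fact mact_zmod : {morph mact : u v / u - v}.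
Proof.
move=> u v; apply/ffunP=> i; rewrite !ffunE -sumrB.
by apply: eq_bigr => j _; rewrite !ffunE scalerBr.
Qed.
HB.instance Definition _ := GRing.isZmodMorphism.Build
  {ffun 'I_n -> N} {ffun 'I_m -> N} mact mact_zmod.

(** Over a noncommutative ring only scalars that commute with the entries pass through; later these
    come from the second factor of a tensor product. *)
Lemma mactZ c u : (forall i j, c * D i j = D i j * c) ->
  mact (c *: u) = c *: mact u.
Proof.
move=> cD; apply/ffunP=> i; rewrite !ffunE scaler_sumr.
by apply: eq_bigr => j _; rewrite !ffunE !scalerA cD.
Qed.
End Mact.

Lemma mactM (N : lmodType L) l m n (D : 'M[L]_(l, m)) (D' : 'M[L]_(m, n))
    (u : {ffun 'I_n -> N}) : mact D (mact D' u) = mact (D *m D') u.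
Proof.
apply/ffunP=> i; rewrite !ffunE.
under eq_bigr => j _ do rewrite ffunE scaler_sumr.
rewrite exchange_big; apply: eq_bigr => j _; rewrite mxE scaler_suml.
by apply: eq_bigr => h _; rewrite scalerA.
Qed.

Lemma mact0l (N : lmodType L) m n (u : {ffun 'I_n -> N}) :
  mact (0 : 'M[L]_(m, n)) u = 0.
Proof.
by apply/ffunP=> i; rewrite !ffunE big1 // => j _; rewrite mxE scale0r.
Qed.

Lemma fmap_mact (M N : lmodType L) (d : {linear M -> N}) m n
    (D : 'M[L]_(m, n)) u : fmap d (mact D u) = mact D (fmap d u).
Proof.
apply/ffunP=> i; rewrite !ffunE raddf_sum.
by apply: eq_bigr => j _; rewrite ffunE; exact: linearZ_LR.
Qed.

End ColumnAction.

(* A projective resolution given by matrices [D p], whose columns with       *)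
(* entries in N stand for the homomorphisms into N, against an injective     *)
(* resolution [J] of [T], shifted so that [T] sits in degree [s.+1]: the     *)
(* homomorphisms from the resolved module to [J q] are the columns of        *)
(* height [r 0] killed by [D 0].  Below degree [s.+1] the complex [J] may be *)
(* nonzero but is exact.                                                     *)
Section Zigzag.
Variables (L : pzRingType) (J : nat -> lmodType L).
Variables (d : forall q, {linear J q -> J q.+1}) (s : nat).
Variables (T : lmodType L) (iota : {linear T -> J s.+1}).
Hypothesis J0 : forall x : J 0, x = 0.
Hypothesis dd : forall q (x : J q), d q.+1 (d q x) = 0.
Hypothesis diota : forall x, d s.+1 (iota x) = 0.
Hypothesis ex : forall q, q != s -> forall x : J q.+1, d q.+1 x = 0 ->
  exists y, x = d q y.
Hypothesis ex_s : forall x : J s.+1, d s.+1 x = 0 ->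
  exists t y, x = iota t + d s y.
Hypothesis iota_inj : forall t y, iota t = d s y -> t = 0.

(** Columns over [J q] are homomorphisms from free modules, so this is exactness of Hom(-, J q)
    along the resolution. It starts at [D 1]: the kernel of [D 0] remains as the homomorphisms out
    of the resolved module. *)
Definition row_exact (r : nat -> nat) (D : forall p, 'M[L]_(r p.+1, r p)) :=
  (forall p, D p.+1 *m D p = 0) /\
  forall q p (u : {ffun 'I_(r p.+1) -> J q}), mact (D p.+1) u = 0 ->
    exists v, u = mact (D p) v.

(** Dropping the first matrix replaces the resolved module by its first syzygy; the inductions below
    run along this shift. *)
Lemma row_exactS r D : @row_exact r D -> @row_exact (r \o S) (fun p => D p.+1).
Proof. by move=> [DD Dex]; split=> [p|q p]; [exact: DD | exact: Dex]. Qed.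

(** The staircase through the double complex Hom(P_p, J q). It is a relation because each lift w is
    a choice: x = d w, and [D 0] w is then treated over the first syzygy, until [iota] lands in
    T. *)
Fixpoint zigzag n : forall (r : nat -> nat) (D : forall p, 'M[L]_(r p.+1, r p)),
    {ffun 'I_(r 0%N) -> J (n + s).+1} -> {ffun 'I_(r n) -> T} -> Prop :=
  match n with
  | 0%N => fun r D x y => exists w : {ffun 'I_(r 0%N) -> J s},
      mact (D 0%N) w = 0 /\ x = fmap iota y + fmap (d s) w
  | n'.+1 => fun r D x y => exists w : {ffun 'I_(r 0%N) -> J (n' + s).+1},
      x = fmap (d _) w /\
      @zigzag n' (r \o S) (fun p => D p.+1) (mact (D 0%N) w) y
  end.

Definition hom_cobound r (D : forall p, 'M[L]_(r p.+1, r p)) q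
    (x : {ffun 'I_(r 0%N) -> J q.+1}) : Prop :=
  exists w, mact (D 0%N) w = 0 /\ x = fmap (d q) w.

Definition col_cobound (r : nat -> nat) (D : forall p, 'M[L]_(r p.+1, r p)) n :
    {ffun 'I_(r n) -> T} -> Prop :=
  match n with
  | 0%N => fun y => y = 0
  | m.+1 => fun y => exists w, y = mact (D m) w
  end.

Lemma fdd q n (u : {ffun 'I_n -> J q}) : fmap (d q.+1) (fmap (d q) u) = 0.
Proof. by apply/ffunP=> i; rewrite !ffunE dd. Qed.

Lemma fex q n (u : {ffun 'I_n -> J q.+1}) : q != s -> fmap (d q.+1) u = 0 ->
  exists v, u = fmap (d q) v.
Proof.
move=> qs /ffunP du; have [i|f fP] := @ffun_choice n (J q)
  (fun i y => u i = d q y).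
  by apply: ex => //; have := du i; rewrite !ffunE.
by exists f; apply/ffunP=> i; rewrite ffunE -fP.
Qed.

Lemma fex_s n (u : {ffun 'I_n -> J s.+1}) : fmap (d s.+1) u = 0 ->
  exists t v, u = fmap iota t + fmap (d s) v.
Proof.
move=> /ffunP du; have [i|f fP] := @ffun_choice n (T * J s)%type
    (fun i y => u i = iota y.1 + d s y.2).
  have [|t [y uE]] := ex_s (x := u i); first by have := du i; rewrite !ffunE.
  by exists (t, y).
exists [ffun i => (f i).1], [ffun i => (f i).2].
by apply/ffunP=> i; rewrite !ffunE.
Qed.

Lemma fiota_inj n (t : {ffun 'I_n -> T}) v : fmap iota t = fmap (d s) v -> t = 0.
Proof.
move=> /ffunP tv; apply/ffunP=> i; rewrite ffunE.
by apply: (iota_inj (y := v i)); have := tv i; rewrite !ffunE.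
Qed.

(** Exactness of J gives D w = d v. By induction v may be replaced by some D z with the same
    differential, and then w - d z is killed by D. The descent ends at [J 0], which is zero. *)
Lemma below_lift q r D (w : {ffun 'I_(r 0%N) -> J q}) : (q <= s)%N ->
  @row_exact r D -> fmap (d q) (mact (D 0%N) w) = 0 ->
  exists w', mact (D 0%N) w' = 0 /\ fmap (d q) w' = fmap (d q) w.
Proof.
elim: q r D w => [|q IH] r D w qs rD dDw.
  by exists w; split=> //; apply/ffunP=> i; rewrite [LHS]J0 [RHS]J0.
have [DD Dex] := rD; have [v Dv] := fex (negbT (ltn_eqF qs)) dDw.
have [|v' [Dv' dv']] := IH _ _ v (ltnW qs) (row_exactS rD).
  by rewrite /= fmap_mact -Dv mactM DD mact0l.
have [z zE] := Dex _ _ _ Dv'; exists (w - fmap (d q) z); split.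
  by rewrite raddfB /= -fmap_mact -zE dv' Dv subrr.
by rewrite linearB /= fdd subr0.
Qed.

Lemma below_exact q r D (x : {ffun 'I_(r 0%N) -> J q.+1}) : (q < s)%N ->
  @row_exact r D -> mact (D 0%N) x = 0 -> fmap (d q.+1) x = 0 ->
  hom_cobound D x.
Proof.
move=> qs rD Dx dx; have [w xE] := fex (negbT (ltn_eqF qs)) dx.
have [|w' [Dw' dw']] := below_lift (w := w) (ltnW qs) rD.
  by rewrite fmap_mact -xE.
by exists w'; rewrite dw'.
Qed.

Lemma zigzag_linear n r (D : forall p, 'M[L]_(r p.+1, r p)) x y x' y' (c : L) :
  (forall p i j, c * D p i j = D p i j * c) ->
  @zigzag n r D x y -> @zigzag n r D x' y' ->
  @zigzag n r D (c *: x + x') (c *: y + y').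
Proof.
elim: n r D x y x' y' => [|n IH] r D x y x' y' cD /=.
  move=> [w [Dw ->]] [w' [Dw' ->]]; exists (c *: w + w'); split.
    by rewrite raddfD /= mactZ // Dw Dw' scaler0 addr0.
  by rewrite !linearP scalerDr addrACA.
move=> [w [-> zw]] [w' [-> zw']]; exists (c *: w + w'); split.
  by rewrite linearP.
by rewrite raddfD /= mactZ //; apply: IH => // p i j; exact: cD.
Qed.

(** For n > 0, x = d w by exactness, and D w is a cocycle one syzygy further. For n = 0 the cocycle
    is [iota y + d w], where w is corrected by [below_lift]. *)
Lemma zigzag_hom_col n r D (x : {ffun 'I_(r 0%N) -> J (n + s).+1}) :
  @row_exact r D -> mact (D 0%N) x = 0 -> fmap (d _) x = 0 ->
  exists y, mact (D n) y = 0 /\ @zigzag n r D x y.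
Proof.
elim: n r D x => [|n IH] r D x rD Dx dx.
  have [y [w xE]] := fex_s dx.
  have e : fmap iota (mact (D 0%N) y) = fmap (d s) (mact (D 0%N) (- w)).
    rewrite !fmap_mact; apply/eqP; rewrite -subr_eq0 -raddfB /=.
    by rewrite raddfN opprK -xE Dx.
  have Dy := fiota_inj e; exists y; split=> //.
  have [|w' [Dw' dw']] := below_lift (w := w) (leqnn s) rD.
    have := e; rewrite Dy linear0 [mact _ (- w)]raddfN /= linearN /= => /esym/eqP.
    by rewrite oppr_eq0 => /eqP.
  by exists w'; rewrite dw'.
have [|w xE] := fex (q := (n + s).+1) _ dx; first by rewrite gtn_eqF // ltnS leq_addl.
have [DD _] := rD.
have [||y [Dy zy]] := IH _ _ (mact (D 0%N) w) (row_exactS rD).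
- by rewrite mactM DD mact0l.
- by rewrite fmap_mact -xE Dx.
by exists y; split=> //; exists w.
Qed.

Lemma zigzag_col_hom n r D (y : {ffun 'I_(r n) -> T}) :
  @row_exact r D -> mact (D n) y = 0 ->
  exists x, [/\ mact (D 0%N) x = 0, fmap (d _) x = 0 & @zigzag n r D x y].
Proof.
elim: n r D y => [|n IH] r D y rD Dy.
  exists (fmap iota y); split.
  - by rewrite -fmap_mact Dy linear0.
  - by apply/ffunP=> i; rewrite !ffunE diota.
  by exists 0; rewrite !raddf0 addr0.
have [u [Du du zu]] := IH _ _ _ (row_exactS rD) Dy; have [DD Dex] := rD.
have [w uE] := Dex _ _ _ Du; exists (fmap (d _) w); split.
- by rewrite -fmap_mact -uE.
- exact: fdd.
by exists w; rewrite -uE.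
Qed.

(** With the two lemmas above, the relation induces a bijection between the cohomology of Hom(-, J)
    and that of the columns over T: Ext is balanced. *)
Lemma zigzag_cobound n r D x y : @row_exact r D -> @zigzag n r D x y ->
  hom_cobound D x <-> col_cobound D y.
Proof.
elim: n r D x y => [|n IH] r D x y rD /=.
  move=> [w [Dw ->]]; split=> [[w' [Dw' /eqP]]|->].
    by rewrite -subr_eq0 -addrA -linearB addr_eq0 -linearN => /eqP/fiota_inj.
  by exists w; rewrite linear0 add0r.
have [DD Dex] := rD; move=> [w [-> zw]].
split=> [[w' [Dw' /eqP]]|[t yE]].
  rewrite -subr_eq0 -linearB /= => /eqP dww.
  have -> : y = y - mact (D n) 0 by rewrite raddf0 subr0.
  move: zw; have <- : mact (D 0%N) (w - w') = mact (D 0%N) w.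
    by rewrite raddfB /= Dw' subr0.
  move: (w - w') dww => {w' Dw'} w dw zw.
  (* For n = 0 the column w lies in the degree of T, where a cocycle has the form [iota t + d v];
     for larger n its degree is exact. *)
  case: n IH y x w dw zw => [|n] IH y x w dw zw.
    have [t [v wE]] := fex_s dw; case: zw => w' [Dw'].
    rewrite wE raddfD /= -!fmap_mact => e; exists t.
    rewrite raddf0 subr0; apply/eqP; rewrite -subr_eq0; apply/eqP.
    apply: (fiota_inj (v := mact (D 0%N) v - w')).
    rewrite !linearB /=; apply/eqP; rewrite subr_eq -addrA [- _ + _]addrC addrA.
    by rewrite -subr_eq opprK -e addrC.
  have [|v wE] := fex (q := (n + s).+1) _ dw.
    by rewrite gtn_eqF // ltnS leq_addl.
  have [H _] := IH _ _ _ _ (row_exactS rD) zw; case: H => [|t yE].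
    by exists (mact (D 0%N) v); rewrite mactM DD mact0l fmap_mact -wE.
  by exists t; rewrite raddf0 subr0.
case: n IH w t y x zw yE => [|n] IH w t y x zw yE.
  case: zw => w' [/Dex [z ->] e].
  exists (w - fmap iota t - fmap (d s) z); split.
    by rewrite !raddfB /= e yE -!fmap_mact addrAC addrK subrr.
  by rewrite !linearB /= fdd subr0; apply/ffunP=> i; rewrite !ffunE diota subr0.
have [_ H] := IH _ _ _ _ (row_exactS rD) zw; case: H => [|v [/Dex [z ->]]].
  by exists t.
rewrite fmap_mact => e; exists (w - fmap (d _) z); split.
  by rewrite raddfB /= e subrr.
by rewrite linearB /= fdd subr0.
Qed.

End Zigzag.

(** * Hopf algebra identities *)

Ltac mlin := rewrite /= ?linearP ?mulrDl ?mulrDr -?scalerAl -?scalerAr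
  ?(linearP, mulrDl, mulrDr, tensDl, tensDr, tensZl, tensZr, scalerDl, scalerDr)
  -?scalerAl -?scalerAr ?tensZl ?tensZr ?scalerA //.

Ltac mlin_deep :=
  do 4 rewrite /= ?(linearP, mulrDl, mulrDr) -?scalerAl -?scalerAr; mlin.

Section Sweedler.
Variables (k : fieldType) (A : algType k) (H : hopf A).
Local Notation S := (antipode H).
Local Notation eps := (counit H).

(** Sweedler notation: the sum of f(a_1, a_2). *)
Definition sw (U : lmodType k) (a : A) (f : A -> A -> U) : U :=
  alift f (comul H a).

Lemma swE (U : lmodType k) a (f : A -> A -> U) : sw a f =
  \sum_(x <- urepr (comul H a : tensor A A)) x.1 *: f x.2.1 x.2.2.
Proof. by []. Qed.

Lemma eq_sw (U : lmodType k) a (f g : A -> A -> U) :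
  (forall x y, f x y = g x y) -> sw a f = sw a g.
Proof. by move=> fg; rewrite !swE; apply: eq_bigr => x _; rewrite fg. Qed.

Lemma sw_comp (U V : lmodType k) (h : U -> V) a (f : A -> A -> U) :
  linear h -> h (sw a f) = sw a (fun x y => h (f x y)).
Proof.
move=> lh; rewrite !swE (big_morph h (linearDf lh) (linear0f lh)).
by apply: eq_bigr => x _; rewrite (linearZf _ _ lh).
Qed.

Lemma sw_swap (U : lmodType k) a b (f : A -> A -> A -> A -> U) :
  sw a (fun x y => sw b (f x y)) = sw b (fun u v => sw a (fun x y => f x y u v)).
Proof.
rewrite !swE; under eq_bigr => x _ do rewrite swE scaler_sumr.
rewrite exchange_big; apply: eq_bigr => x _; rewrite swE scaler_sumr.
by apply: eq_bigr => y _; rewrite !scalerA mulrC.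
Qed.

Lemma sw_linear (U : lmodType k) (f : A -> A -> U) :
  bilin f -> linear (fun a => sw a f).
Proof. by move=> bf c x y; rewrite /sw linearP (alift_linear bf). Qed.

Lemma sw_linear_fun (U V : lmodType k) a (f : V -> A -> A -> U) :
  (forall x y, linear (fun t => f t x y)) -> linear (fun t => sw a (f t)).
Proof.
move=> lf c s t; rewrite !swE scaler_sumr -big_split; apply: eq_bigr => x _.
by rewrite lf scalerDr !scalerA mulrC.
Qed.

Lemma sw1 (U : lmodType k) (f : A -> A -> U) : bilin f -> sw 1 f = f 1 1.
Proof. by move=> bf; rewrite /sw rmorph1 -aten1 (aliftE _ _ bf). Qed.

Lemma sw_mul (U : lmodType k) a b (f : A -> A -> U) : bilin f ->
  sw (a * b) f = sw a (fun x y => sw b (fun u v => f (x * u) (y * v))).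
Proof.
have cM : comul H (a * b) = (comul H a : talg A A) * comul H b := rmorphM _ _ _.
move=> bf; rewrite /sw cM; have lf := alift_linear bf.
have f2 x y : bilin (fun u v => f (x * u) (y * v)).
  by split=> [v c u u'|u c v v']; rewrite mulrDr -scalerAr ?bf.1 ?bf.2.
have f1 t : bilin (fun x y => alift (fun u v => f (x * u) (y * v)) t).
  split=> [y c x x'|x c y y']; elim/talg_ind: t => [|e u v t IH];
    rewrite ?(linear0f (alift_linear (f2 _ _))) ?scaler0 ?addr0 //;
    rewrite !(alift_linear (f2 _ _)) !(aliftE _ _ (f2 _ _)) IH mulrDl -scalerAl
      ?bf.1 ?bf.2 !scalerDr !scalerA (mulrC e) addrACA //.
elim/talg_ind: (comul H a) => [|c x y s IH].
  by rewrite mul0r (linear0f lf) (linear0f (alift_linear (f1 _))).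
rewrite mulrDl -scalerAl lf IH (alift_linear (f1 _)) (aliftE _ _ (f1 _)).
congr (_ *: _ + _); elim/talg_ind: (comul H b) => [|e u v t IHt].
  by rewrite mulr0 (linear0f lf) (linear0f (alift_linear (f2 _ _))).
rewrite mulrDr -scalerAr lf IHt (alift_linear (f2 _ _)) (aliftE _ _ (f2 _ _)).
by rewrite atenM (aliftE _ _ bf).
Qed.

Definition trilin (U : lmodType k) (g : A -> A -> A -> U) : Prop :=
  [/\ forall y z, linear (fun x => g x y z), forall x z, linear (fun y => g x y z)
    & forall x y, linear (g x y)].

Lemma sw_assoc (U : lmodType k) a (g : A -> A -> A -> U) : trilin g ->
  sw a (fun x z => sw x (fun x' y => g x' y z))
  = sw a (fun x y => sw y (fun y' z => g x y' z)).
Proof.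
move=> [g1 g2 g3].
have b1 x : bilin (g x) by split=> [z|y]; [exact: g2 | exact: g3].
have b2 z : bilin (fun x y => g x y z) by split=> [y|x]; [exact: g1 | exact: g2].
have b3 : bilin (fun x t => tlift (g x) t).
  split=> [t c x x'|x]; last exact: tlift_linear.
  elim/tensor_ind: t => [|e y z t' IH].
    by rewrite !(linear0f (tlift_linear (b1 _))) scaler0 addr0.
  rewrite !(tlift_linear (b1 _)) !(tliftE (b1 _)) IH g1.
  by rewrite !scalerDr !scalerA (mulrC e) addrACA.
pose h := tlift (fun x t => tlift (g x) t); have lh : linear h := tlift_linear b3.
have bt1 (z : A) : bilin (fun u v : A => tens u (tens v z)).
  by split=> [v c u u'|u c v v']; rewrite ?(tensDl, tensDr, tensZl, tensZr).
have bt : bilin (fun t (z : A) => tlift (fun u v : A => tens u (tens v z)) t).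
  split=> [z|w c z z']; first exact: tlift_linear.
  elim/tensor_ind: w => [|e u v t' IH].
    by rewrite !(linear0f (tlift_linear (bt1 _))) scaler0 addr0.
  rewrite !(tlift_linear (bt1 _)) !(tliftE (bt1 _)) IH !tensDr !tensZr.
  by rewrite !scalerDr !scalerA (mulrC e) addrACA.
have e : tassoc (sw a (fun x y => tens (comul H x : tensor A A) y))
    = sw a (fun x y => tens x (comul H y : tensor A A)) := hopf_coassoc H a.
have := congr1 h e.
rewrite (sw_comp (h := @tassoc k A A A)); last exact: tlift_linear.
rewrite !(sw_comp (h := h)) // => e'; apply: etrans (etrans _ e') _.
  apply: eq_sw => x z; rewrite /tassoc (tliftE bt) -/(alift _ _) -/(sw x _).
  by rewrite (sw_comp (h := h)) //; apply: eq_sw => u v; rewrite /h (tliftE b3) (tliftE (b1 _)).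
by apply: eq_sw => x y; rewrite /h (tliftE b3).
Qed.

Lemma sw_counitl (U : lmodType k) a (h : A -> U) : linear h ->
  sw a (fun x y => (eps x : k) *: h y) = h a.
Proof.
have e : sw a (fun x y => (eps x : k) *: y) = a := hopf_counitl H a.
move=> lh; rewrite -[in RHS]e (sw_comp (h := h)) //.
by apply: eq_sw => x y; rewrite (linearZf _ _ lh).
Qed.

Lemma sw_counitr (U : lmodType k) a (h : A -> U) : linear h ->
  sw a (fun x y => (eps y : k) *: h x) = h a.
Proof.
have e : sw a (fun x y => (eps y : k) *: x) = a := hopf_counitr H a.
move=> lh; rewrite -[in RHS]e (sw_comp (h := h)) //.
by apply: eq_sw => x y; rewrite (linearZf _ _ lh).
Qed.

Lemma sw_antipodel (U : lmodType k) a (h : A -> U) : linear h ->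
  sw a (fun x y => h (S x * y)) = (eps a : k) *: h 1.
Proof.
by move=> lh; rewrite -(sw_comp (h := h)) // /sw hopf_antipodel (linearZf _ _ lh).
Qed.

Lemma sw_antipoder (U : lmodType k) a (h : A -> U) : linear h ->
  sw a (fun x y => h (x * S y)) = (eps a : k) *: h 1.
Proof.
by move=> lh; rewrite -(sw_comp (h := h)) // /sw hopf_antipoder (linearZf _ _ lh).
Qed.

Lemma antipode1 : S 1 = 1.
Proof.
have := hopf_antipodel H 1; rewrite -/(sw _ _) sw1.
  by rewrite mulr1 rmorph1 scale1r.
by split=> [y c x x'|x c y y']; mlin.
Qed.

(** Both sides equal the sum of S(a_1 b_1) a_2 b_2 S(b_3) S(a_3). Collapsing b_2 S(b_3) and a_2
    S(a_3) leaves S(ab); collapsing S(a_1 b_1) a_2 b_2 leaves S(b) S(a). *)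
Lemma antipodeM a b : S (a * b) = S b * S a.
Proof.
pose G a1 a2 a3 b1 b2 b3 := S (a1 * b1) * (a2 * b2) * (S b3 * S a3).
transitivity (sw a (fun a1 a' => sw a' (fun a2 a3 =>
    sw b (fun b1 b' => sw b' (fun b2 b3 => G a1 a2 a3 b1 b2 b3))))).
  transitivity (sw a (fun a1 a' => (eps a' : k) *: S (a1 * b))).
    by rewrite (sw_counitr _ (h := fun x => S (x * b))) // => c x y; mlin.
  apply: eq_sw => a1 a'.
  transitivity (sw a' (fun a2 a3 => sw b (fun b1 b' =>
      (eps b' : k) *: (S (a1 * b1) * (a2 * S a3))))); last first.
    apply: eq_sw => a2 a3; apply: eq_sw => b1 b'; rewrite /G.
    have := @sw_antipoder _ b' (fun x => S (a1 * b1) * (a2 * x * S a3)).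
    rewrite mulr1 => <-; last by move=> c x y; mlin.
    by apply: eq_sw => b2 b3; rewrite !mulrA.
  have := @sw_antipoder _ a' (fun x => S (a1 * b) * x).
  rewrite mulr1 => <-; last by move=> c x y; mlin.
  apply: eq_sw => a2 a3; rewrite (sw_counitr _ (h := fun x => S (a1 * x) * _)) //.
  by move=> c x y; mlin.
transitivity (sw b (fun b' b3 => sw a (fun a' a3 =>
    sw (a' * b') (fun x y => S x * y * (S b3 * S a3))))); last first.
  transitivity (sw b (fun b' b3 => (eps b' : k) *: (S b3 * S a))); last first.
    by rewrite (sw_counitl _ (h := fun x => S x * S a)) // => c x y; mlin.
  apply: eq_sw => b' b3; rewrite -(sw_counitl a (h := fun x => S b3 * S x)); last first.
    by move=> c x y; mlin.
  rewrite (sw_comp (h := fun x => (eps b' : k) *: x)); last first.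
    by move=> c x y; rewrite scalerDr !scalerA mulrC.
  apply: eq_sw => a' a3; rewrite (sw_antipodel _ (h := fun x => x * _)).
    by rewrite mul1r rmorphM scalerA mulrC.
  by move=> c x y; mlin.
transitivity (sw a (fun a' a3 => sw b (fun b' b3 => sw a' (fun a1 a2 =>
    sw b' (fun b1 b2 => G a1 a2 a3 b1 b2 b3))))); last first.
  rewrite sw_swap; apply: eq_sw => b' b3; apply: eq_sw => a' a3.
  by rewrite sw_mul //; split=> [v c u u'|u c v v']; mlin.
rewrite -(sw_assoc _ (g := fun a1 a2 a3 =>
  sw b (fun b1 b' => sw b' (fun b2 b3 => G a1 a2 a3 b1 b2 b3)))); last first.
  split=> [a2 a3|a1 a3|a1 a2]; apply: sw_linear_fun => b1 b';
    apply: sw_linear_fun => b2 b3 c x y; rewrite /G; mlin.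
apply: eq_sw => a' a3; rewrite [RHS]sw_swap; apply: eq_sw => a1 a2.
rewrite -(sw_assoc _ (g := fun b1 b2 b3 => G a1 a2 a3 b1 b2 b3)) //.
by split=> [b2 b3|b1 b3|b1 b2] c x y; rewrite /G; mlin.
Qed.

End Sweedler.

(** * The map delta, the winding automorphism, the adjoint module and the enveloping algebra *)

Section HopfMaps.
Variables (k : fieldType) (A : algType k) (H : hopf A).
Local Notation S := (antipode H).
Local Notation eps := (counit H).

Definition antipode_conv (a : A) : A^c := S a.
Fact antipode_conv_linear : linear antipode_conv.
Proof. by move=> c x y; exact: linearP. Qed.
Fact antipode_conv_monoid : monoid_morphism antipode_conv.
Proof. by split=> [|x y]; [exact: (antipode1 H) | exact: (antipodeM H)]. Qed.
HB.instance Definition _ :=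
  GRing.isLinear.Build k A A^c _ antipode_conv antipode_conv_linear.
HB.instance Definition _ :=
  GRing.isMonoidMorphism.Build A A^c antipode_conv antipode_conv_monoid.

Definition delta : {lrmorphism A -> talg A A^c} :=
  (tmap (idfun : {lrmorphism A -> A}) (antipode_conv : {lrmorphism A -> A^c})
   \o comul H)%FUN.

Lemma deltaE a : delta a = sw H a (fun x y => x \ox antipode_conv y).
Proof.
rewrite /delta /= -[comul H a]/(comul H a : tensor A A).
have lt := @tmap_linear k A A A A^c idfun antipode_conv.
have e : sw H a (fun x y => x \ox y) = comul H a.
  rewrite /sw; elim/talg_ind: (comul H a : talg A A) => [|c x y t IH];
    have la := alift_linear (aten_bilin A A).
    exact: linear0f la.
  by rewrite la IH (aliftE _ _ (aten_bilin A A)).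
by rewrite -{1}e (sw_comp _ _ _ lt); apply: eq_sw => x y; rewrite tmapE.
Qed.

Definition antipode2 : A -> A := fun a => S (S a).
Fact antipode2_linear : linear antipode2.
Proof. by move=> c x y; rewrite /antipode2 !linearP. Qed.
Fact antipode2_monoid : monoid_morphism antipode2.
Proof. by split=> [|x y]; rewrite /antipode2 ?antipode1 // !antipodeM. Qed.
HB.instance Definition _ := GRing.isLinear.Build k A A _ antipode2 antipode2_linear.
HB.instance Definition _ := GRing.isMonoidMorphism.Build A A antipode2 antipode2_monoid.

Section Winding.
Variable chi : {lrmorphism A -> k^o}.
Local Notation xi := (left_winding H chi).

Lemma windingE a : xi a = sw H a (fun x y => (chi x : k) *: y).
Proof. by []. Qed.

Lemma winding_bilin : bilin (fun x y : A => (chi x : k) *: y).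
Proof. by split=> [y c x x'|x c y y']; mlin; rewrite mulrC. Qed.

Fact winding_linear : linear xi.
Proof. exact: sw_linear winding_bilin. Qed.
Fact winding_monoid : monoid_morphism xi.
Proof.
split=> [|a b].
  by rewrite windingE (sw1 _ winding_bilin) rmorph1 scale1r.
rewrite windingE (sw_mul _ _ _ winding_bilin).
have lb : linear (fun u => u * xi b) by move=> c x y; mlin.
rewrite [xi a]windingE (sw_comp H (h := fun u => u * xi b)) //; apply: eq_sw => x y.
have lx : linear (fun u => (chi x : k) *: y * u) by move=> c u v; mlin; rewrite mulrC.
rewrite [xi b]windingE (sw_comp H (h := fun u => (chi x : k) *: y * u)) //; apply: eq_sw => u v.
by rewrite rmorphM -scalerAl -scalerAr scalerA.
Qed.
HB.instance Definition _ := GRing.isLinear.Build k A A _ xi winding_linear.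
HB.instance Definition _ := GRing.isMonoidMorphism.Build A A xi winding_monoid.

Definition winding : {lrmorphism A -> A} := xi.

(** Winding by chi o S, the convolution inverse of chi. *)
Definition winding_inv a : A := sw H a (fun x y => (chi (S x) : k) *: y).

Lemma windingK : cancel xi winding_inv.
Proof.
move=> a; pose f (x y : A) := (chi (S x) : k) *: y.
rewrite windingE -[LHS]/(sw H (sw H a _) f).
have bf : bilin f.
  by split=> [y c x x'|x c y y']; rewrite /f; mlin; rewrite mulrC.
rewrite (sw_comp H (h := fun u => sw H u f)); last exact: sw_linear.
transitivity (sw H a (fun x y => sw H y (fun u v => (chi (x * S u) : k) *: v))).
  apply: eq_sw => x y; rewrite (linearZf _ _ (sw_linear H bf)).
  rewrite (sw_comp H (h := fun u => (chi x : k) *: u)); last first.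
    by move=> c u v; mlin; rewrite mulrC.
  by apply: eq_sw => u v; rewrite /f scalerA rmorphM.
rewrite -(sw_assoc H _ (g := fun x u v => (chi (x * S u) : k) *: v)); last first.
  by split=> [u v|x v|x u] c y z; mlin; rewrite mulrC.
rewrite -[RHS](sw_counitl H a (h := id)) //; apply: eq_sw => x v.
rewrite (sw_antipoder H _ (h := fun u => (chi u : k) *: v)).
  by rewrite rmorph1 scale1r.
by move=> c u w; mlin; rewrite mulrC.
Qed.

Lemma winding_invK : cancel winding_inv xi.
Proof.
move=> a; rewrite /winding_inv.
rewrite (sw_comp H (h := xi)); last exact: winding_linear.
transitivity (sw H a (fun x y => sw H y (fun u v => (chi (S x * u) : k) *: v))).
  apply: eq_sw => x y; rewrite (linearZf _ _ winding_linear) windingE.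
  rewrite (sw_comp H (h := fun u => (chi (S x) : k) *: u)); last first.
    by move=> c u v; mlin; rewrite mulrC.
  by apply: eq_sw => u v; rewrite scalerA rmorphM.
rewrite -(sw_assoc H _ (g := fun x u v => (chi (S x * u) : k) *: v)); last first.
  by split=> [u v|x v|x u] c y z; mlin; rewrite mulrC.
rewrite -[RHS](sw_counitl H a (h := id)) //; apply: eq_sw => x v.
rewrite (sw_antipodel H _ (h := fun u => (chi u : k) *: v)).
  by rewrite rmorph1 scale1r.
by move=> c u w; mlin; rewrite mulrC.
Qed.

Definition nakayama_aut : {lrmorphism A -> A} :=
  ((antipode2 : {lrmorphism A -> A}) \o winding)%FUN.

Lemma nakayama_aut_bij : bijective S -> bijective nakayama_aut.
Proof.
move=> bS; apply: bij_comp; first exact: bij_comp.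
by exists winding_inv; [exact: windingK | exact: winding_invK].
Qed.
End Winding.

(* The left module A (x) A under a . (r (x) s) = mu(a_1) r (x) s S(a_2) is   *)
(* free on 1 (x) A, via x (x) y |-> x . (1 (x) y).                            *)
Section Adjoint.
Variables (mu : {lrmorphism A -> A}) (mu' : A -> A).
Hypotheses (muK : cancel mu mu') (mu'K : cancel mu' mu).

Lemma inverse_linear : linear mu'.
Proof. by move=> c x y; apply: (can_inj muK); rewrite linearP /= !mu'K. Qed.

Definition adj : tensor A A -> tensor A A :=
  tlift (fun x y => sw H x (fun x1 x2 => tens (mu x1) (y * S x2))).
Definition adj_inv : tensor A A -> tensor A A :=
  tlift (fun r s => sw H (mu' r) (fun x1 x2 => tens x1 (s * S (S x2)))).

Lemma adj_bilin :
  bilin (fun x y => sw H x (fun x1 x2 => tens (mu x1) (y * S x2))).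
Proof.
split=> [y|x]; last by apply: sw_linear_fun => x1 x2 c y y'; mlin.
by apply: sw_linear; split=> [x2 c x x'|x c x2 x2']; mlin.
Qed.

Lemma adj_inv_bilin :
  bilin (fun r s => sw H (mu' r) (fun x1 x2 => tens x1 (s * S (S x2)))).
Proof.
split=> [y c r r'|x]; last by apply: sw_linear_fun => x1 x2 c y y'; mlin.
rewrite inverse_linear; apply: sw_linear.
by split=> [x2 a x x'|x a x2 x2']; mlin.
Qed.

Lemma adjE x y :
  adj (tens x y) = sw H x (fun x1 x2 => tens (mu x1) (y * S x2)).
Proof. by rewrite [LHS](tliftE adj_bilin). Qed.
Lemma adj_invE r s :
  adj_inv (tens r s) = sw H (mu' r) (fun x1 x2 => tens x1 (s * S (S x2))).
Proof. by rewrite [LHS](tliftE adj_inv_bilin). Qed.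
Lemma adj_linear : linear adj. Proof. exact: tlift_linear adj_bilin. Qed.
Lemma adj_inv_linear : linear adj_inv.
Proof. exact: tlift_linear adj_inv_bilin. Qed.

(** The product y S(x_3) S^2(x_2) = y S(S(x_2) x_3) collapses by the antipode axiom, which is why
    [adj_inv] carries S^2. *)
Lemma adjK : cancel adj adj_inv.
Proof.
apply: tens_ext => [c x y|//|x y]; first by rewrite adj_linear adj_inv_linear.
rewrite adjE (sw_comp _ _ _ adj_inv_linear).
transitivity (sw H x (fun x1 x2 => sw H x1 (fun u v =>
    tens u (y * S (S v * x2))))).
  apply: eq_sw => x1 x2; rewrite adj_invE muK; apply: eq_sw => u v.
  by rewrite antipodeM mulrA.
rewrite (sw_assoc H _ (g := fun u v w => tens u (y * S (S v * w)))); last first.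
  by split=> [v w|u w|u v] c z z'; mlin.
rewrite -[RHS](sw_counitr H x (h := fun u => tens u y)); last by move=> c z z'; mlin.
apply: eq_sw => u v; rewrite (sw_antipodel H _ (h := fun w => tens u (y * S w))).
  by rewrite antipode1 mulr1.
by move=> c z z'; mlin.
Qed.

Lemma adj_invK : cancel adj_inv adj.
Proof.
apply: tens_ext => [c x y|//|r s]; first by rewrite adj_inv_linear adj_linear.
rewrite adj_invE (sw_comp _ _ _ adj_linear).
transitivity (sw H (mu' r) (fun x1 x2 => sw H x1 (fun u v =>
    tens (mu u) (s * S (v * S x2))))).
  apply: eq_sw => x1 x2; rewrite adjE; apply: eq_sw => u v.
  by rewrite antipodeM mulrA.
rewrite (sw_assoc H _ (g := fun u v w => tens (mu u) (s * S (v * S w)))); last first.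
  by split=> [v w|u w|u v] c z z'; mlin.
rewrite -[in RHS](mu'K r).
rewrite -[RHS](sw_counitr H _ (h := fun u => tens (mu u) s)); last by move=> c z z'; mlin.
apply: eq_sw => u v; rewrite (sw_antipoder H _ (h := fun w => tens (mu u) (s * S w))).
  by rewrite antipode1 mulr1.
by move=> c z z'; mlin.
Qed.

Definition biact_tens (f g : A -> A) : tensor A A -> tensor A A :=
  tlift (fun r s => tens (f r) (g s)).

Section Biact.
Variables f g : A -> A.
Hypotheses (lf : linear f) (lg : linear g).
Lemma biact_tens_bilin : bilin (fun r s => tens (f r) (g s)).
Proof. by split=> [s c r r'|r c s s']; rewrite ?lf ?lg; mlin. Qed.
Lemma biact_tensE r s : biact_tens f g (tens r s) = tens (f r) (g s).
Proof. by rewrite [LHS](tliftE biact_tens_bilin). Qed.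
Lemma biact_tens_linear : linear (biact_tens f g).
Proof. exact: tlift_linear biact_tens_bilin. Qed.
End Biact.

Lemma mull_linear (a : A) : linear ( *%R a).
Proof. by move=> c x y; mlin. Qed.
Lemma mulr_linear (a : A) : linear ( *%R^~ a).
Proof. by move=> c x y; mlin. Qed.
Lemma id_linear : linear (id : A -> A).
Proof. by []. Qed.

(** The coproduct is multiplicative and S reverses products, so a_1 comes out on the far left and
    S(a_2) on the far right. *)
Lemma adj_mull a x y : adj (tens (a * x) y)
  = sw H a (fun a1 a2 => biact_tens ( *%R (mu a1)) ( *%R^~ (S a2)) (adj (tens x y))).
Proof.
rewrite !adjE sw_mul; last by split=> [v c u u'|u c v v']; mlin.
apply: eq_sw => a1 a2.
rewrite (sw_comp H (h := biact_tens _ _)); last first.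
  exact: biact_tens_linear (mull_linear _) (mulr_linear _).
apply: eq_sw => x1 x2; rewrite biact_tensE; [|exact: mull_linear|exact: mulr_linear].
by rewrite rmorphM antipodeM mulrA.
Qed.

Lemma adj_right_factor b x y :
  adj (tens x (b * y)) = biact_tens id ( *%R b) (adj (tens x y)).
Proof.
rewrite !adjE (sw_comp H (h := biact_tens _ _)); last first.
  exact: biact_tens_linear id_linear (mull_linear _).
apply: eq_sw => x1 x2; rewrite biact_tensE; [|exact: id_linear|exact: mull_linear].
by rewrite mulrA.
Qed.

(* sum x_1 a_1 (x) y S^2(a_3) S(x_2 a_2) = x_1 a (x) y S(x_2) *)
Lemma adj_mulr a x y :
  sw H a (fun a1 a2 => adj (tens (x * a1) (y * S (S a2))))
  = biact_tens ( *%R^~ (mu a)) id (adj (tens x y)).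
Proof.
have lb := biact_tens_linear (mulr_linear (mu a)) id_linear.
rewrite adjE (sw_comp _ _ _ lb).
pose G x1 x2 a1 a2 a3 := tens (mu x1 * mu a1) (y * S (a2 * S a3) * S x2).
transitivity (sw H a (fun a' a3 => sw H a' (fun a1 a2 =>
    sw H x (fun x1 x2 => G x1 x2 a1 a2 a3)))).
  apply: eq_sw => a' a3; rewrite adjE sw_mul; last first.
    by split=> [v c u u'|u c v v']; mlin.
  rewrite sw_swap; apply: eq_sw => a1 a2; apply: eq_sw => x1 x2.
  by rewrite /G rmorphM !antipodeM !mulrA.
rewrite (sw_assoc H _ (g := fun a1 a2 a3 => sw H x (fun x1 x2 => G x1 x2 a1 a2 a3))).
  transitivity (sw H a (fun a1 a' => (eps a' : k) *:
      sw H x (fun x1 x2 => tens (mu x1 * mu a1) (y * S x2)))).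
    apply: eq_sw => a1 a'.
    rewrite (sw_antipoder H _ (h := fun u =>
      sw H x (fun x1 x2 => tens (mu x1 * mu a1) (y * S u * S x2)))).
      by rewrite antipode1 mulr1.
    by apply: sw_linear_fun => x1 x2 c z z'; mlin.
  rewrite (sw_counitr H a (h := fun u =>
    sw H x (fun x1 x2 => tens (mu x1 * mu u) (y * S x2)))).
    by apply: eq_sw => x1 x2; rewrite biact_tensE //; exact: mulr_linear.
  by apply: sw_linear_fun => x1 x2 c z z'; mlin.
by split=> [a2 a3|a1 a3|a1 a2]; apply: sw_linear_fun => x1 x2 c z z';
  rewrite /G; mlin_deep.
Qed.

End Adjoint.

(* A^e is free as a right module through delta. *)
Definition env_iso : tensor A A -> talg A A^c :=
  tlift (fun x y => sw H x (fun x1 x2 => x1 \ox (S x2 * y : A^c))).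
Definition env_iso_inv : talg A A^c -> tensor A A :=
  alift (fun x (y : A^c) => sw H x (fun x1 x2 => tens x1 (x2 * (y : A)))).

Lemma env_iso_bilin :
  bilin (fun x y => sw H x (fun x1 x2 => x1 \ox (S x2 * y : A^c)) : talg A A^c).
Proof.
have b (z : A) : bilin (fun x1 x2 : A => x1 \ox (S x2 * z : A^c)).
  split=> [x2 c x x'|x c x2 x2']; first by rewrite atenDl atenZl.
  rewrite linearP mulrDl -scalerAl; exact: (aten_bilin A A^c).2.
split=> [y|x]; first exact: sw_linear.
apply: sw_linear_fun => x1 x2 c y y'; rewrite mulrDr -scalerAr.
exact: (aten_bilin A A^c).2.
Qed.

Lemma env_iso_inv_bilin :
  bilin (fun x (y : A^c) => sw H x (fun x1 x2 => tens x1 (x2 * (y : A)))).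
Proof.
split=> [y|x].
  by apply: sw_linear; split=> [x2 c z z'|z c x2 x2']; mlin.
apply: sw_linear_fun => x1 x2 c y y'.
rewrite -[X in tens x1 (x2 * X)]/(c *: (y : A) + (y' : A) : A); mlin.
Qed.

Lemma env_isoE x y :
  env_iso (tens x y) = sw H x (fun x1 x2 => x1 \ox (S x2 * y : A^c)).
Proof. by rewrite [LHS](tliftE env_iso_bilin). Qed.
Lemma env_iso_invE x (y : A^c) :
  env_iso_inv (x \ox y) = sw H x (fun x1 x2 => tens x1 (x2 * (y : A))).
Proof. exact: aliftE env_iso_inv_bilin. Qed.
Lemma env_iso_linear : linear env_iso. Proof. exact: tlift_linear env_iso_bilin. Qed.
Lemma env_iso_inv_linear : linear env_iso_inv.
Proof. exact: alift_linear env_iso_inv_bilin. Qed.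

Lemma env_isoK : cancel env_iso env_iso_inv.
Proof.
apply: tens_ext => [c x y|//|x y]; first by rewrite env_iso_linear env_iso_inv_linear.
rewrite env_isoE (sw_comp _ _ _ env_iso_inv_linear).
transitivity (sw H x (fun x1 x2 => sw H x1 (fun u v =>
    tens u (v * S x2 * y)))).
  apply: eq_sw => x1 x2; rewrite env_iso_invE; apply: eq_sw => u v.
  by rewrite mulrA.
rewrite (sw_assoc H _ (g := fun u v w => tens u (v * S w * y))); last first.
  by split=> [v w|u w|u v] c z z'; mlin.
rewrite -[RHS](sw_counitr H x (h := fun u => tens u y)); last by move=> c z z'; mlin.
apply: eq_sw => u v; rewrite (sw_antipoder H _ (h := fun w => tens u (w * y))).
  by rewrite mul1r.
by move=> c z z'; mlin.
Qed.

Lemma env_iso_invK : cancel env_iso_inv env_iso.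
Proof.
move=> t; elim/talg_ind: t => [|c x y t IH].
  by rewrite (linear0f env_iso_inv_linear) (linear0f env_iso_linear).
rewrite env_iso_inv_linear env_iso_linear IH; congr (_ *: _ + _).
rewrite env_iso_invE (sw_comp _ _ _ env_iso_linear).
transitivity (sw H x (fun x1 x2 => sw H x1 (fun u v =>
    u \ox (S v * x2 * (y : A) : A^c)))).
  apply: eq_sw => x1 x2; rewrite env_isoE; apply: eq_sw => u v.
  by rewrite mulrA.
have l3 (a b : A) : linear (fun u : A => a \ox (u * b : A^c)).
  move=> e u v; rewrite mulrDl -scalerAl; exact: (aten_bilin A A^c).2.
rewrite (sw_assoc H _ (g := fun u v w => u \ox (S v * w * (y : A) : A^c))); last first.
  split=> [v w|u w|u v] e z z'.
  - exact: (aten_bilin A A^c).1.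
  - by rewrite linearP mulrDl -scalerAl; exact: l3.
  by rewrite mulrDr -scalerAr; exact: l3.
rewrite -[RHS](sw_counitr H x (h := fun u => u \ox y)); last exact: (aten_bilin A A^c).1.
apply: eq_sw => u v; rewrite (sw_antipodel H _ (h := fun w => u \ox (w * (y : A) : A^c))).
  by rewrite mul1r.
exact: l3.
Qed.

(** [env_iso (tens x y)] is the product (1 (x) y) delta(x), and [delta] is multiplicative. *)
Lemma env_iso_mulr x a y : env_iso (tens (x * a) y) = env_iso (tens x y) * delta a.
Proof.
have lm (t : talg A A^c) : linear (fun u => u * t) by move=> c u v; mlin.
have lm' (t : talg A A^c) : linear (fun u => t * u) by move=> c u v; mlin.
rewrite !env_isoE deltaE (sw_comp _ _ _ (lm _)) sw_mul; last first.
  split=> [v c u u'|u c v v']; first exact: (aten_bilin A A^c).1.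
  by rewrite linearP mulrDl -scalerAl; exact: (aten_bilin A A^c).2.
apply: eq_sw => x1 x2; rewrite (sw_comp _ _ _ (lm' _)); apply: eq_sw => a1 a2.
rewrite atenM antipodeM; congr (_ \ox _).
by rewrite -[RHS]/(S a2 * (S x2 * y)) mulrA.
Qed.

(* Hence right factors move to the left modulo A^e delta(ker eps).           *)
Lemma delta_move b :
  b \ox 1 = sw H b (fun b1 b2 => (1 \ox (b2 : A^c)) * delta b1) :> talg A A^c.
Proof.
have l3 (a d : A) : linear (fun u : A => a \ox (d * u : A^c)).
  move=> e u v; rewrite mulrDr -scalerAr; exact: (aten_bilin A A^c).2.
transitivity (sw H b (fun b1 b2 => sw H b1 (fun u v => u \ox (S v * b2 : A^c)))).
  rewrite (sw_assoc H _ (g := fun u v w => u \ox (S v * w : A^c))); last first.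
    split=> [v w|u w|u v] e z z'.
    - exact: (aten_bilin A A^c).1.
    - by rewrite linearP mulrDl -scalerAl; exact: (aten_bilin A A^c).2.
    exact: l3.
  rewrite -[LHS](sw_counitr H b (h := fun u => u \ox (1 : A^c))); last exact: (aten_bilin A A^c).1.
  apply: eq_sw => u v; rewrite (sw_antipodel H _ (h := fun w => u \ox (w : A^c))) //.
  exact: (aten_bilin A A^c).2.
apply: eq_sw => b1 b2; rewrite deltaE.
have lm' (t : talg A A^c) : linear (fun u => t * u) by move=> c u v; mlin.
rewrite (sw_comp _ _ _ (lm' _)); apply: eq_sw => u v.
by rewrite atenM mul1r.
Qed.

End HopfMaps.

(** * Free resolutions of the trivial module *)

Section Noetherian.
Variable A : pzRingType.
Hypothesis nA : left_noetherian A.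

Lemma submodule_mulmx m n (S : 'rV[A]_n -> Prop) (G : 'M[A]_(m, n)) c :
  S 0 -> (forall x y, S x -> S y -> S (x + y)) -> (forall a x, S x -> S (a *: x)) ->
  (forall i, S (row i G)) -> S (c *m G).
Proof.
move=> S0 SD SZ SG; rewrite mulmx_sum_row.
by elim/big_rec: _ => // i x _ Sx; apply: SD => //; apply: SZ.
Qed.

(** Induction on n: the first coordinates of vectors in S form a left ideal, and the vectors of S
    with first coordinate 0 a submodule in one dimension less. Lifted generators of the former and
    generators of the latter generate S. *)
Lemma noetherian_submodule n (S : 'rV[A]_n -> Prop) :
  S 0 -> (forall x y, S x -> S y -> S (x + y)) -> (forall a x, S x -> S (a *: x)) ->
  exists m (G : 'M[A]_(m, n)), (forall i, S (row i G)) /\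
    forall x, S x -> exists c : 'rV_m, x = c *m G.
Proof.
elim: n S => [|n IH] S.
  move=> S0 SD SZ; exists 0%N, 0; split=> [[]//|x _]; exists 0; by rewrite [LHS]thinmx0 [RHS]thinmx0.
rewrite -[n.+1]/(1 + n)%N in S * => S0 SD SZ.
pose J a := exists x : 'rV_n, S (row_mx a%:M x).
have [||a b|p [g [gJ gP]]] := nA (J := J).
- by exists 0; rewrite raddf0 row_mx0.
- move=> a b [x Sx] [y Sy]; exists (x + y).
  by rewrite raddfD -add_row_mx; exact: SD.
- move=> [x Sx]; exists (a *: x).
  by rewrite -scale_scalar_mx -scale_row_mx; exact: SZ.
have [x xS] := choice gJ.
pose S' y := S (row_mx 0 y).
have [||a y|m [G [GS GP]]] := IH S'.
- by rewrite /S' row_mx0.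
- by move=> y z; rewrite /S' -[0 as X in row_mx X (_ + _)]addr0 -add_row_mx; exact: SD.
- by rewrite /S' -[0 as X in row_mx X (_ *: _)](scaler0 _ a) -scale_row_mx; exact: SZ.
pose cg : 'cV[A]_p := \col_i g i; pose X : 'M[A]_(p, n) := \matrix_i x i.
pose G1 : 'M[A]_(p, 1 + n) := row_mx cg X.
have G1S i : S (row i G1).
  rewrite row_row_mx rowK [row i cg](_ : _ = (g i)%:M) //.
  by apply/matrixP=> a b; rewrite !ord1 !mxE eqxx mulr1n.
exists (p + m)%N, (col_mx G1 (row_mx 0 G)); split=> [i|y Sy].
  rewrite -(splitK i); case: (split i) => j /=.
    by rewrite rowKu.
  by rewrite rowKd row_row_mx row0; exact: GS.
have [|c cE] := gP (lsubmx y 0 0).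
  exists (rsubmx y); rewrite [X in row_mx X _](_ : _ = lsubmx y) ?hsubmxK //.
  by rewrite [RHS]mx11_scalar.
pose c1 : 'rV_p := \row_j c j.
have lc1 : c1 *m cg = lsubmx y.
  rewrite [RHS]mx11_scalar cE; apply/matrixP=> i j.
  by rewrite !ord1 !mxE eqxx mulr1n; apply: eq_bigr => l _; rewrite !mxE.
have [|c2 c2E] := GP (rsubmx y - c1 *m X).
  rewrite /S'; have -> : row_mx 0 (rsubmx y - c1 *m X) = y + (-1) *: (c1 *m G1).
    by rewrite scaleN1r mul_mx_row lc1 -{2}(hsubmxK y) opp_row_mx add_row_mx subrr.
  by apply: (SD _ _ Sy (SZ _ _ (submodule_mulmx _ S0 SD SZ G1S))).
exists (row_mx c1 c2); rewrite mul_row_col /G1 !mul_mx_row mulmx0 -c2E.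
by rewrite add_row_mx addr0 lc1 [c1 *m X + _]addrC subrK hsubmxK.
Qed.
End Noetherian.

(** Rank 1 in degree 0 is built in, so that [D 0] is a single column by conversion. *)
Definition rk (r : nat -> nat) (p : nat) : nat := if p is q.+1 then r q else 1%N.

(** The matrices act on row vectors from the right, hence left linearly; the module resolved is A
    modulo the left ideal [aug]. *)
Record free_resolution (A : pzRingType) (aug : A -> Prop) (r : nat -> nat)
    (D : forall p, 'M[A]_(rk r p.+1, rk r p)) : Prop := FreeResolution {
  free_resK : forall p, D p.+1 *m D p = 0;
  free_resE : forall p (v : 'rV_(rk r p.+1)), v *m D p = 0 ->
    exists w, v = w *m D p.+1;
  free_res0 : forall a : A, aug a <-> exists w : 'rV_(rk r 1), a%:M = w *m D 0%N }.

Lemma free_resolution_exists (A : pzRingType) (aug : A -> Prop) :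
  left_noetherian A -> aug 0 -> (forall x y, aug x -> aug y -> aug (x + y)) ->
  (forall a x, aug x -> aug (a * x)) ->
  exists r D, @free_resolution A aug r D.
Proof.
move=> nA aug0 augD augM.
have [|x y|a x|m0 [M0 [M0P M0E]]] := noetherian_submodule nA
  (n := 1) (S := fun x => aug (x 0 0)).
- by rewrite mxE.
- by rewrite mxE; exact: augD.
- by rewrite mxE; exact: augM.
(* The recursion carries a matrix together with its size; each step picks generators of the row
   kernel of the current matrix. *)
pose state := {mn : nat * nat & 'M[A]_(mn.1, mn.2)}.
have step (s : state) : exists t : {m : nat & 'M[A]_(m, (projT1 s).1)},
    projT2 t *m projT2 s = 0 /\
    forall v : 'rV_ _, v *m projT2 s = 0 -> exists w, v = w *m projT2 t.
  case: s => [[m n] M] /=.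
  have [|x y Mx My|a x Mx|l [G [GS GP]]] := noetherian_submodule nA
      (S := fun v : 'rV_m => v *m M = 0).
  - exact: mul0mx.
  - by rewrite mulmxDl Mx My addr0.
  - by rewrite -scalemxAl Mx scaler0.
  exists (existT _ l G); split=> /=; last exact: GP.
  by apply/row_matrixP=> i; rewrite row_mul GS row0.
pose f s := sval (cid (step s)); have fP s := svalP (cid (step s)).
pose st := fix st p : state := if p is q.+1
  then existT (fun mn : nat * nat => 'M[A]_(mn.1, mn.2))
              (projT1 (f (st q)), (projT1 (st q)).1) (projT2 (f (st q)))
  else existT (fun mn : nat * nat => 'M[A]_(mn.1, mn.2)) (m0, 1%N) M0.
pose r q := (projT1 (st q)).1.
pose D p : 'M[A]_(rk r p.+1, rk r p) :=
  match p with 0%N => M0 | q.+1 => projT2 (st q.+1) end.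
exists r, D; split=> [p|p v|a].
- by case: p => [|p]; [exact: (fP (st 0%N)).1 | exact: (fP (st p.+1)).1].
- by case: p v => [|p]; [exact: (fP (st 0%N)).2 | exact: (fP (st p.+1)).2].
split=> [aug_a|[w wE]].
  by apply: M0E; rewrite mxE eqxx mulr1n.
have -> : a = (a%:M : 'M[A]_1) 0 0 by rewrite mxE eqxx mulr1n.
rewrite wE; apply: (submodule_mulmx (S := fun x => aug (x 0 0))) => //=.
- by rewrite mxE.
- by move=> x y ? ?; rewrite mxE; exact: augD.
by move=> b x ?; rewrite mxE; exact: augM.
Qed.

Section ResolutionComplex.
Variables (k : fieldType) (A : algType k) (eps : {lrmorphism A -> k^o}).
Variables (r : nat -> nat) (D : forall p, 'M[A]_(rk r p.+1, rk r p)).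
Hypothesis rD : free_resolution (fun a => eps a = 0) D.

Definition rk0 (n : nat) : nat := if n is p.+1 then rk r p else 0%N.
Definition free_obj (n : nat) : lmodType A := 'rV[A]_(rk0 n).
Local Notation Q := free_obj.

Definition free_mx (n : nat) : 'M[A]_(rk0 n, rk0 n.-1) :=
  match n with 0%N => 0 | 1%N => 0 | p.+2 => D p end.

Definition free_diff_fun n (v : Q n) : Q n.-1 := v *m free_mx n.
Fact free_diff_linear n : linear (@free_diff_fun n).
Proof. by move=> c u v; rewrite /free_diff_fun mulmxDl scalemxAl. Qed.
HB.instance Definition _ n := GRing.isLinear.Build A (Q n) (Q n.-1) _
  (@free_diff_fun n) (@free_diff_linear n).
Definition free_diff n : {linear Q n -> Q n.-1} := @free_diff_fun n.

Lemma free_diffK n (v : Q n) : free_diff n.-1 (free_diff n v) = 0.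
Proof.
rewrite /free_diff /= /free_diff_fun -mulmxA.
case: n v => [|[|[|n]]] v /=; rewrite ?mulmx0 //.
by rewrite (free_resK rD) mulmx0.
Qed.

(* P is zero in positive degrees and 'rV_(rk r n) in degree -n; free_idx      *)
(* shifts n by one so that index 0 stands for the zero module.               *)
Definition free_idx (i : int) : nat :=
  match i with Posz 0 => 1%N | Posz _.+1 => 0%N | Negz n => n.+2 end.

Lemma free_idxS i : free_idx (i + 1) = (free_idx i).-1.
Proof.
case: i => [[|n]|[|n]] //.
have -> : Negz n.+1 + 1 = Negz n by rewrite !NegzE -addn1 PoszD opprD addrNK.
by [].
Qed.

Lemma free_idxN (n : nat) : free_idx (- n%:Z) = n.+1.
Proof. by case: n => [|n] //; rewrite -NegzE. Qed.

Lemma free_idx_eq i (n : nat) : free_idx i = n.+1 -> i = - n%:Z.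
Proof.
by case: i => [[|m]|m] //= []; [move=> <- | move=> <-; rewrite NegzE].
Qed.

Definition free_cdiff (i j : int) : {linear Q (free_idx i) -> Q (free_idx j)} :=
  if j == i + 1 then
    (tr Q (free_idx i).-1 (free_idx j) \o free_diff (free_idx i))%FUN
      : {linear Q (free_idx i) -> Q (free_idx j)}
  else \0.

Definition free_complex : complex A.
Proof.
exists (fun i => Q (free_idx i)) free_cdiff; rewrite /free_cdiff.
  by move=> i j x /negPf ->.
move=> i j l x; case: ifP => _ //; case: ifP => [/eqP ->|_]; last by rewrite linear0.
rewrite /= free_idxS trE.
have e : free_diff (free_idx i).-1 (free_diff (free_idx i) x) = 0.
  exact: free_diffK.
by rewrite e linear0.
Defined.
Local Notation P := free_complex.

Definition aug_val i (v : P i) : triv A eps := eps (tr Q (free_idx i) 1 v 0 0).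
Fact aug_valP i (v : P i) : stalk_pred 0 i (aug_val v).
Proof.
rewrite /stalk_pred; case: eqVneq => //= i0.
rewrite /aug_val tr0 ?mxE ?linear0 ?eqxx //.
by apply: contraNneq i0 => /free_idx_eq ->.
Qed.
Definition aug_fun i (v : P i) : stalk 0 (triv A eps) i := StalkObj (aug_valP v).
Fact aug_linear i : linear (@aug_fun i).
Proof.
move=> c u v; apply: val_inj; rewrite /= /aug_val linearP /= !mxE.
by rewrite rmorphD rmorphM.
Qed.
HB.instance Definition _ i := GRing.isLinear.Build A (P i)
  (stalk 0 (triv A eps) i) _ (@aug_fun i) (@aug_linear i).

Lemma rk0_zero a (v : Q a) : a = 0%N -> v = 0.
Proof. by move=> a0; subst a; exact: thinmx0. Qed.

Lemma aug_val_diff a (v : Q a) :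
  eps (tr Q a.-1 1 (free_diff a v) 0 0) = 0.
Proof.
case: a v => [|[|[|a]]] v /=; try by rewrite tr0 // mxE linear0.
rewrite trE; apply/(free_res0 rD); exists v.
by rewrite [RHS]mx11_scalar.
Qed.

Definition aug_map : cmap P (stalk 0 (triv A eps)).
Proof.
exists (fun i => @aug_fun i : {linear P i -> stalk 0 (triv A eps) i}) => i j x.
rewrite [LHS]/=; have [ji|ji] := eqVneq j (i + 1); last first.
  by rewrite /= /free_cdiff (negPf ji) linear0.
apply: val_inj; rewrite /= /aug_val /free_cdiff ji eqxx [X in eps (_ X _ _)]/=.
by rewrite free_idxS trE; exact: aug_val_diff.
Defined.

Lemma rV_projective n : projective_module ('rV[A]_n : lmodType A).
Proof.
move=> M N f g fsurj.
have [m mP] := choice (fun j : 'I_n => fsurj (g (delta_mx 0 j))).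
pose h (v : 'rV[A]_n) := \sum_j v 0 j *: m j.
have lh : linear h.
  move=> c u v; rewrite /h scaler_sumr -big_split; apply: eq_bigr => j _.
  by rewrite !mxE scalerDl scalerA.
have H := GRing.isLinear.Build A 'rV[A]_n M _ h lh.
pose h' : {linear 'rV[A]_n -> M} := HB.pack h H.
exists h' => v; rewrite /= /h raddf_sum [in RHS](row_sum_delta v) raddf_sum.
apply: eq_bigr => j _; transitivity (v 0 j *: f (m j)); first exact: linearZ_LR.
by rewrite mP; apply/esym; exact: linearZ_LR.
Qed.

(** The indices are variables tied by equations so that a can be destructed. Index 1 is exactness at
    the augmentation, higher indices exactness between the matrices. *)
Lemma free_exact a b c (v : Q a) : b = a.+1 -> c = a.-1 -> a != 0%N ->
  tr Q a.-1 c (free_diff a v) = 0 -> eps (tr Q a 1 v 0 0) = 0 ->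
  exists y : Q b, tr Q b.-1 a (free_diff b y) = v.
Proof.
move=> -> ->; rewrite trE; case: a v => [|[|a]] v // _.
  rewrite trE => _ /(free_res0 rD) [w wE]; exists w; rewrite trE.
  by rewrite [RHS]mx11_scalar wE.
by move=> /(free_resE rD) [w ->] _; exists w; rewrite trE.
Qed.

Lemma aug_mapP : proj_resolution aug_map.
Proof.
split=> [i|i|[[|n]|n] // _ x]; last exact: thinmx0; last exact: rV_projective.
split=> [v cv [y /(congr1 val) /esym fv]|y _].
  have [i0|i0] := eqVneq (free_idx i) 0%N.
    by exists 0; rewrite linear0 (rk0_zero (a := free_idx i) v).
  have ei : free_idx (i - 1) = (free_idx i).+1.
    move: i0; case e : (free_idx i) => [|n] // _.
    by rewrite (free_idx_eq e) -opprD -PoszD addn1 free_idxN.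
  case: (@free_exact (free_idx i) (free_idx (i - 1)) (free_idx (i + 1)) v) => //.
  - exact: free_idxS.
  - by move: cv; rewrite /cocycle /= /free_cdiff eqxx.
  - move=> w wE; exists w; rewrite /= /free_cdiff subrK eqxx /=.
    exact: wE.
have [i0|i0] := eqVneq i 0; last first.
  suff -> : y = 0.
    exists 0; split; first by rewrite /cocycle linear0.
    by exists 0; rewrite linear0 sub0r -linearN oppr0 linear0.
  exact: (stalk_concentrated (m := 0)).
subst i; exists (((stalk_val y : k)%:A : A)%:M : 'rV_1); split.
  exact: thinmx0.
exists 0; rewrite linear0; apply: val_inj.
rewrite /= /aug_val [tr _ _ _ _]trE mxE eqxx mulr1n linearZ rmorph1 /=.
by rewrite [X in _ - X]mulr1 subrr.
Qed.

End ResolutionComplex.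

(** * The complex Hom_A(P, A) in terms of columns over A *)

Definition cmul (A : pzRingType) m n (D : 'M[A]_(m, n)) (u : {ffun 'I_n -> A}) :
  {ffun 'I_m -> A} := opm (fun i j => *%R (D i j)) u.

Section FreeCochains.
Variables (k : fieldType) (A : algType k) (eps : {lrmorphism A -> k^o}).
Variables (r : nat -> nat) (D : forall p, 'M[A]_(rk r p.+1, rk r p)).
Hypothesis rD : free_resolution (fun a => eps a = 0) D.
Local Notation P := (free_complex rD).
Local Notation Q := (free_obj A r).
Local Notation Y := (stalk 0 (regbim A)).
Local Notation C n := (ext_complex P n).

Definition pair_val n (u : {ffun 'I_(rk r n) -> A}) (v : Q n.+1) : A :=
  \sum_(l < rk r n) (v : 'rV_(rk r n)) 0 l * u l.

Lemma pair_val_linear n u c (v w : Q n.+1) :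
  pair_val u (c *: v + w) = c * pair_val u v + pair_val u w :> A.
Proof.
rewrite /pair_val mulr_sumr -big_split; apply: eq_bigr => l _.
by rewrite !mxE mulrDl mulrA.
Qed.

Lemma pair_val0 n (u : {ffun 'I_(rk r n) -> A}) : pair_val u 0 = 0.
Proof. by rewrite /pair_val big1 // => l _; rewrite mxE mul0r. Qed.

Lemma pair_val_diff n (u : {ffun 'I_(rk r n) -> A}) (v : Q n.+2) :
  pair_val u (free_diff D n.+2 v) = pair_val (cmul (D n) u) v.
Proof.
rewrite /pair_val; under eq_bigr => l _ do rewrite mxE mulr_suml.
rewrite exchange_big; apply: eq_bigr => h _; rewrite /= ffunE mulr_sumr.
by apply: eq_bigr => l _; rewrite mulrA.
Qed.

Lemma pair_val_delta n (u : {ffun 'I_(rk r n) -> A}) l :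
  pair_val u (delta_mx 0 l) = u l.
Proof.
rewrite /pair_val (bigD1 l) //= mxE !eqxx mul1r big1 ?addr0 // => j jl.
by rewrite mxE (negPf jl) andbF mul0r.
Qed.

Definition col_val n u (i j : int) (v : P i) : regbim A :=
  if j == 0 then pair_val u (tr Q (free_idx i) n.+1 v) else 0.
Fact col_valP n u i j (v : P i) : stalk_pred 0 j (@col_val n u i j v).
Proof. by rewrite /stalk_pred /col_val; case: (j == 0) => //=; rewrite eqxx. Qed.
(** A column u is the homomorphism v |-> v u on the free module of rank [rk r n]. That module sits
    in degree -n and A in degree 0, so only this pair of degrees carries a value. *)
Definition col_cochain n (u : {ffun 'I_(rk r n) -> A}) : C n%:Z.
Proof.
exists (fun i j v => StalkObj (@col_valP n u i j v) : Y j) => [i j e v w|i j v ij].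
  apply: val_inj; rewrite /= /col_val; case: (j == 0); last by rewrite scaler0 addr0.
  by rewrite linearP pair_val_linear bimod_scaleE /= mulr1.
apply: val_inj; rewrite /= /col_val; case: eqVneq => // j0.
rewrite tr0 ?pair_val0 //; apply: contraNneq ij => /free_idx_eq ->.
by rewrite j0 addNr.
Defined.

Lemma col_cochainE n u (v : P (- n%:Z)) :
  stalk_val ((col_cochain u : cochain _ _ _) (- n%:Z) 0 v)
  = pair_val u (tr Q (free_idx (- n%:Z)) n.+1 v).
Proof. by []. Qed.

Lemma free_cochainP (n : int) (f g : C n) :
  (forall v, (f : cochain _ _ _) (- n) 0 v = (g : cochain _ _ _) (- n) 0 v) -> f = g.
Proof.
move=> fg; apply: cochainP => i j v.
have [jn|jn] := eqVneq j (i + n); last by rewrite !cochain_deg.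
have [j0|j0] := eqVneq j 0; last first.
  by rewrite [LHS](stalk_concentrated (m := 0)) // [RHS](stalk_concentrated (m := 0)).
have iN : i = - n by apply/eqP; rewrite -addr_eq0 -jn j0.
by subst j i; rewrite j0; exact: fg.
Qed.

Lemma col_cochain_surj n (f : C n%:Z) : exists u, f = @col_cochain n u.
Proof.
pose u : {ffun 'I_(rk r n) -> A} := [ffun l =>
  stalk_val ((f : cochain _ _ _) (- n%:Z) 0
     (tr Q n.+1 (free_idx (- n%:Z)) (delta_mx 0 l : 'rV_(rk r n))))].
exists u; apply: free_cochainP => v; apply: val_inj.
rewrite [RHS]col_cochainE.
have tK : tr Q n.+1 (free_idx (- n%:Z)) (tr Q (free_idx (- n%:Z)) n.+1 v) = v.
  by rewrite trK ?free_idxN // trE.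
rewrite -{1}tK; move: (tr Q _ n.+1 v) => w; rewrite /pair_val.
pose F (w : Q n.+1) : A^o :=
  stalk_val ((f : cochain _ _ _) (- n%:Z) 0 (tr Q n.+1 (free_idx (- n%:Z)) w)).
have lF : linear F.
  by move=> e x y; rewrite /F linearP /= cochain_lin /= bimod_scaleE /= mulr1.
rewrite -[LHS]/(F w) {1}(row_sum_delta (w : 'rV_(rk r n))).
rewrite (big_morph F (linearDf lF) (linear0f lF)); apply: eq_bigr => l _.
by rewrite (linearZf _ _ lF) ffunE.
Qed.

Lemma col_cochainD n c u u' :
  @col_cochain n (c *: u + u') = (c%:A : A^c) *: col_cochain u + col_cochain u'.
Proof.
apply: cochainP => i j v; apply: val_inj; rewrite /= /col_val.
case: (j == 0); last by rewrite scaler0 addr0.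
rewrite bimod_scaleE /= mul1r /pair_val -[c%:A]/(c *: (1 : A)) -scalerAr mulr1.
rewrite scaler_sumr -big_split; apply: eq_bigr => l _.
by rewrite !ffunE mulrDr scalerAr.
Qed.

Lemma col_cochain0 n : @col_cochain n 0 = 0.
Proof.
apply: cochainP => i j v; apply: val_inj; rewrite /= /col_val.
by case: (j == 0) => //; rewrite /pair_val big1 // => l _; rewrite ffunE mulr0.
Qed.

Lemma col_cochain_inj n : injective (@col_cochain n).
Proof.
move=> u u' uu; apply/ffunP=> l; rewrite -!pair_val_delta.
have := congr1 (fun f : C n%:Z => stalk_val ((f : cochain _ _ _) (- n%:Z) 0
  (tr Q n.+1 (free_idx (- n%:Z)) (delta_mx 0 l : 'rV_(rk r n))))) uu.
rewrite /= /col_val eqxx.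
by rewrite !trK ?free_idxN // !trE.
Qed.

Lemma tr_free_diff n a b (v : Q a) : a = n.+2 -> b = n.+1 ->
  tr Q b n.+1 (tr Q a.-1 b (free_diff D a v)) = free_diff D n.+2 (tr Q a n.+2 v).
Proof. by move=> an bn; subst a b; rewrite !trE. Qed.

Lemma csign_neq0 n : ((csign n)%:~R : k) != 0.
Proof. by rewrite /csign rmorphXn /= rmorphN1 signr_eq0. Qed.

(** The sign of the Hom differential is recorded only as a nonzero scalar, which affects neither
    cocycles nor coboundaries. *)
Lemma col_cochain_diff n : exists2 s : k, s != 0 & forall u,
  cdiff (ext_complex P) n%:Z n.+1%:Z (@col_cochain n u)
  = col_cochain (s *: cmul (D n) u).
Proof.
exists (- (csign n%:Z)%:~R); first by rewrite oppr_eq0 csign_neq0.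
move=> u; apply: free_cochainP => v; apply: val_inj.
rewrite /= /hom_diff_fun; have -> : (n.+1%:Z == n%:Z + 1) = true.
  by rewrite -PoszD addn1 eqxx.
transitivity (- (pair_val u (tr Q (free_idx (- n.+1%:Z + 1)) n.+1
    (free_cdiff D (- n.+1%:Z) (- n.+1%:Z + 1) v)) *~ csign n%:Z)).
  by rewrite sub0r [LHS](raddfN \val) [X in - X](raddfMz \val).
have ei : free_idx (- n.+1%:Z + 1) = n.+1 by rewrite free_idxS free_idxN.
rewrite /free_cdiff eqxx [X in pair_val u X](tr_free_diff (n := n)) //.
rewrite pair_val_diff /col_val eqxx -scaler_int.
rewrite /pair_val -scaleNr scaler_sumr; apply: eq_bigr => l _.
by rewrite [in RHS]ffunE -scalerAr.
Qed.

Definition col_cob n : {ffun 'I_(rk r n) -> A} -> Prop :=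
  match n with
  | 0%N => fun u => u = 0
  | m.+1 => fun u => exists w, u = cmul (D m) w
  end.

Lemma cmulZ m n (M : 'M[A]_(m, n)) (s : k) u : cmul M (s *: u) = s *: cmul M u.
Proof.
rewrite (linearZf (f := cmul M)) //; apply: opm_linear => i j c x y.
by rewrite mulrDr scalerAr.
Qed.

Lemma col_cocycle n u : cocycle (@col_cochain n u) <-> cmul (D n) u = 0.
Proof.
have [s s0 sE] := col_cochain_diff n.
rewrite /cocycle -PoszD addn1 sE; split=> [|->]; last by rewrite scaler0 col_cochain0.
rewrite -[in RHS]col_cochain0 => /col_cochain_inj /eqP.
by rewrite scaler_eq0 (negPf s0) => /eqP.
Qed.

Lemma col_coboundary n u : coboundary (@col_cochain n u) <-> col_cob u.
Proof.
case: n u => [|n] u.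
  split=> [[f fE]|/= ->]; last by exists 0; rewrite linear0 col_cochain0.
  have f0 : f = 0.
    apply: free_cochainP => v; rewrite (rk0_zero (a := free_idx (- (0%:Z - 1))) v) //.
    by rewrite !cochain_map0.
  by apply: col_cochain_inj; rewrite -fE f0 linear0 col_cochain0.
have [s s0 sE] := col_cochain_diff n.
split=> [/(coboundaryE (j := n%:Z)) H|[w ->]].
  have [|f fE] := H; first by rewrite -PoszD addn1.
  have [w wE] := col_cochain_surj f; exists (s *: w); rewrite cmulZ.
  by apply: col_cochain_inj; rewrite -fE wE sE.
apply: (@coboundaryP _ (ext_complex P) _ n%:Z _ (col_cochain (s^-1 *: w))).
by rewrite sE cmulZ scalerA mulfV // scale1r.
Qed.

Section Gorenstein.
Variable d : nat.
Hypothesis Ext1 : one_dim_cohomology_at (ext_complex P) d%:Z.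
Hypothesis Ext0 : forall i : int, i <> d%:Z -> acyclic_at (ext_complex P) i.

Lemma col_exact n u : n != d -> cmul (D n) u = 0 -> @col_cob n u.
Proof.
move=> /eqP nd /col_cocycle cu; apply/col_coboundary; apply: Ext0 => //.
by case.
Qed.

Lemma col_generator : exists z : {ffun 'I_(rk r d) -> A},
  [/\ cmul (D d) z = 0, ~ col_cob z & forall u, cmul (D d) u = 0 ->
    exists c : k, col_cob (u - c *: z)].
Proof.
have [f [cf bf fP]] := Ext1; have [z zE] := col_cochain_surj f; exists z.
split; [by apply/col_cocycle; rewrite -zE | by move/col_coboundary; rewrite -zE |].
move=> u /col_cocycle /fP [c]; rewrite zE => H; exists c; apply/col_coboundary.
rewrite addrC -scaleNr col_cochainD scaleNr scaleNr addrC.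
exact: H.
Qed.

(** Right multiplication on A acts entrywise on columns, so the character of the integral can be
    read on column representatives. *)
Lemma col_integral (chi : {lrmorphism A -> k^o}) :
  left_integral_char A eps d chi ->
  forall z : {ffun 'I_(rk r d) -> A}, cmul (D d) z = 0 ->
  forall b, col_cob ([ffun l => z l * b] - (chi b : k) *: z).
Proof.
move=> Hchi z /col_cocycle cz b; apply/col_coboundary.
rewrite addrC -scaleNr col_cochainD addrC scaleNr scaleNr.
have := Hchi _ _ (aug_mapP rD) _ cz b.
suff -> : (b : A^c) *: (col_cochain z) = col_cochain [ffun l => z l * b] by [].
apply: cochainP => i j v; apply: val_inj; rewrite /= /col_val.
case: (j == 0); last by rewrite scaler0.
rewrite bimod_scaleE /= mul1r /pair_val mulr_suml.
by apply: eq_bigr => l _; rewrite ffunE mulrA.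
Qed.
End Gorenstein.

End FreeCochains.

(** * Cohomology of Hom out of a cyclic module, and truncation *)

Section CyclicHom.
Variables (k : fieldType) (E F : algType k).
Variables (X : complex E) (Y : complex (talg E F)) (t : int) (rho : X t).
Hypothesis Xt : concentrated t X.
Hypothesis gen : forall x : X t, exists e, x = e *: rho.

(** The possible values at rho of a homomorphism out of E rho, which is determined by that value. *)
Definition annihilated n (w : Y (t + n)) : Prop :=
  forall e, e *: rho = 0 -> (e \ox (1 : F)) *: w = 0.

Lemma cyc_ext n (f g : cochain X Y n) :
  f t (t + n) rho = g t (t + n) rho -> f = g.
Proof.
move=> fg; apply: cochainP => i j x.
have [jn|jn] := eqVneq j (i + n); last by rewrite !cochain_deg.
have [it|it] := eqVneq i t; last by rewrite (Xt it x) !cochain_map0.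
subst i j; have [e ->] := gen x.
have fe (h : cochain X Y n) : h t (t + n) (e *: rho) = (e \ox 1) *: h t (t + n) rho.
  by rewrite -[e *: rho]addr0 cochain_lin cochain_map0 addr0.
by rewrite !fe fg.
Qed.

Lemma cyc_mk n (w : Y (t + n)) : annihilated w ->
  exists f : cochain X Y n, f t (t + n) rho = w.
Proof.
move=> ann.
have [c cP] := choice gen.
pose f i j (x : X i) : Y j := tr Y (t + n) j ((c (tr X i t x) \ox 1) *: w).
have cw e e' : e *: rho = e' *: rho -> (e \ox (1 : F)) *: w = (e' \ox 1) *: w.
  move=> /eqP; rewrite -subr_eq0 -scalerBl => /eqP /ann.
  rewrite -scaleN1r atenDl atenZl scaleN1r scalerBl => /eqP.
  by rewrite subr_eq0 => /eqP.
have flin i j e x x' : f i j (e *: x + x') = (e \ox 1) *: f i j x + f i j x'.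
  rewrite /f -linearP; congr (tr _ _ _ _); rewrite scalerA -scalerDl.
  rewrite atenM mulr1 -atenDl; apply: cw.
  by rewrite scalerDl -scalerA -!cP linearP.
have fdeg i j x : j != i + n -> f i j x = 0.
  move=> jn; rewrite /f; have [it|it] := eqVneq i t.
    by subst i; rewrite tr0 // eq_sym.
  by rewrite [(_ \ox _) *: _]ann ?linear0 // -cP tr0.
exists (Cochain flin fdeg); rewrite /= /f !trE -[RHS]scale1r -aten1.
by apply: cw; rewrite -cP scale1r.
Qed.

Lemma cyc_annihilated n (f : cochain X Y n) : annihilated (f t (t + n) rho).
Proof.
move=> e e0; have := cochain_lin f (t + n) e rho 0.
by rewrite e0 addr0 !cochain_map0 addr0 => <-.
Qed.

Lemma cyc_diff n m j (f : cochain X Y n) : m = n + 1 -> j = t + m ->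
  (cdiff (hom_complex X Y) n m f : cochain X Y m) t j rho
  = cdiff Y (t + n) j (f t (t + n) rho).
Proof.
move=> mn jm; rewrite /= /hom_diff_fun mn eqxx.
have -> : cdiff X t (t + 1) rho = 0.
  by apply: Xt; rewrite -subr_eq0 addrAC subrr add0r.
rewrite cochain_map0 mul0rz subr0.
by have -> : j - 1 = t + n by rewrite jm mn addrA addrK.
Qed.

Lemma cyc_cocycle n (f : hom_complex X Y n) :
  cocycle f <-> cocycle ((f : cochain X Y n) t (t + n) rho).
Proof.
split=> [cf|cf].
  apply: (@cocycleP _ Y _ (t + (n + 1))); first by rewrite addrA.
  by rewrite -(cyc_diff (m := n + 1)) // [cdiff _ _ _ _]cf.
apply: cyc_ext; rewrite (cyc_diff (m := n + 1)) //.
exact: (cocycleE cf).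
Qed.

Lemma cyc_coboundary n (f : hom_complex X Y n) : coboundary f <->
  exists2 w : Y (t + (n - 1)), annihilated w &
    cdiff Y _ (t + n) w = (f : cochain X Y n) t (t + n) rho.
Proof.
split=> [[h <-]|[w /cyc_mk [h <-] hw]].
  exists ((h : cochain X Y (n - 1)) t (t + (n - 1)) rho).
    exact: cyc_annihilated.
  by rewrite (cyc_diff (m := n)) // subrK.
exists h; apply: cyc_ext; rewrite (cyc_diff (m := n)) //.
by rewrite subrK.
Qed.

End CyclicHom.

Lemma subrBB (V : zmodType) (x y z : V) : x - y - (z - y) = x - z.
Proof. by rewrite opprB addrA subrK. Qed.

Section Concentration.
Variables (F : pzRingType) (X : complex F) (t : int) (M : lmodType F).

(** An isomorphism from M to the cohomology in degree t, given on representatives: these are chosen,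
    so [phi] is linear only modulo coboundaries. *)
Record cohomology_map (phi : M -> X t) : Prop := CohomologyMap {
  coh_cocycle : forall m, cocycle (phi m);
  coh_linear : forall c m m', coboundary (phi (c *: m + m') - (c *: phi m + phi m'));
  coh_inj : forall m, coboundary (phi m) -> m = 0;
  coh_surj : forall x, cocycle x -> exists m, coboundary (x - phi m) }.

Lemma coboundary0 i : coboundary (0 : X i).
Proof. by exists 0; rewrite linear0. Qed.
Lemma coboundaryP_lin i c (x y : X i) :
  coboundary x -> coboundary y -> coboundary (c *: x + y).
Proof. by move=> [u <-] [v <-]; exists (c *: u + v); rewrite linearP. Qed.
Lemma coboundaryD i (x y : X i) : coboundary x -> coboundary y -> coboundary (x + y).
Proof. by move=> cx cy; rewrite -[x]scale1r; exact: coboundaryP_lin. Qed.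
Lemma coboundaryN i (x : X i) : coboundary x -> coboundary (- x).
Proof. by move=> [u <-]; exists (- u); rewrite linearN. Qed.
Lemma coboundaryB i (x y : X i) : coboundary x -> coboundary y -> coboundary (x - y).
Proof. by move=> cx cy; apply: coboundaryD => //; exact: coboundaryN. Qed.
Lemma coboundaryZ i c (x : X i) : coboundary x -> coboundary (c *: x).
Proof. by move=> [u <-]; exists (c *: u); rewrite linearZ_LR. Qed.

Section Truncation.
Variable i : int.
Definition trunc_pred : pred (X i) :=
  fun x => [|| i < t, (i == t) && `[< cocycle x >] | x == 0].
Record trunc_obj := TruncObj { trunc_val : X i; trunc_valP : trunc_pred trunc_val }.
Fact trunc_submod : submod_closed trunc_pred.
Proof.
split=> [|e x y]; rewrite !unfold_in ?eqxx ?orbT //.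
case: (i < t) => //=; case: (i == t) => /=; last first.
  by move=> /eqP-> /eqP->; rewrite scaler0 addr0.
have c0 z : `[< cocycle z >] || (z == 0) -> cocycle z.
  by case/orP => [/asboolP //|/eqP ->]; rewrite /cocycle linear0.
move=> /c0 cx /c0 cy; apply/orP; left; apply/asboolP.
by rewrite /cocycle linearP cx cy scaler0 addr0.
Qed.
HB.instance Definition _ :=
  GRing.isSubmodClosed.Build F (X i) trunc_pred trunc_submod.
HB.instance Definition _ := [isSub of trunc_obj for trunc_val].
HB.instance Definition _ := [Choice of trunc_obj by <:].
HB.instance Definition _ := [SubChoice_isSubLmodule of trunc_obj by <:].
End Truncation.

Lemma trunc_diffP i j (x : trunc_obj i) : trunc_pred (cdiff X i j (trunc_val x)).
Proof.
have [ji|ji] := eqVneq j (i + 1); last by rewrite /trunc_pred cdiff_shape // eqxx !orbT.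
have [it|ti|it] := ltgtP i t.
- rewrite /trunc_pred; have: j <= t by rewrite ji lezD1.
  rewrite le_eqVlt => /orP[/eqP->|-> //]; rewrite eqxx /=.
  by apply/orP; right; apply/orP; left; apply/asboolP; rewrite /cocycle cdiffK.
- have := trunc_valP x; rewrite /trunc_pred.
  rewrite (ltNge i) (ltW ti) (gt_eqF ti) /= => /eqP ->.
  by rewrite linear0 eqxx !orbT.
subst i; have := trunc_valP x; rewrite /trunc_pred ltxx eqxx /= => H.
have -> : cdiff X t j (trunc_val x) = 0; last by rewrite eqxx !orbT.
case/orP: H => [/asboolP /cocycleE //|/eqP ->]; exact: linear0.
Qed.
Definition trunc_diff_fun i j (x : trunc_obj i) : trunc_obj j :=
  TruncObj (trunc_diffP j x).
Fact trunc_diff_linear i j : linear (@trunc_diff_fun i j).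
Proof. by move=> c x y; apply: val_inj; rewrite /= linearP. Qed.
HB.instance Definition _ i j := GRing.isLinear.Build F (trunc_obj i) (trunc_obj j)
  _ (@trunc_diff_fun i j) (@trunc_diff_linear i j).

Definition truncation : complex F.
Proof.
exists (fun i => trunc_obj i : lmodType F)
       (fun i j => @trunc_diff_fun i j : {linear _ -> _}).
- by move=> i j x ij; apply: val_inj; rewrite /= cdiff_shape.
- by move=> i j l x; apply: val_inj; rewrite /= cdiffK.
Defined.

Definition trunc_incl_fun i (x : truncation i) : X i := trunc_val x.
Fact trunc_incl_linear i : linear (@trunc_incl_fun i).
Proof. by []. Qed.
HB.instance Definition _ i := GRing.isLinear.Build F (truncation i) (X i)
  _ (@trunc_incl_fun i) (@trunc_incl_linear i).
Definition trunc_incl : cmap truncation X.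
Proof. by exists (fun i => @trunc_incl_fun i : {linear _ -> _}). Defined.

Lemma trunc_cocycle i (x : trunc_obj i) : t <= i -> cocycle (trunc_val x).
Proof.
move=> ti; have := trunc_valP x; rewrite /trunc_pred ltNge ti /=.
case/orP => [/andP[_ /asboolP]//|/eqP ->]; by rewrite /cocycle linear0.
Qed.

Lemma trunc_zero i (x : trunc_obj i) : t < i -> x = 0.
Proof.
move=> ti; suff x0 : trunc_val x = 0 by exact: val_inj.
by have := trunc_valP x; rewrite /trunc_pred (ltNge i) (ltW ti) (gt_eqF ti) => /eqP.
Qed.

Lemma trunc_coboundary i (x : truncation i) : i <= t ->
  coboundary (trunc_val x) -> coboundary x.
Proof.
move=> it [y yx]; have yP : trunc_pred y.
  by apply/or3P; apply: Or31; rewrite ltrBlDr ltzD1.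
by exists (TruncObj yP); apply: val_inj.
Qed.

Hypothesis acyc : forall i, i != t -> acyclic_at X i.

Lemma trunc_incl_qiso : qiso trunc_incl.
Proof.
move=> i; split=> [x cx fx|y cy].
  have [it|ti] := leP i t; first exact: trunc_coboundary.
  by rewrite (trunc_zero x ti); exists 0; rewrite linear0.
have [it|ti|it] := ltgtP i t.
- have yP : trunc_pred y by rewrite /trunc_pred it.
  exists (TruncObj yP); split; first exact: val_inj.
  by rewrite /= /trunc_incl_fun subrr; exact: coboundary0.
- exists 0; split; first by rewrite /cocycle linear0.
  by rewrite (linear0 (trunc_incl i)) subr0; apply: acyc cy; rewrite gt_eqF.
subst i; have yP : trunc_pred y.
  by rewrite /trunc_pred ltxx eqxx /=; apply/orP; left; apply/asboolP.
exists (TruncObj yP); split; first exact: val_inj.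
by rewrite /= /trunc_incl_fun subrr; exact: coboundary0.
Qed.

Variable phi : M -> X t.
Hypothesis phiP : cohomology_map phi.

Lemma coh_eq m m' x : coboundary (x - phi m) -> coboundary (x - phi m') -> m = m'.
Proof.
move=> cm cm'; apply/eqP; rewrite eq_sym -subr_eq0 -scaleN1r addrC; apply/eqP.
apply: (coh_inj phiP); rewrite -[phi _](subrK (-1 *: phi m + phi m')).
apply: coboundaryD; first exact: (coh_linear phiP).
have -> : -1 *: phi m + phi m' = (x - phi m) - (x - phi m').
  by rewrite opprB [RHS]addrC addrA addrNK addrC scaleN1r.
exact: coboundaryB.
Qed.

Let proj_ex i (x : trunc_obj i) :
  exists m, coboundary (tr (cobj X) i t (trunc_val x) - phi m).
Proof.
apply: (coh_surj phiP); have [it|it] := eqVneq i t; last first.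
  by rewrite tr0 // /cocycle linear0.
by subst i; rewrite trE; exact: trunc_cocycle.
Qed.

Definition trunc_proj_val i (x : trunc_obj i) : M := sval (cid (proj_ex x)).
Let projP i (x : trunc_obj i) := svalP (cid (proj_ex x)).

Lemma coh_zero : coboundary (phi 0).
Proof.
have := coh_linear phiP 0 0 0; rewrite scale0r add0r scale0r add0r subrr => _.
have := coh_linear phiP 1 0 0; rewrite !scale1r addr0 opprD addrA subrr sub0r.
by move=> /coboundaryN; rewrite opprK.
Qed.

Lemma trunc_proj_valP i (x : trunc_obj i) : stalk_pred t i (trunc_proj_val x).
Proof.
rewrite /stalk_pred; case: eqVneq => //= it; apply/eqP.
apply: (coh_eq (projP x)); rewrite tr0 // sub0r.
by apply: coboundaryN; exact: coh_zero.
Qed.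
Definition trunc_proj_fun i (x : truncation i) : stalk t M i :=
  StalkObj (trunc_proj_valP x).
Fact trunc_proj_linear i : linear (@trunc_proj_fun i).
Proof.
move=> c x y; apply: val_inj; rewrite /=.
apply: (coh_eq (projP _)); rewrite /= linearP.
have := coboundaryP_lin c (projP x) (projP y).
set a := tr _ _ _ _; set b := tr _ _ _ _.
rewrite -/(trunc_proj_val x) -/(trunc_proj_val y) scalerBr addrACA -opprD.
move=> H; have := coboundaryB H (coh_linear phiP c (trunc_proj_val x) (trunc_proj_val y)).
by rewrite subrBB.
Qed.
HB.instance Definition _ i := GRing.isLinear.Build F (truncation i) (stalk t M i)
  _ (@trunc_proj_fun i) (@trunc_proj_linear i).

Lemma trunc_projE (x : truncation t) m :
  coboundary (trunc_val x - phi m) -> trunc_proj_val x = m.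
Proof. by move=> H; apply: coh_eq (projP x) _; rewrite trE. Qed.

Definition trunc_proj : cmap truncation (stalk t M).
Proof.
exists (fun i => @trunc_proj_fun i : {linear _ -> _}) => i j x; rewrite [RHS]/=.
have [jt|jt] := eqVneq j t; last exact: (stalk_concentrated (m := t)).
subst j; apply: val_inj; rewrite /=; apply: trunc_projE => /=.
apply: coboundaryB; last exact: coh_zero.
exact: (@coboundaryP _ X _ i).
Defined.

Lemma trunc_proj_qiso : qiso trunc_proj.
Proof.
move=> i; have [it|it] := eqVneq i t; last first.
  split=> [x cx _|y _].
    have [lit|tli] := leP i t; last first.
      by rewrite (trunc_zero x tli); exists 0; rewrite linear0.
    apply: trunc_coboundary lit _; apply: acyc => //.
    by move: cx => /(congr1 val).
  exists 0; split; first by rewrite /cocycle linear0.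
  rewrite (stalk_concentrated (m := t) it (y - _)).
  by exists 0; rewrite linear0.
subst i; split=> [x cx [y /(congr1 val) /= /esym x0]|y _].
  apply: trunc_coboundary => //; have := projP x.
  rewrite -/(trunc_proj_val x) x0 trE => H.
  by rewrite -[trunc_val x](subrK (phi 0)); apply: coboundaryD H coh_zero.
have xP : trunc_pred (phi (stalk_val y)).
  rewrite /trunc_pred ltxx eqxx /=; apply/orP; left; apply/asboolP.
  exact: (coh_cocycle phiP).
exists (TruncObj xP); split; first by apply: val_inj; exact: (coh_cocycle phiP).
exists 0; rewrite linear0; apply: val_inj => /=.
rewrite (trunc_projE (m := stalk_val y)) ?subrr //=.
exact: coboundary0.
Qed.

(** The roof is the canonical truncation of X in degrees at most t, which includes into X and
    projects onto its top cohomology. *)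
Lemma derived_iso_concentrated : derived_iso (stalk t M) X.
Proof.
exists truncation, trunc_proj, trunc_incl; split.
  exact: trunc_proj_qiso.
exact: trunc_incl_qiso.
Qed.

End Concentration.

(** Each m is lifted along one leg of the roof to a cocycle and pushed along the other; two lifts
    differ by a coboundary. *)
Lemma derived_iso_cohomology (F : pzRingType) (X : complex F) (t : int)
    (M : lmodType F) :
  derived_iso (stalk t M) X -> exists phi : M -> X t, cohomology_map phi.
Proof.
move=> [Z [f [g [qf qg]]]].
have ex m : exists z : Z t, cocycle z /\ stalk_val (f t z) = m.
  have mP : stalk_pred t t m by rewrite /stalk_pred eqxx.
  have [|z [cz [y /(congr1 val) /= e]]] := (qf t).2 (StalkObj mP).
    by [].
  by exists z; split=> //; apply/eqP; rewrite eq_sym -subr_eq0 -e.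
have [z zP] := choice ex.
have inj (y : Z t) : cocycle y -> stalk_val (f t y) = 0 -> coboundary y.
  move=> cy fy; apply: (qf t).1 => //; exists 0; rewrite linear0.
  exact/val_inj/esym.
exists (fun m => g t (z m)); split.
- move=> m; rewrite /cocycle -cmapC.
  by have [cz _] := zP m; rewrite [cdiff _ _ _ _]cz linear0.
- move=> c m m'; rewrite -linearP -linearB.
  have [y yE] : coboundary (z (c *: m + m') - (c *: z m + z m')).
    have [c1 e1] := zP (c *: m + m'); have [c2 e2] := zP m; have [c3 e3] := zP m'.
    apply: inj; first by rewrite /cocycle linearB linearP c1 c2 c3 scaler0 addr0 subr0.
    by rewrite linearB linearP /= e1 e2 e3 subrr.
  by exists (g _ y); rewrite -cmapC yE.
- move=> m H; have [cz <-] := zP m.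
  by have [y <-] := (qg t).1 _ cz H; rewrite cmapC.
move=> x /(qg t).2 [y [cy H]]; exists (stalk_val (f t y)).
have [cz ze] := zP (stalk_val (f t y)).
rewrite -[x](subrK (g t y)) -addrA -linearB; apply: coboundaryD => //.
have [||w wE] := inj (y - z (stalk_val (f t y))).
- by rewrite /cocycle linearB cz cy subr0.
- by rewrite linearB /= ze subrr.
by exists (g _ w); rewrite -cmapC wE.
Qed.

(** * Base change to the enveloping algebra *)

Definition row_ffun (R : pzRingType) n (v : 'rV[R]_n) : {ffun 'I_n -> R} :=
  [ffun j => v 0 j].

Lemma row_ffun_inj (R : pzRingType) n : injective (@row_ffun R n).
Proof.
move=> u v /ffunP uv; apply/rowP=> j; have := uv j; by rewrite !ffunE.
Qed.

Lemma row_ffun_surj (R : pzRingType) n (u : {ffun 'I_n -> R}) :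
  exists v, u = row_ffun v.
Proof. by exists (\row_j u j); apply/ffunP=> j; rewrite !ffunE mxE. Qed.

Lemma row_ffun_mulmx (R : pzRingType) m n (M : 'M[R]_(m, n)) (v : 'rV[R]_m) :
  row_ffun (v *m M) = opm (fun j i => *%R^~ (M i j)) (row_ffun v).
Proof.
by apply/ffunP=> j; rewrite !ffunE mxE; apply: eq_bigr => i _; rewrite ffunE.
Qed.

Lemma row_ffun0 (R : pzRingType) n : row_ffun (0 : 'rV[R]_n) = 0.
Proof. by apply/ffunP=> j; rewrite !ffunE mxE. Qed.

(* [Phi] presents R2 as the free right R1-module R1 (x) V.                    *)
Lemma row_exact_base_change (k : fieldType) (R1 R2 : algType k) (V : lmodType k)
    (phi : {rmorphism R1 -> R2}) (Phi : tensor R1 V -> R2) (Psi : R2 -> tensor R1 V)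
    l m n (M : 'M[R1]_(m, n)) (N : 'M[R1]_(l, m)) :
  (forall x y, Phi (x + y) = Phi x + Phi y) -> cancel Phi Psi -> cancel Psi Phi ->
  (forall x a v, Phi (tens (x * a) v) = Phi (tens x v) * phi a) ->
  (forall v : 'rV_m, v *m M = 0 -> exists w, v = w *m N) ->
  forall v : 'rV_m, v *m map_mx phi M = 0 -> exists w, v = w *m map_mx phi N.
Proof.
move=> PhiD PhiK PsiK PhiM ex v vM.
have lin (a : R1) : linear ( *%R^~ a) by move=> c x y; rewrite mulrDl scalerAl.
have comp a : compatible Phi ( *%R^~ a) ( *%R^~ (phi a)).
  by split=> [s t|x w]; rewrite ?mulrDl ?PhiM.
have [||y [w vE]] := opm_exact PhiD PhiK PsiK (fun i j => lin (M j i))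
  (fun i j => lin (N j i)) (fun i j => comp (M j i)) (fun i j => comp (N j i))
  (z := 0) _ (t := row_ffun v).
- move=> u; have [x ->] := row_ffun_surj u; rewrite -row_ffun_mulmx.
  rewrite -(row_ffun0 _ n) => /row_ffun_inj /ex [w ->]; exists 0, (row_ffun w).
  by rewrite scaler0 add0r row_ffun_mulmx.
- rewrite -[RHS](row_ffun0 _ n) -vM row_ffun_mulmx; apply/ffunP=> i; rewrite !ffunE.
  by apply: eq_bigr => j _; rewrite mxE.
have [x xE] := row_ffun_surj w; exists x; apply: row_ffun_inj.
rewrite vE xE row_ffun_mulmx coltenE; apply/ffunP=> i; rewrite !ffunE.
rewrite (linear0f ((tens_bilin _ _).1 y)) (Phi_zero PhiD) add0r.
by apply: eq_bigr => j _; rewrite mxE.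
Qed.

(** E (x) F is visibly a free right E-module, so [Phi] is the identity. *)
Lemma row_exact_tinl (k : fieldType) (E F : algType k) l m n
    (M : 'M[E]_(m, n)) (N : 'M[E]_(l, m)) :
  (forall v : 'rV_m, v *m M = 0 -> exists w, v = w *m N) ->
  forall v : 'rV_m, v *m map_mx (tinl E F) M = 0 ->
    exists w, v = w *m map_mx (tinl E F) N.
Proof.
pose Phi (x : tensor E F) : talg E F := x; pose Psi (x : talg E F) : tensor E F := x.
apply: (row_exact_base_change (Phi := Phi) (Psi := Psi)) => // x a v.
by rewrite -[RHS]/((x \ox v) * (a \ox 1)) atenM mulr1.
Qed.

Section InjectiveExact.
Variables (L : pzRingType) (N : lmodType L).
Hypothesis inj : injective_module N.

Section Image.
Variables (B C : lmodType L) (p : {linear B -> C}).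
Definition im_pred : pred C := fun c => `[< exists b, c = p b >].
Record im_obj := ImObj { im_val : C; im_valP : im_pred im_val }.
Fact im_submod : submod_closed im_pred.
Proof.
split=> [|e x y]; rewrite !unfold_in; first by apply/asboolP; exists 0; rewrite linear0.
move=> /asboolP [u ->] /asboolP [v ->]; apply/asboolP.
by exists (e *: u + v); rewrite linearP.
Qed.
HB.instance Definition _ := GRing.isSubmodClosed.Build L C im_pred im_submod.
HB.instance Definition _ := [isSub of im_obj for im_val].
HB.instance Definition _ := [Choice of im_obj by <:].
HB.instance Definition _ := [SubChoice_isSubLmodule of im_obj by <:].

(** The condition on kernels makes u a map on the image of p, which extends to C by injectivity of
    N. *)
Lemma injective_factor (u : {linear B -> N}) :
  (forall b, p b = 0 -> u b = 0) ->
  exists v : {linear C -> N}, forall b, v (p b) = u b.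
Proof.
move=> ker.
have ex (c : im_obj) : exists b, im_val c = p b by have := im_valP c => /asboolP.
have [s sP] := choice ex.
have us (c : im_obj) b : im_val c = p b -> u (s c) = u b.
  move=> cb; apply/eqP; rewrite -subr_eq0 -linearB; apply/eqP; apply: ker.
  by rewrite linearB -sP cb subrr.
pose g (c : im_obj) := u (s c).
have lg : linear g.
  move=> e x y; rewrite /g -linearP; apply: us => /=.
  by rewrite linearP /= -!sP.
have lv : linear im_val by [].
have H1 := GRing.isLinear.Build L im_obj N _ g lg.
have H2 := GRing.isLinear.Build L im_obj C _ im_val lv.
pose g' : {linear im_obj -> N} := HB.pack g H1.
pose v' : {linear im_obj -> C} := HB.pack im_val H2.
have [h hP] := inj (f := v') g' val_inj.
exists h => b; have bP : im_pred (p b) by apply/asboolP; exists b.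
by rewrite -[p b]/(v' (ImObj bP)) hP; exact: us.
Qed.
End Image.

(** A column u is a homomorphism L^m -> N. If M' kills it, it vanishes on the row space of M', hence
    on the kernel of M, and so factors through M. *)
Lemma mact_exact l m n (M : 'M[L]_(m, n)) (M' : 'M[L]_(l, m)) :
  (forall v : 'rV_m, v *m M = 0 -> exists w, v = w *m M') ->
  forall u : {ffun 'I_m -> N}, mact M' u = 0 -> exists v, u = mact M v.
Proof.
move=> ex u Mu.
pose pm (v : 'rV[L]_m) : 'rV[L]_n := v *m M.
have lpm : linear pm by move=> c x y; rewrite /pm mulmxDl scalemxAl.
pose um (v : 'rV[L]_m) : N := \sum_i v 0 i *: u i.
have lum : linear um.
  move=> c x y; rewrite /um scaler_sumr -big_split; apply: eq_bigr => i _.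
  by rewrite !mxE scalerDl scalerA.
have H1 := GRing.isLinear.Build L 'rV[L]_m 'rV[L]_n _ pm lpm.
have H2 := GRing.isLinear.Build L 'rV[L]_m N _ um lum.
pose pm' : {linear 'rV[L]_m -> 'rV[L]_n} := HB.pack pm H1.
pose um' : {linear 'rV[L]_m -> N} := HB.pack um H2.
have [|h hP] := @injective_factor _ _ pm' um'.
  move=> b /ex [w ->]; rewrite /= /um.
  under eq_bigr => i _ do rewrite mxE scaler_suml.
  rewrite exchange_big big1 // => j _ /=.
  under eq_bigr => i _ do rewrite -scalerA.
  by rewrite -scaler_sumr; have /ffunP/(_ j) := Mu; rewrite !ffunE => ->; rewrite scaler0.
exists [ffun j => h (delta_mx 0 j)]; apply/ffunP=> i; rewrite ffunE.
have := hP (delta_mx 0 i); rewrite /= /um (bigD1 i) //= mxE !eqxx scale1r.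
rewrite big1 => [|j ji]; last by rewrite mxE (negPf ji) andbF scale0r.
rewrite addr0 => <-; rewrite /pm -rowE [row i M]row_sum_delta raddf_sum.
apply: eq_bigr => j _; rewrite !mxE ffunE; exact: linearZ_LR.
Qed.
End InjectiveExact.

Section EnvelopingResolution.
Variables (k : fieldType) (A : algType k) (H : hopf A).
Local Notation Ae := (talg A A^c).
Variable F : algType k.
Local Notation L := (talg Ae F).
Local Notation eps := (counit H).
Variables (r : nat -> nat) (D : forall p, 'M[A]_(rk r p.+1, rk r p)).
Hypothesis rD : free_resolution (fun a => eps a = 0) D.

(** The factor F carries the structure that remains on the coefficients; it commutes with the image
    of [delta]. *)
Definition env_hom (a : A) : L := delta H a \ox 1.
Fact env_hom_linear : linear env_hom.
Proof. by move=> c x y; rewrite /env_hom linearP atenDl atenZl. Qed.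
Fact env_hom_monoid : monoid_morphism env_hom.
Proof.
split=> [|x y]; first by rewrite /env_hom rmorph1.
by rewrite /env_hom rmorphM atenM mulr1.
Qed.
HB.instance Definition _ := GRing.isLinear.Build k A L _ env_hom env_hom_linear.
HB.instance Definition _ := GRing.isMonoidMorphism.Build A L env_hom env_hom_monoid.

Definition env_mx p : 'M[L]_(rk r p.+1, rk r p) := map_mx env_hom (D p).

Lemma env_mxK p : env_mx p.+1 *m env_mx p = 0.
Proof. by rewrite -map_mxM (free_resK rD) map_mx0. Qed.

(** Row exactness passes along [delta] and then along A^e -> A^e (x) F, the target being free on the
    right both times; injectivity of [J q] turns it into exactness on columns. *)
Lemma env_mx_exact (J : nat -> lmodType L) :
  (forall q, injective_module (J q)) -> row_exact J env_mx.
Proof.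
move=> injJ; split=> [p|q p u]; first exact: env_mxK.
apply: (mact_exact (injJ q)) => v.
have e n m (M : 'M[A]_(m, n)) :
    map_mx env_hom M = map_mx (tinl Ae F) (map_mx (delta H) M).
  by apply/matrixP=> i j; rewrite !mxE.
rewrite /env_mx !e; apply: row_exact_tinl => {}v.
apply: (row_exact_base_change (Phi := env_iso H) (Psi := env_iso_inv H)).
- exact: (linearDf (env_iso_linear H)).
- exact: env_isoK.
- exact: env_iso_invK.
- by move=> x a y; exact: env_iso_mulr.
exact: (free_resE rD).
Qed.

Lemma env_act1 (a : A) (b : A^c) :
  (a \ox b) *: (1 : regbim A) = (a * (b : A) : A).
Proof. by rewrite bimod_scaleE /= mul1r. Qed.

Lemma regbim_scaleZ (c : k) (t : Ae) (m : regbim A) :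
  (c *: t) *: m = c *: (t *: m : A).
Proof.
rewrite -[in LHS]mulr_algl -scalerA -[c%:A]atenZl bimod_scaleE /= mulr1.
by rewrite mulr_algl.
Qed.

Lemma regbim_linear (m : regbim A) : linear (fun t : Ae => t *: m : A).
Proof. by move=> c x y; rewrite scalerDl regbim_scaleZ. Qed.

Lemma delta_act1 a : delta H a *: (1 : regbim A) = (eps a : k) *: (1 : A).
Proof.
rewrite deltaE (sw_comp H _ _ (regbim_linear 1)).
rewrite -(sw_antipoder H a (h := id)) //; apply: eq_sw => x y.
by rewrite bimod_scaleE /= mul1r.
Qed.

Section Annihilator.
Variable N : lmodType L.

Lemma kscale_linear (w : N) : linear (fun t : Ae => (t \ox (1 : F)) *: w : restr (in_alg L) N).
Proof. by move=> c x y; rewrite atenDl atenZl scalerDl -[in LHS]mulr_algl -scalerA. Qed.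

(** By [delta_move], a (x) b is congruent to ab (x) 1 modulo A^e delta(ker eps), so e acts on w as
    (e . 1) (x) 1 does. *)
Lemma annihilated_delta (w : N) :
  (forall a, eps a = 0 -> env_hom a *: w = 0) ->
  forall e : Ae, e *: (1 : regbim A) = 0 -> (e \ox 1) *: w = 0.
Proof.
move=> ann.
have ann' a : env_hom a *: w = ((eps a : k)%:A : L) *: w.
  have e0 : eps (a - (eps a : k)%:A) = 0.
    rewrite rmorphB; apply/eqP; rewrite subr_eq0; apply/eqP/esym.
    transitivity ((eps a : k) *: eps 1); first exact: linearZ_LR.
    by rewrite rmorph1; exact: mulr1.
  move: (ann _ e0) => /eqP; rewrite rmorphB scalerBl subr_eq0 => /eqP ->.
  congr (_ *: w); transitivity ((eps a : k) *: env_hom 1); first exact: linearZ_LR.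
  by rewrite rmorph1.
pose g (t : Ae) : restr (in_alg L) N := (t \ox (1 : F)) *: w.
have lg : linear g := kscale_linear w.
have l2 : linear (fun b : A => g (1 \ox (b : A^c))).
  by move=> c x y; rewrite -lg; congr g; exact: (aten_bilin A A^c).2.
have gM s t : g (s * t) = (s \ox 1) *: (g t : N).
  by rewrite /g scalerA atenM mulr1.
have move1 (b : A) : g (b \ox (1 : A^c)) = g (1 \ox (b : A^c)).
  rewrite (delta_move H) (sw_comp H _ _ lg).
  rewrite -(sw_counitl H b l2); apply: eq_sw => b1 b2.
  rewrite gM [X in _ *: X]ann' [RHS]restr_in_algE /g !scalerA.
  by rewrite mulr_algr mulr_algl.
have main (e : Ae) : g e = g ((e *: (1 : regbim A) : A) \ox (1 : A^c)).
  have lr : linear (fun a : A => g (a \ox (1 : A^c))).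
    by move=> c x y; rewrite -lg; congr g; exact: (aten_bilin A A^c).1.
  elim/talg_ind: e => [|c a b e IH].
    by rewrite scale0r (linear0f lr) (linear0f lg).
  rewrite lg IH regbim_linear lr env_act1; congr (_ *: _ + _).
  have eM : a \ox b = (a \ox (1 : A^c)) * (1 \ox b) by rewrite atenM mulr1 mul1r.
  by rewrite eM gM -move1 -gM atenM mulr1.
move=> e e1; rewrite -[LHS]/(g e) main e1 /g.
by rewrite (linear0f ((aten_bilin A A^c).1 1)) (linear0f ((aten_bilin Ae F).1 1)) scale0r.
Qed.

(** The entries of [D 0] generate ker eps, and delta(ker eps) generates the annihilator of 1 in A^e;
    hence A is the module that [env_mx] resolves. *)
Lemma annihilatedP (w : N) :
  (forall e : Ae, e *: (1 : regbim A) = 0 -> (e \ox (1 : F)) *: w = 0) <->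
  mact (env_mx 0) [ffun=> w] = 0.
Proof.
split=> [ann|Dw].
  apply/ffunP=> i; rewrite !ffunE big_ord1 ffunE mxE; apply: ann.
  rewrite delta_act1; have -> : eps (D 0%N i 0) = 0; last by rewrite scale0r.
  apply/(free_res0 rD); exists (delta_mx 0 i); rewrite -rowE.
  by apply/matrixP=> a b; rewrite !ord1 !mxE eqxx mulr1n.
apply: annihilated_delta => a /(free_res0 rD) [v vE].
have -> : a = (a%:M : 'M[A]_1) 0 0 by rewrite mxE eqxx mulr1n.
rewrite vE mxE rmorph_sum scaler_suml big1 // => i _; rewrite rmorphM -scalerA.
have /ffunP/(_ i) := Dw; rewrite !ffunE big_ord1 ffunE mxE => e.
by rewrite [X in _ *: X]e scaler0.
Qed.
End Annihilator.

End EnvelopingResolution.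

(** * The coefficients of the rigidity condition *)

Section TwistedTensor.
Variables (k : fieldType) (A : algType k) (H : hopf A).
Local Notation Ae := (talg A A^c).
Local Notation L := (talg Ae Ae).
Local Notation S := (antipode H).
Local Notation eps := (counit H).
Variables (mu : {lrmorphism A -> A}) (mu' : A -> A).
Hypotheses (muK : cancel mu mu') (mu'K : cancel mu' mu).
Variable m : int.
Local Notation M := (twist mu (regbim A)).
Local Notation R := (stalk m M).
Local Notation X := (tensor_op R).
Local Notation t := (m + m).
Local Notation T := (X t).

Lemma tensor_op_concentrated : concentrated t X.
Proof.
move=> i it x; elim/ct_ind: x => [//|c a b x y u ->].
rewrite addr0 [ct_ten _ _ _](_ : _ = 0) ?scaler0 //.
have [am|am] := eqVneq a m; last first.
  by rewrite (stalk_concentrated am x) ct_ten_0l.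
have [bm|bm] := eqVneq b m; last first.
  by rewrite (stalk_concentrated bm y) ct_ten_0r.
by subst a b; apply: ct_ten0 => e; move: it; rewrite e eqxx.
Qed.

Lemma stalk_topP (a : M) : stalk_pred m m a.
Proof. by rewrite /stalk_pred eqxx. Qed.
Definition relem (a : A) : R m := StalkObj (stalk_topP (a : M)).

Lemma twist_act (a : A) (b : A^c) (r : A) :
  (a \ox b) *: (r : M) = mu a * (r * (b : A)) :> A.
Proof.
rewrite -[LHS]/(tmap mu (idfun : {lrmorphism A^c -> A^c}) (a \ox b) *: (r : regbim A)).
by rewrite tmapE bimod_scaleE.
Qed.

Lemma relem0 : relem 0 = 0.
Proof. exact: val_inj. Qed.

Lemma relem_act (a : A) (b : A^c) (r : A) :
  (a \ox b) *: relem r = relem (mu a * r * (b : A)).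
Proof. by apply: val_inj; rewrite /= twist_act mulrA. Qed.

Lemma relemP c (r r' : A) : relem (c *: r + r') = (c%:A : Ae) *: relem r + relem r'.
Proof.
rewrite -[c%:A]atenZl relem_act mulr1; apply: val_inj => /=.
by rewrite linearZ_LR rmorph1 mulr_algl.
Qed.

Lemma ten_bilin :
  bilin (fun r s => ct_ten t (relem r) (relem s) : ct_obj R R t).
Proof.
by split=> [s c r r'|r c s s']; rewrite relemP ?ct_tenPl ?ct_tenPr.
Qed.

(** The only nonzero degree t = 2m of R (x) R^op is A (x) A as a vector space; [ten] and [unten] are
    the identification. *)
Definition ten : tensor A A -> T :=
  tlift (fun r s => ct_ten t (relem r) (relem s) : ct_obj R R t).

Lemma tenE r s : ten (tens r s) = ct_ten t (relem r) (relem s).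
Proof. exact: (tliftE ten_bilin r s). Qed.

Lemma ten_lin : linear (ten : _ -> ct_obj R R t).
Proof. exact: tlift_linear ten_bilin. Qed.

Lemma tenD x y : ten (x + y) = ten x + ten y.
Proof. exact: (linearDf ten_lin). Qed.

Lemma unten_multi : ct_multi t (fun i j (x : R i) (y : R j) =>
  tens (stalk_val x : A) (stalk_val y : A)).
Proof.
have act c (r : A) : (c%:A : Ae) *: (r : M) = c *: r :> A.
  by rewrite -[c%:A]atenZl twist_act linearZ_LR rmorph1 mulr1 mulr_algl.
split=> [i j c x x' y|i j c x y y'|i j x y ij] /=.
- by rewrite act tensDl tensZl.
- by rewrite act tensDr tensZr.
have [im|im] := eqVneq i m; last first.
  by rewrite (stalk_concentrated im x) (linear0f ((tens_bilin _ _).1 _)).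
have [jm|jm] := eqVneq j m; last first.
  by rewrite (stalk_concentrated jm y) (linear0f ((tens_bilin _ _).2 _)).
by case: ij; rewrite im jm.
Qed.

Definition unten : T -> tensor A A :=
  ct_lift (fun i j (x : R i) (y : R j) => tens (stalk_val x : A) (stalk_val y : A)).

Lemma unten_lin : linear (unten : ct_obj R R t -> _).
Proof. exact: ct_lift_linear unten_multi. Qed.

Lemma tenK : cancel ten unten.
Proof.
apply: tens_ext => [c x y|//|r s]; first by rewrite ten_lin unten_lin.
by rewrite tenE [LHS](ct_liftE unten_multi).
Qed.

Lemma untenK : cancel unten ten.
Proof.
move=> x; elim/ct_ind: x => [|c i j x y u IH].
  by rewrite (linear0f unten_lin) (linear0f ten_lin).
rewrite unten_lin ten_lin IH; apply: (congr1 (fun v : ct_obj R R t => c *: v + u)).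
rewrite [unten _](ct_liftE unten_multi) tenE.
have [im|im] := eqVneq i m; last first.
  rewrite (stalk_concentrated im x) ct_ten_0l.
  by have -> : relem (stalk_val (0 : R i)) = 0 := relem0; rewrite ct_ten_0l.
have [jm|jm] := eqVneq j m; last first.
  rewrite (stalk_concentrated jm y) ct_ten_0r.
  by have -> : relem (stalk_val (0 : R j)) = 0 := relem0; rewrite ct_ten_0r.
by subst i j; congr ct_ten; exact: val_inj.
Qed.

(** The first copy of A^e acts on the outer sides of r (x) s, the second on the inner sides. *)
Lemma ten_act_tens (a : A) (b : A^c) (b' : A) (a' : A^c) r s :
  ((a \ox b) \ox (b' \ox a')) *: ten (tens r s)
  = ten (tens (mu a * r * (a' : A)) (mu b' * s * (b : A))).
Proof.
rewrite !tenE -[LHS]/(tinterchange A A^c A A^c ((a \ox b) \ox (b' \ox a')) *: 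
  (ct_ten t (relem r) (relem s) : ct_mod R R t)).
by rewrite tinterchangeE ct_scaleE !relem_act.
Qed.

Lemma ten_act (a : A) (b : A^c) (b' : A) (a' : A^c) x :
  ((a \ox b) \ox (b' \ox a')) *: ten x
  = ten (biact_tens (fun r => mu a * r * (a' : A)) (fun s => mu b' * s * (b : A)) x).
Proof.
have l u v : linear (fun r : A => u * r * v).
  by move=> c y z; rewrite mulrDr mulrDl -scalerAr -scalerAl.
have lb := biact_tens_linear (l (mu a) (a' : A)) (l (mu b') (b : A)).
elim/tensor_ind: x => [|c r s x IH].
  by rewrite (linear0f lb) (linear0f ten_lin) scaler0.
rewrite -tensZl (linearDf lb) !tenD scalerDr IH ten_act_tens.
by rewrite biact_tensE.
Qed.

Lemma ten_linear : linear (ten : _ -> restr (in_alg L) T).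
Proof.
move=> c x y; rewrite tenD; congr (_ + _); rewrite restr_in_algE.
have -> : c%:A = ((c%:A : A) \ox (1 : A^c)) \ox (1 \ox (1 : A^c)) :> L.
  by rewrite [X in X \ox _]atenZl [RHS]atenZl !aten1.
rewrite ten_act; congr ten; move: x; apply: tens_ext => [e x z|e x z|r s].
- by rewrite scalerDr !scalerA mulrC.
- by apply: biact_tens_linear => u v w; rewrite mulrDr mulrDl -scalerAr -scalerAl.
rewrite biact_tensE; last by move=> u v w; rewrite mulrDr mulrDl -scalerAr -scalerAl.
  rewrite rmorph1 mul1r !mulr1 -tensZl; congr tens.
  by rewrite linearZ_LR rmorph1 mulr_algl.
by move=> u v w; rewrite mulrDr mulrDl -scalerAr -scalerAl.
Qed.

Definition adj_ten (x : tensor A A) : T := ten (adj H mu x).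
Definition adj_unten (x : T) : tensor A A := adj_inv H mu' (unten x).

Lemma adj_tenD x y : adj_ten (x + y) = adj_ten x + adj_ten y.
Proof. by rewrite /adj_ten (linearDf (adj_linear _ _)) tenD. Qed.
Lemma adj_tenK : cancel adj_ten adj_unten.
Proof. by move=> x; rewrite /adj_ten /adj_unten tenK adjK. Qed.
Lemma adj_untenK : cancel adj_unten adj_ten.
Proof. by move=> x; rewrite /adj_ten /adj_unten adj_invK // untenK. Qed.

(** Through [adj] the outer action along [delta] becomes left multiplication on the first factor, so
    T is free over A. *)
Lemma adj_ten_compatible a :
  compatible adj_ten ( *%R a) ( *:%R (env_hom H Ae a : L)).
Proof.
split=> [x y|x y]; first exact: scalerDr.
rewrite /adj_ten adj_mull (sw_comp _ _ _ ten_linear).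
rewrite /env_hom deltaE.
have lw (w : T) : linear (fun u : Ae => (u \ox (1 : Ae)) *: w : restr (in_alg L) T).
  exact: kscale_linear.
rewrite [LHS](sw_comp _ _ _ (lw _)). apply: (@eq_sw _ _ H (restr (in_alg L) T)) => a1 a2.
apply: etrans (ten_act a1 (antipode_conv H a2) 1 1 _) _; congr ten.
by congr biact_tens; apply: funext => u; rewrite ?mulr1 // rmorph1 mul1r.
Qed.

End TwistedTensor.

(** * Cohomology of columns over a free module *)

Section ColumnCohomology.
Variables (k : fieldType) (A : algType k) (V : lmodType k).
Variables (L : pzRingType) (h : {rmorphism A -> L}) (T : lmodType L).
Variables (Phi : tensor A V -> T) (Psi : T -> tensor A V).
Hypothesis PhiD : forall x y, Phi (x + y) = Phi x + Phi y.
Hypotheses (PhiK : cancel Phi Psi) (PsiK : cancel Psi Phi).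
Hypothesis PhiA : forall a, compatible Phi ( *%R a) ( *:%R (h a)).
Variables (r : nat -> nat) (D : forall p, 'M[A]_(rk r p.+1, rk r p)).

Definition scalar_mx p : 'M[L]_(rk r p.+1, rk r p) := map_mx h (D p).

(** In degree 0 the incoming matrix has no columns, so coboundaries are an image in every degree. *)
Definition prev_dim (n : nat) : nat := if n is m.+1 then rk r m else 0%N.
Definition prev_mx (n : nat) : 'M[A]_(rk r n, prev_dim n) :=
  match n with 0%N => 0 | m.+1 => D m end.

Lemma prev_col_cob n (u : {ffun 'I_(rk r n) -> A}) :
  col_cob D u <-> exists w, u = cmul (prev_mx n) w.
Proof.
case: n u => [|n] u //=; split=> [->|[w ->]].
  by exists 0; apply/ffunP=> i; rewrite !ffunE big_ord0.
by apply/ffunP=> i; rewrite !ffunE big_ord0.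
Qed.

Lemma mact_map m n (M : 'M[A]_(m, n)) (u : {ffun 'I_n -> T}) :
  mact (map_mx h M) u = opm (fun i j => *:%R (h (M i j))) u.
Proof.
by apply/ffunP=> i; rewrite !ffunE; apply: eq_bigr => j _; rewrite mxE.
Qed.

Lemma prev_col_cobound n (y : {ffun 'I_(rk r n) -> T}) :
  col_cobound scalar_mx y
  <-> exists w, y = opm (fun i j => *:%R (h (prev_mx n i j))) w.
Proof.
case: n y => [|n] y /=; last first.
  by split=> [[w ->]|[w ->]]; exists w; rewrite mact_map.
split=> [->|[w ->]].
  by exists 0; apply/ffunP=> i; rewrite !ffunE big_ord0.
by apply/ffunP=> i; rewrite !ffunE big_ord0.
Qed.

Let lin (a : A) : linear ( *%R a).
Proof. by move=> c x y; rewrite mulrDr scalerAr. Qed.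

(** This is [opm_exact] for the class z; with z = 0 it becomes acyclicity. *)
Lemma col_cobound_rep n (z : {ffun 'I_(rk r n) -> A}) :
  (forall u, cmul (D n) u = 0 -> exists c : k, col_cob D (u - c *: z)) ->
  forall y : {ffun 'I_(rk r n) -> T}, mact (scalar_mx n) y = 0 ->
  exists v, col_cobound scalar_mx (y - colten Phi (tens z v)).
Proof.
move=> ex y; rewrite mact_map => Dy.
have [u /ex [c /prev_col_cob [w uE]]|v [w yE]] := opm_exact PhiD PhiK PsiK
  (fun i j => lin (D n i j)) (fun i j => lin (prev_mx n i j))
  (fun i j => PhiA (D n i j)) (fun i j => PhiA (prev_mx n i j)) (z := z) _ Dy.
  by exists c, w; rewrite -[opm _ w]uE addrC subrK.
by exists v; apply/prev_col_cobound; exists w; rewrite yE addrC addKr.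
Qed.

Lemma col_cobound_inj n (z : {ffun 'I_(rk r n) -> A}) v :
  ~ col_cob D z -> col_cobound scalar_mx (colten Phi (tens z v)) -> v = 0.
Proof.
move=> nz /prev_col_cobound [w wE].
apply: (opm_cokernel PhiD PhiK PsiK (fun i j => lin (prev_mx n i j))
  (fun i j => PhiA (prev_mx n i j)) (z := z) _ wE) => x xE.
by apply: nz; apply/prev_col_cob; exists x.
Qed.

Lemma colten_cocycle n (z : {ffun 'I_(rk r n) -> A}) v :
  cmul (D n) z = 0 -> mact (scalar_mx n) (colten Phi (tens z v)) = 0.
Proof.
move=> Dz; rewrite mact_map.
rewrite -(colten_opm PhiD _ (fun i j => lin (D n i j)) (fun i j => PhiA (D n i j))).
rewrite tmaplE; last by apply: opm_linear.
by rewrite [opm _ z]Dz (linear0f ((tens_bilin _ _).1 v)) (colten0 PhiD).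
Qed.

Lemma colten_sw (H : hopf A) n (z : {ffun 'I_(rk r n) -> A})
    (chi : A -> k) (g : A -> V) a :
  (forall b, col_cob D ([ffun l => z l * b] - chi b *: z)) ->
  col_cobound scalar_mx
   (colten Phi (sw H a (fun a1 a2 => tens [ffun l => z l * a1] (g a2)))
    - colten Phi (tens z (sw H a (fun a1 a2 => chi a1 *: g a2)))).
Proof.
move=> zb; have ex b : exists w, [ffun l => z l * b] - chi b *: z = cmul (prev_mx n) w.
  exact/prev_col_cob.
(* The function w is chosen without linearity; [sw] sums over one fixed expression of the coproduct,
   so this does no harm. *)
have [w wE] := choice ex.
have lF := opm_linear (fun i j => lin (prev_mx n i j)).
set x := sw _ _ _; set y := tens _ _.
have -> : x = tmapl (opm (fun i j => *%R (prev_mx n i j)))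
    (sw H a (fun a1 a2 => tens (w a1) (g a2))) + y.
  rewrite /y (sw_comp _ _ _ ((tens_bilin _ _).2 z)).
  rewrite (sw_comp _ _ _ (tmapl_linear lF)) /x !swE -big_split /=.
  apply: eq_bigr => i _; rewrite -scalerDr /=; congr (_ *: _).
  by rewrite tmaplE // -[opm _ _]wE tensZr -tensZl -tensDl subrK.
rewrite (coltenD PhiD) addrK; apply/prev_col_cobound; eexists.
exact: (colten_opm PhiD _ (fun i j => lin (prev_mx n i j)) (fun i j => PhiA (prev_mx n i j))).
Qed.

End ColumnCohomology.

(** * The Ext bimodule *)

Lemma qiso_exact_off (L : pzRingType) (t i : int) (X I : complex L) (f : cmap X I) :
  concentrated t X -> qiso f -> i != t -> acyclic_at I i.
Proof.
move=> Xt qf it x /(qf i).2 [y [_]].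
by rewrite (Xt i it y) linear0 subr0.
Qed.

Lemma pred_index_ex (L : pzRingType) (I : complex L) (i j : int) (x : I i)
    (P : forall l, I l -> Prop) : i = j + 1 ->
  (exists w : I (i - 1), P _ w /\ cdiff I _ i w = x) <->
  (exists w : I j, P _ w /\ cdiff I _ i w = x).
Proof. by move=> ij; have -> : i - 1 = j by rewrite ij addrK. Qed.

(** * Passing between an injective resolution and columns *)

Section Transfer.
Variables (L : pzRingType) (r : nat -> nat).
Variable D : forall p, 'M[L]_(rk r p.+1, rk r p).
Hypothesis rowex : forall J : nat -> lmodType L,
  (forall q, injective_module (J q)) -> row_exact J D.

(* The elements of N killed by the first matrix are the homomorphisms into N *)
(* from the module that [D] resolves.                                        *)
Definition killed (N : lmodType L) (w : N) : Prop := mact (D 0) [ffun=> w] = 0.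

Definition killed_cobound (I : complex L) i (x : I i) : Prop :=
  exists w : I (i - 1), killed w /\ cdiff I _ i w = x.

(** The staircase relation seen from outside: it matches the cohomology of the killed elements of I
    in degree i with that of columns over T in degree n, linearly over scalars commuting with the
    matrices. *)
Record transfer (I : complex L) (T : lmodType L) i n
    (Z : I i -> {ffun 'I_(rk r n) -> T} -> Prop) : Prop := Transfer {
  tr_linear : forall c x y x' y', (forall p i j, c * D p i j = D p i j * c) ->
    Z x y -> Z x' y' -> Z (c *: x + x') (c *: y + y');
  tr_to : forall x, killed x -> cocycle x -> exists y, mact (D n) y = 0 /\ Z x y;
  tr_from : forall y, mact (D n) y = 0 -> exists x, [/\ killed x, cocycle x & Z x y];
  tr_cobound : forall x y, Z x y -> killed_cobound x <-> col_cobound D y }.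

Lemma ffun1 (N : Type) (u : {ffun 'I_1 -> N}) : u = [ffun=> u ord0].
Proof. by apply/ffunP=> i; rewrite ord1 ffunE. Qed.

Variables (X I : complex L) (f : cmap X I) (t : int).
Hypotheses (Xt : concentrated t X) (fI : inj_resolution f).

(** Counting from a degree a up to which I vanishes makes degrees natural numbers. The minimum
    places a below t, and s is the number of degrees strictly between. *)
Lemma resolution_base : exists (a : int) (s : nat),
  t = a + s.+1%:Z /\ forall i, i <= a -> forall x : I i, x = 0.
Proof.
have [_ _ [b Ib]] := fI; pose a := Num.min (b - 1) (t - 1).
have ab : a < b.
  by apply: (@le_lt_trans _ _ (b - 1)); rewrite ?ge_min ?lexx // ltrBlDr ltrDl.
have at1 : a <= t - 1 by rewrite ge_min lexx orbT.
exists a, (absz (t - 1 - a)%R); split; last first.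
  by move=> i ia; apply: Ib; apply: le_lt_trans ab.
by rewrite -addn1 PoszD gez0_abs ?subr_ge0 // addrA subrKC subrK.
Qed.

Section Base.
Variables (a : int) (s : nat).
Hypothesis ts : t = a + s.+1%:Z.
Hypothesis Ia : forall i, i <= a -> forall x : I i, x = 0.
Let J (q : nat) := I (a + q%:Z).
Let d q : {linear J q -> J q.+1} := cdiff I (a + q%:Z) (a + q.+1%:Z).

Lemma base_succ q : a + q.+1%:Z = a + q%:Z + 1.
Proof. by rewrite -addrA -PoszD addn1. Qed.

Lemma base_rowex : row_exact J D.
Proof. by have [_ inj _] := fI; apply: rowex => q; exact: inj. Qed.

Lemma base_zero (x : J 0) : x = 0.
Proof.
by apply: Ia; rewrite addr0.
Qed.

Lemma base_dd q (x : J q) : d q.+1 (d q x) = 0.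
Proof. exact: cdiffK. Qed.

Lemma base_cocycle q (x : J q) : d q x = 0 <-> cocycle x.
Proof.
by split=> [/cocycleP|cx]; [apply; exact: base_succ | exact: cocycleE].
Qed.

Lemma base_exact q : q != s -> forall x : J q.+1, d q.+1 x = 0 ->
  exists y, x = d q y.
Proof.
move=> qs x /base_cocycle cx; have [qf _ _] := fI.
have := qiso_exact_off Xt qf _ cx; rewrite ts => H.
have [|y yx] := coboundaryE (base_succ q) (H _); last by exists y.
by apply: contraNneq qs => /addrI [] ->.
Qed.

Let T := X (a + s.+1%:Z).
Let iota : {linear T -> J s.+1} := f (a + s.+1%:Z).

Lemma base_Xzero i : i != a + s.+1%:Z -> forall x : X i, x = 0.
Proof. by move=> it; apply: Xt; rewrite ts. Qed.

Lemma base_iota (x : T) : d s.+1 (iota x) = 0.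
Proof.
rewrite /d /iota -cmapC [cdiff X _ _ x]base_Xzero ?linear0 //.
by rewrite base_succ -subr_eq0 addrAC subrr add0r.
Qed.

Lemma base_exact_s (x : J s.+1) : d s.+1 x = 0 ->
  exists u y, x = iota u + d s y.
Proof.
move=> /base_cocycle /(let: And3 qf _ _ := fI in qf _).2 [u [_]].
case/(coboundaryE (base_succ s)) => y yE; exists u, y.
by rewrite /d yE addrC subrK.
Qed.

Lemma base_iota_inj (u : T) y : iota u = d s y -> u = 0.
Proof.
move=> uy; have [qf _ _] := fI.
have cu : cocycle u.
  apply: base_Xzero; by rewrite -subr_eq0 addrAC subrr add0r.
have bu : coboundary (f _ u) by apply: (coboundaryP (y := y)); rewrite -uy.
have [v <-] := (qf _).1 u cu bu.
rewrite (base_Xzero (i := a + s.+1%:Z - 1) _ v) ?linear0 //.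
by rewrite -subr_eq0 addrAC subrr.
Qed.

Let zz n := @zigzag L J d s T iota n (rk r) D.

(** [rk r 0] is 1, so a column at the start of the staircase is a single element of I. *)
Lemma base_transfer n : exists Z, @transfer I T (a + (n + s).+1%:Z) n Z.
Proof.
pose Z (x : J (n + s).+1) (y : {ffun 'I_(rk r n) -> T}) := zz [ffun=> x] y.
exists Z; split.
- move=> c x y x' y' cD Zx Zx'; rewrite /Z.
  rewrite (_ : [ffun=> _] = c *: [ffun=> x] + [ffun=> x']).
    exact: zigzag_linear.
  by apply/ffunP=> i; rewrite !ffunE.
- move=> x kx /base_cocycle cx.
  apply: (zigzag_hom_col base_zero base_dd base_exact base_exact_s base_iota_inj base_rowex) => //.
  by apply/ffunP=> i; rewrite !ffunE.
- move=> y Dy.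
  have [x [kx cx Zx]] := zigzag_col_hom base_dd base_iota base_rowex Dy.
  exists (x ord0); split; [by rewrite /killed -ffun1| |by rewrite /Z -ffun1].
  by apply/base_cocycle; have /ffunP/(_ ord0) := cx; rewrite !ffunE.
move=> x y Zxy; rewrite /killed_cobound.
rewrite (pred_index_ex _ (fun l => @killed (I l)) (base_succ (n + s))).
rewrite -(zigzag_cobound base_dd base_iota base_exact base_exact_s base_iota_inj base_rowex Zxy).
split=> [[w [kw wx]]|[w [kw wx]]].
  by exists [ffun=> w]; split=> //; apply/ffunP=> i; rewrite !ffunE.
exists (w ord0); split; first by rewrite /killed -ffun1.
by have /ffunP/(_ ord0) := wx; rewrite !ffunE.
Qed.

Lemma base_below i (x : I i) : i < a + s.+1%:Z -> killed x -> cocycle x ->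
  killed_cobound x.
Proof.
move=> it kx cx; rewrite /killed_cobound.
have [ia|ai] := leP i a.
  exists 0; rewrite linear0 (Ia ia x); split=> //; rewrite /killed.
  by apply/ffunP=> j; rewrite !ffunE big1 // => l _; rewrite ffunE scaler0.
have [q iE] : exists q : nat, i = a + q.+1%:Z.
  exists (absz (i - a - 1)%R); rewrite -addn1 PoszD gez0_abs ?subrK ?subrKC // subr_ge0.
  by rewrite lerBrDl lezD1.
subst i; rewrite (pred_index_ex _ (fun l => @killed (I l)) (base_succ q)).
have qs : (q < s)%N by move: it; rewrite ltrD2l.
case: (below_exact base_zero base_dd base_exact qs base_rowex (x := [ffun=> x])).
- exact: kx.
- by apply/ffunP=> j; rewrite !ffunE; apply/base_cocycle.
move=> w [kw wx]; exists (w ord0); split; first by rewrite /killed -ffun1.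
by have /ffunP/(_ ord0) := wx; rewrite !ffunE.
Qed.

End Base.

Lemma transfer_exists (n : nat) i : i = t + n%:Z ->
  exists Z, @transfer I (X t) i n Z.
Proof.
have [a [s [ts Ia]]] := resolution_base; move=> ->; rewrite ts.
have -> : a + s.+1%:Z + n%:Z = a + (n + s).+1%:Z.
  by rewrite -addrA -PoszD addSn addnC.
exact: base_transfer.
Qed.

Lemma below_cobound i (x : I i) : i < t -> killed x -> cocycle x ->
  killed_cobound x.
Proof.
have [a [s [ts Ia]]] := resolution_base; rewrite {1}ts.
exact: base_below.
Qed.

End Transfer.

Lemma col_cobound0 (L : pzRingType) (T : lmodType L) (r : nat -> nat)
    (D : forall p, 'M[L]_(r p.+1, r p)) n :
  col_cobound D (0 : {ffun 'I_(r n) -> T}).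
Proof. by case: n => [|n] //=; exists 0; rewrite raddf0. Qed.

Section ExtBimodule.
Variables (k : fieldType) (A : algType k) (H : hopf A) (d : nat).
Local Notation Ae := (talg A A^c).
Local Notation L := (talg Ae Ae).
Local Notation S := (antipode H).
Local Notation eps := (counit H).
Variables (r : nat -> nat) (D : forall p, 'M[A]_(rk r p.+1, rk r p)).
Hypothesis rD : free_resolution (fun a => eps a = 0) D.
Variable z : {ffun 'I_(rk r d) -> A}.
Hypothesis col_ex : forall n u, n != d -> cmul (D n) u = 0 -> @col_cob _ _ _ D n u.
Hypothesis z_cocycle : cmul (D d) z = 0.
Hypothesis z_nontriv : ~ col_cob D z.
Hypothesis z_gen : forall u, cmul (D d) u = 0 -> exists c : k, col_cob D (u - c *: z).
Variable chi : {lrmorphism A -> k^o}.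
Hypothesis z_chi : forall b, col_cob D ([ffun l => z l * b] - (chi b : k) *: z).

Variables (mu : {lrmorphism A -> A}) (mu' : A -> A).
Hypotheses (muK : cancel mu mu') (mu'K : cancel mu' mu).
Local Notation m := (- d%:Z).
Local Notation X := (tensor_op (stalk m (twist mu (regbim A)))).
Local Notation t := (m + m).
Local Notation Phi := (@adj_ten k A H mu m).
Local Notation Dl := (env_mx H Ae D).
Variables (I : complex L) (f : cmap X I).
Hypothesis fI : inj_resolution f.
Local Notation Hc := (hom_complex (E := Ae) (F := Ae) (stalk 0 (regbim A)) I).

Lemma rho_valP : stalk_pred 0 0 (1 : regbim A).
Proof. by []. Qed.
Definition rho : stalk 0 (regbim A) 0 := StalkObj rho_valP.

Lemma rho_gen (x : stalk 0 (regbim A) 0) : exists e, x = e *: rho.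
Proof.
exists ((stalk_val x : A) \ox (1 : A^c)); apply: val_inj.
by rewrite /= env_act1 mulr1.
Qed.
Local Notation conc0 := (@stalk_concentrated Ae 0 (regbim A)).

Definition ev (n : int) (x : Hc n) : I (0 + n) := (x : cochain _ _ n) 0 (0 + n) rho.

Lemma annihilated_killed n (w : I (0 + n)) : annihilated rho w <-> killed Dl w.
Proof.
rewrite /killed -(annihilatedP rD (w : I (0 + n))).
by split=> ann e e1; apply: ann; [exact: val_inj | rewrite -[LHS]/(\val (e *: rho)) e1].
Qed.

Lemma ev_killed n (x : Hc n) : killed Dl (ev x).
Proof. by apply/annihilated_killed; exact: cyc_annihilated. Qed.

Lemma ev_surj n (w : I (0 + n)) : killed Dl w -> exists x : Hc n, ev x = w.
Proof.
by move=> /annihilated_killed /(cyc_mk rho_gen)[x xw]; exists x.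
Qed.

Lemma ev_cocycle n (x : Hc n) : cocycle x <-> cocycle (ev x).
Proof. exact: (cyc_cocycle conc0 rho_gen). Qed.

Lemma ev_coboundary n (x : Hc n) : coboundary x <-> killed_cobound Dl (ev x).
Proof.
rewrite (cyc_coboundary conc0 rho_gen) /killed_cobound.
rewrite (pred_index_ex (j := 0 + (n - 1)) _ (fun l => @killed _ _ Dl (I l))); last first.
  by rewrite -addrA subrK.
split=> [[w /annihilated_killed kw wx]|[w [/annihilated_killed kw wx]]]; by exists w.
Qed.

Lemma ev_linear n (c : Ae) (x y : Hc n) : ev (c *: x + y) = (1 \ox c) *: ev x + ev y.
Proof. by []. Qed.

(** The matrices involve only the first copy of A^e; hence the transfer is linear over the second,
    which gives the bimodule structure. *)
Lemma env_comm (c : Ae) p i j : (1 \ox c) * Dl p i j = Dl p i j * (1 \ox c) :> L.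
Proof. by rewrite mxE /env_hom !atenM !mul1r !mulr1. Qed.

Lemma shift_degree : m = t + d%:Z.
Proof. by rewrite subrK. Qed.

Lemma T_conc : concentrated t X. Proof. exact: tensor_op_concentrated. Qed.
Lemma L_rowex : forall J : nat -> lmodType L,
  (forall q, injective_module (J q)) -> row_exact J Dl.
Proof. by move=> J; exact: env_mx_exact. Qed.

Local Notation PhiD := (@adj_tenD k A H mu m).
Local Notation PhiK := (@adj_tenK k A H mu mu' muK mu'K m).
Local Notation PsiK := (@adj_untenK k A H mu mu' muK mu'K m).
Local Notation PhiA := (@adj_ten_compatible k A H mu m).

(** Below degree t, [below_cobound] applies. In degree t + p with p different from d the columns
    over A are exact, which is the case z = 0 of [col_cobound_rep]. *)
Lemma ext_acyclic n : n != m -> acyclic_at Hc n.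
Proof.
move=> nm x cx; apply/ev_coboundary; have kx := ev_killed x.
have cex : cocycle (ev x) by apply/ev_cocycle.
have [lt_nt|le_tn] := ltP (0 + n) t; first exact: (below_cobound L_rowex T_conc fI).
have [p pE] : exists p : nat, 0 + n = t + p%:Z.
  by exists (absz (0 + n - t)%R); rewrite gez0_abs ?subr_ge0 // subrKC.
have [Z ZP] := transfer_exists L_rowex T_conc fI pE.
have [y [Dy Zy]] := tr_to ZP kx cex.
apply/(tr_cobound ZP Zy).
have pd : p != d.
  by apply: contraNneq nm => pd; rewrite -[n]add0r pE pd -shift_degree.
have [u Du|v] := col_cobound_rep PhiD PhiK PsiK PhiA (z := 0) _ Dy.
  by exists 0; rewrite scaler0 subr0; exact: col_ex.
by rewrite (linear0f ((tens_bilin _ _).1 v)) (colten0 PhiD) subr0.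
Qed.

Lemma Z_exists : exists Z, transfer Dl (T := X t) (I := I) (i := 0 + m) (n := d) Z.
Proof. apply: (transfer_exists L_rowex T_conc fI); rewrite add0r; exact: shift_degree. Qed.

Let Z := sval (cid Z_exists).
Let ZP : transfer Dl Z := svalP (cid Z_exists).

Definition col (y : A) : {ffun 'I_(rk r d) -> X t} := colten Phi (tens z y).

Lemma class_exists y : exists x : Hc m, cocycle x /\ Z (ev x) (col y).
Proof.
have Dcol : mact (Dl d) (col y) = 0 by exact: (colten_cocycle PhiD PhiA).
have [w [kw cw Zw]] := tr_from ZP Dcol; have [x xw] := ev_surj kw.
by exists x; rewrite ev_cocycle xw.
Qed.

Definition ext_class y : Hc m := sval (cid (class_exists y)).
Lemma ext_class_cocycle y : cocycle (ext_class y).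
Proof. exact: (svalP (cid (class_exists y))).1. Qed.
Lemma ext_classZ y : Z (ev (ext_class y)) (col y).
Proof. exact: (svalP (cid (class_exists y))).2. Qed.

Lemma act_N1 (V : lmodType L) (v : V) : (1 \ox (-1 : Ae)) *: v = - v.
Proof. by rewrite -[_ \ox _]/(tinr Ae Ae (-1)) rmorphN1 scaleN1r. Qed.

(** The difference is formed with the scalar 1 (x) (-1), to which [env_comm] and hence [tr_linear]
    apply. *)
Lemma Z_eq (x x' : Hc m) u u' : Z (ev x) u -> Z (ev x') u' ->
  col_cobound Dl (u - u') -> coboundary (x - x').
Proof.
move=> Zu Zu' cu; apply/ev_coboundary.
have ZZ := tr_linear ZP (c := 1 \ox (-1)) (env_comm _) Zu' Zu.
have -> : ev (x - x') = (1 \ox (-1)) *: ev x' + ev x by rewrite act_N1 [RHS]addrC.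
by apply/(tr_cobound ZP ZZ); rewrite act_N1 [- u' + u]addrC.
Qed.

Lemma ext_classD y y' : coboundary (ext_class (y + y') - (ext_class y + ext_class y')).
Proof.
apply: (Z_eq (ext_classZ _) (u' := col y + col y')); last first.
  by rewrite /col tensDr (coltenD PhiD) subrr; exact: col_cobound0.
have := tr_linear ZP (c := 1 \ox 1) (env_comm _) (ext_classZ y) (ext_classZ y').
by rewrite aten1 !scale1r.
Qed.

Lemma ext_class_inj y : coboundary (ext_class y) -> y = 0.
Proof.
move=> /ev_coboundary /(tr_cobound ZP (ext_classZ y)).
exact: (col_cobound_inj PhiD PhiK PsiK PhiA z_nontriv).
Qed.

Lemma ext_class_surj x : cocycle x -> exists y, coboundary (x - ext_class y).
Proof.
move=> /ev_cocycle cx; have [u [Du Zu]] := tr_to ZP (ev_killed x) cx.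
have [v cv] := col_cobound_rep PhiD PhiK PsiK PhiA z_gen Du.
by exists v; exact: (Z_eq Zu (ext_classZ v)).
Qed.

(** Put a' = mu^-1(a). By [adj_mulr] the inner right action of a on z (x) y is right multiplication
    by a'_1 on z and by S^2(a'_2) on y. By [colten_sw] the former becomes the scalar chi(a'_1), and
    the sum of chi(a'_1) S^2(a'_2) is nu(a'). *)
Lemma col_act (b : A) (a : A^c) y : col_cobound Dl
  ((1 \ox (b \ox a)) *: col y - col (mu b * y * nakayama_aut H chi (mu' a))).
Proof.
have := colten_sw PhiD PhiA H (fun a2 => mu b * y * S (S a2)) (mu' a) z_chi.
have -> : sw H (mu' a) (fun a1 a2 => (chi a1 : k) *: (mu b * y * S (S a2)))
    = mu b * y * nakayama_aut H chi (mu' a).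
  have lm : linear (fun u : A => mu b * y * S (S u)) by move=> c u v; mlin.
  rewrite -[RHS]/(mu b * y * S (S (left_winding H chi (mu' a)))) windingE.
  by rewrite (sw_comp _ _ _ lm); apply: eq_sw => x x'; rewrite (linearZf _ _ lm).
set rhs := colten _ (sw _ _ _).
(* What remains is an exact equality of columns; coboundaries enter only through [colten_sw]. *)
suff -> : (1 \ox (b \ox a)) *: col y = rhs by [].
apply/esym/ffunP=> i; rewrite [RHS]ffunE [rhs i]ffunE [col y i]ffunE.
rewrite (sw_comp _ _ _ (tmapl_linear (@proj_linear _ _ _ i))).
transitivity (Phi (sw H (mu' a) (fun a1 a2 =>
    tens (z i * a1) (mu b * y * S (S a2))))).
  congr Phi; apply: eq_sw => a1 a2.
  by rewrite (tmaplE _ _ (@proj_linear _ _ _ i)) ffunE.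
rewrite (tmaplE _ _ (@proj_linear _ _ _ i)) /adj_ten.
rewrite (sw_comp _ _ _ (adj_linear H mu)) adj_mulr mu'K adj_right_factor.
rewrite -[X in X \ox _]aten1 ten_act; congr ten.
rewrite rmorph1; move: (adj H mu _) => w.
have lr : linear (fun u : A => 1 * u * (a : A)).
  by move=> c u v; rewrite !mul1r mulrDl -scalerAl.
have ll : linear (fun u : A => mu b * u * 1).
  by move=> c u v; rewrite !mulr1 mulrDr -scalerAr.
have l1 := biact_tens_linear (@id_linear k A) (mull_linear (mu b)).
have l2 := biact_tens_linear (mulr_linear (a : A)) (@id_linear k A).
elim/tensor_ind: w => [|c u v w IH].
  by rewrite (linear0f l1) (linear0f l2) (linear0f (biact_tens_linear lr ll)).
rewrite l1 l2 (biact_tens_linear lr ll) IH; congr (_ *: _ + _).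
rewrite !biact_tensE ?mul1r ?mulr1 //; [exact: mulr_linear | exact: mull_linear].
Qed.

Lemma ext_class_act (b : A) (a : A^c) y : coboundary
  ((b \ox a) *: ext_class y - ext_class (mu b * y * nakayama_aut H chi (mu' a))).
Proof.
apply: (Z_eq _ (ext_classZ _) (col_act b a y)).
have Z0 : Z (ev (0 : Hc m)) 0.
  have := tr_linear ZP (c := 1 \ox (-1)) (env_comm _) (ext_classZ 0) (ext_classZ 0).
  by rewrite !act_N1 !addNr.
rewrite -[_ *: ext_class y]addr0 -[_ *: col y]addr0 ev_linear.
exact: (tr_linear ZP (c := 1 \ox (b \ox a)) (env_comm _) (ext_classZ y) Z0).
Qed.

End ExtBimodule.

(** * Dualising complexes *)

Section InjectiveTransport.
Variables (E F : pzRingType) (sig : {rmorphism E -> F}) (sig' : {rmorphism F -> E}).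
Hypotheses (sigK : cancel sig sig') (sig'K : cancel sig' sig).

(** The extension problem is moved over F by restricting along the inverse of sig, solved there and
    moved back. *)
Lemma restr_injective (I : lmodType F) :
  injective_module I -> injective_module (restr sig I).
Proof.
move=> injI M N f g f_inj.
pose g1 (x : restr sig' M) : I := g x.
have lg : linear g1.
  move=> a x y; rewrite /g1 -[g _]/(g (sig' a *: (x : M) + y)) linearP.
  by rewrite -[sig' a *: g x]/(sig (sig' a) *: (g x : I)) sig'K.
have Hg := GRing.isLinear.Build F (restr sig' M) I _ g1 lg.
pose g1' : {linear restr sig' M -> I} := HB.pack g1 Hg.
have [h hP] := injI _ _ (restr_map (f := sig') f : {linear restr sig' M -> restr sig' N})
  g1' f_inj.
pose h1 (x : N) : restr sig I := h (x : restr sig' N).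
have lh : linear h1.
  move=> e x y; rewrite /h1.
  have -> : e *: x + y = sig e *: (x : restr sig' N) + (y : restr sig' N).
    by rewrite -[sig e *: _]/(sig' (sig e) *: x) sigK.
  by rewrite linearP.
have Hh := GRing.isLinear.Build E N (restr sig I) _ h1 lh.
pose h1' : {linear N -> restr sig I} := HB.pack h1 Hh.
by exists h1' => x; exact: (hP x).
Qed.

Definition shift_restr (I : complex F) (t : int) : complex E.
Proof.
exists (fun i => restr sig (I (i - t)))
       (fun i j => restr_map (f := sig) (cdiff I (i - t) (j - t))).
  move=> i j x ij; apply: cdiff_shape; apply: contraNneq ij => e.
  by apply/eqP/(addIr (- t)); rewrite e addrAC.
by move=> i j l x; exact: cdiffK.
Defined.

Variables (X : complex E) (t : int) (M : lmodType F) (alpha : X t -> M).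
Hypothesis Xt : concentrated t X.
Hypothesis alphaP : forall e x y, alpha (e *: x + y) = sig e *: alpha x + alpha y.
Hypothesis alpha_bij : bijective alpha.

Lemma alpha0 : alpha 0 = 0.
Proof.
have := alphaP 1 0 0; rewrite scaler0 addr0 rmorph1 scale1r => /eqP.
by rewrite -subr_eq0 opprD addrA subrr sub0r oppr_eq0 => /eqP.
Qed.

(** X is M in degree t up to the ring isomorphism sig, so an injective resolution of M, restricted
    along sig and shifted, resolves X. *)
Lemma injdim_transport n : injdim_le M n -> finite_injdim X.
Proof.
move=> [I [g [[qg injI [b Ib]] Ineg Ipos]]].
pose J := shift_restr I t.
have succ i : i + 1 - t = i - t + 1 by rewrite addrAC.
have pred i : i - t = i - 1 - t + 1 by rewrite addrAC subrK.
have cobJ i (x : J i) : coboundary (x : I (i - t)) <-> coboundary x.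
  split=> [/(coboundaryE (pred i)) [y yx]|[y yx]]; first by exists y.
  exact: (coboundaryP (y := y : I (i - 1 - t))).
have cocJ i (x : J i) : cocycle x <-> cocycle (x : I (i - t)).
  split=> cx; first exact: (cocycleP (succ i) cx).
  exact: (cocycleE cx).
have sP i (x : X i) : stalk_pred 0 (i - t) (alpha (tr (cobj X) i t x)).
  rewrite /stalk_pred subr_eq0; case: eqVneq => //= it.
  by rewrite tr0 // alpha0.
pose h i (x : X i) : J i := g (i - t) (StalkObj (sP i x)).
have lh i : linear (@h i).
  move=> e x y; rewrite /h.
  have -> : StalkObj (sP i (e *: x + y))
      = sig e *: StalkObj (sP i x) + StalkObj (sP i y) :> stalk 0 M (i - t).
    by apply: val_inj; rewrite /= linearP alphaP.
  by rewrite linearP.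
have H i := GRing.isLinear.Build E (X i) (J i) _ (@h i) (lh i).
pose h' i : {linear X i -> J i} := HB.pack (@h i) (H i).
have hC i j x : h' j (cdiff X i j x) = cdiff J i j (h' i x).
  have -> : cdiff J i j (h' i x) = 0.
    by rewrite /= /restr_map /h -cmapC linear0.
  have [ij|ij] := eqVneq j (i + 1); last by rewrite cdiff_shape // linear0.
  have [it|it] := eqVneq i t; last by rewrite (Xt it x) !linear0.
  by rewrite (Xt _ (cdiff X i j x)) ?linear0 // ij it -subr_eq0 addrAC subrr add0r.
exists J, (CMap hC), (n%:Z + t); split; last first.
  by move=> i ni x; apply: (Ipos (i - t)); rewrite ltrBrDr.
split=> [i|i|]; last first.
- by exists t => i it x; apply: (Ineg (i - t)); rewrite subr_lt0.
- exact: restr_injective (injI _).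
split=> [x cx|y /cocJ /(qg _).2 [s [_ ys]]].
  have [it|it] := eqVneq i t; last by rewrite (Xt it x) => _; exact: coboundary0.
  subst i => /cobJ hx.
  have [|y /(congr1 val) /= sx] := (qg _).1 (StalkObj (sP t x)) _ hx; first by [].
  have -> : x = 0; last exact: coboundary0.
  by apply: (bij_inj alpha_bij); rewrite alpha0 -[x in LHS](trE (N := cobj X)) -sx.
have [al' al'K alK] := alpha_bij.
exists (tr (cobj X) t i (al' (stalk_val s))); split.
  have [it|it] := eqVneq i t; last by rewrite tr0 1?eq_sym // /cocycle linear0.
  by apply: Xt; rewrite it -subr_eq0 addrAC subrr add0r.
apply/cobJ; rewrite /= /h.
have [it|it] := eqVneq i t; last first.
  have s0 : s = 0 by apply: (stalk_concentrated (m := 0)); rewrite subr_eq0.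
  move: ys; rewrite s0 linear0 subr0; set v := StalkObj _.
  have -> : v = 0 :> stalk 0 M (i - t).
    by apply: (stalk_concentrated (m := 0)); rewrite subr_eq0.
  by rewrite linear0 subr0.
have -> : StalkObj (sP i (tr (cobj X) t i (al' (stalk_val s)))) = s :> stalk 0 M (i - t).
  by apply: val_inj; rewrite /= trK // trE alK.
exact: ys.
Qed.

End InjectiveTransport.

Lemma fg_cohomology_cyclic (E : pzRingType) (X : complex E) (t : int) (rho : X t) :
  concentrated t X -> (forall x : X t, exists e, x = e *: rho) -> fg_cohomology X.
Proof.
move=> Xt gen i; have [it|it] := eqVneq i t; last first.
  exists 0%N, (fun=> 0); split=> [[]//|x _]; exists (fun=> 0).
  by rewrite big_ord0 subr0 (Xt _ it x); exact: coboundary0.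
subst i; exists 1%N, (fun=> rho); split=> [j|x _].
  by apply: Xt; rewrite -subr_eq0 addrAC subrr add0r.
by have [e ->] := gen x; exists (fun=> e); rewrite big_ord1 subrr; exact: coboundary0.
Qed.

(** * Canonical morphisms out of a free cyclic module *)

Section CanonicalIso.
Variables (k : fieldType) (E F : algType k).
Variables (X : complex E) (Y : complex (talg E F)) (t : int) (rho : X t).
Hypothesis Xt : concentrated t X.
Hypothesis gen : forall x : X t, exists e, x = e *: rho.
Hypothesis free : forall e, e *: rho = 0 -> e = 0.
Local Notation Hc := (hom_complex (E := E) (F := F) X Y).
Variable g : forall i, X i -> Y i.
Hypothesis g_lin : forall i e x y, g (e *: x + y) = (e \ox 1) *: g x + g y :> Y i.
Hypothesis g_cocycle : cocycle (g rho).
Hypothesis Y_acyclic : forall i, i != t -> acyclic_at Y i.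
Hypothesis Y_surj : forall y : Y t, cocycle y ->
  exists a : F, coboundary (y - (1 \ox a) *: g rho).
Hypothesis Y_inj : forall a : F, coboundary ((1 \ox a) *: g rho) -> a = 0.

Definition canon_fun i j (x : X i) : Y j := tr (cobj Y) i j (g x).
Fact canon_lin i j e x y :
  @canon_fun i j (e *: x + y) = (e \ox 1) *: @canon_fun i j x + @canon_fun i j y.
Proof. by rewrite /canon_fun g_lin linearP. Qed.
Fact canon_deg i j (x : X i) : j != i + 0 -> @canon_fun i j x = 0.
Proof. by rewrite addr0 => ij; rewrite /canon_fun tr0 // eq_sym. Qed.
Definition canon : Hc 0 := Cochain canon_lin canon_deg.

Lemma annihilated_free n (w : Y (t + n)) : annihilated rho w.
Proof.
move=> e /free ->; have -> : (0 : E) \ox (1 : F) = 0.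
  exact: (linear0f ((aten_bilin E F).1 1)).
exact: scale0r.
Qed.

Lemma hom_coboundary n (x : Hc n) :
  coboundary x <-> coboundary ((x : cochain _ _ _) t (t + n) rho).
Proof.
rewrite (cyc_coboundary Xt gen); split=> [[w _ wx]|].
  exact: (coboundaryP (y := w)).
case/(coboundaryE (j := t + (n - 1))) => [|w wx]; first by rewrite -addrA subrK.
by exists w => //; exact: annihilated_free.
Qed.

Definition canon_act_fun (n : int) (a : stalk 0 (F^o : lmodType F) n) : Hc n :=
  tr (cobj Hc) 0 n ((stalk_val a : F) *: canon).
Fact canon_act_linear n : linear (@canon_act_fun n).
Proof.
by move=> c a b; rewrite /canon_act_fun -linearP /= scalerDl -scalerA.
Qed.
HB.instance Definition _ n := GRing.isLinear.Build F
  (stalk 0 (F^o : lmodType F) n) (Hc n) _ (@canon_act_fun n) (@canon_act_linear n).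

Lemma canon_rho : (canon : cochain _ _ _) t (t + 0) rho = tr (cobj Y) t (t + 0) (g rho).
Proof. by []. Qed.

Lemma canon_cocycle : cocycle canon.
Proof.
apply/(cyc_cocycle Xt gen); rewrite canon_rho.
by rewrite addr0 trE.
Qed.

Definition canon_map : cmap (stalk 0 (F^o : lmodType F)) Hc.
Proof.
exists (fun n => @canon_act_fun n : {linear _ -> _}) => n m a.
rewrite [LHS]linear0; apply/esym.
have [n0|n0] := eqVneq n 0; last first.
  transitivity (cdiff Hc n m 0); last exact: linear0.
  by congr (cdiff Hc n m _); rewrite /= /canon_act_fun tr0 // eq_sym.
subst n; transitivity (cdiff Hc 0 m ((stalk_val a : F) *: canon)).
  by congr (cdiff Hc 0 m _); exact: trE.
by rewrite linearZ_LR (cocycleE canon_cocycle) scaler0.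
Defined.

Lemma canon_mapE (a : stalk 0 (F^o : lmodType F) 0) i (x : X i) :
  (canon_map 0 a : cochain _ _ _) i i x = (1 \ox (stalk_val a : F)) *: g x.
Proof.
rewrite -[canon_map 0 a]/(tr (cobj Hc) 0 0 ((stalk_val a : F) *: canon)) trE.
by rewrite cochainZ /= /canon_fun trE.
Qed.

(** Since rho is free, evaluation at rho turns Hom(X, Y) into a shift of Y. The hypotheses say that
    Y has cohomology only in degree t and that a |-> (1 (x) a) g(rho) identifies F with it. *)
Lemma canon_map_qiso : qiso canon_map.
Proof.
move=> n; have [n0|n0] := eqVneq n 0; last first.
  split=> [a _ _|y cy].
    by rewrite (stalk_concentrated (m := 0) n0 a); exists 0; rewrite linear0.
  exists 0; split; first by rewrite /cocycle linear0.
  rewrite linear0 subr0; apply/hom_coboundary; apply: Y_acyclic.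
    by rewrite -subr_eq0 addrAC subrr add0r.
  exact/(cyc_cocycle Xt gen).
subst n.
have cE a : canon_map 0 a = (stalk_val a : F) *: canon by exact: trE.
(* The degree t + 0 is rewritten to t under a predicate abstracted over the degree, which keeps all
   terms well typed. *)
have rhoE (P : forall i, Y i -> Prop) (a : F) (y : Hc 0) :
    P _ ((y : cochain _ _ _) t (t + 0) rho - (1 \ox a) *: tr (cobj Y) t (t + 0) (g rho))
    = P t ((y : cochain _ _ _) t t rho - (1 \ox a) *: g rho).
  by rewrite addr0 trE.
split=> [a _ /hom_coboundary|y cy].
  rewrite cE cochainZ canon_rho => H.
  have a0 : stalk_val a = 0.
    by apply: Y_inj; move: H; rewrite addr0 trE.
  have -> : a = 0 by exact: val_inj.
  by exists 0; rewrite linear0.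
have cyr : cocycle ((y : cochain _ _ _) t t rho).
  by have := (cyc_cocycle Xt gen y).1 cy; rewrite addr0.
have [a H] := Y_surj cyr.
have aP : stalk_pred 0 0 (a : F^o) by [].
exists (StalkObj aP); split; first exact: val_inj.
apply/hom_coboundary; rewrite cE.
rewrite -[X in coboundary X]/((y : cochain _ _ _) t (t + 0) rho
  - (1 \ox a) *: tr (cobj Y) t (t + 0) (g rho)).
by rewrite (rhoE (fun i => @coboundary _ Y i)).
Qed.

End CanonicalIso.

(** * Twists of A are dualising complexes *)

Section DualisingTwist.
Variables (k : fieldType) (A : algType k).
Local Notation Ae := (talg A A^c).
Variables (mu : {lrmorphism A -> A}) (mu' : A -> A).
Hypotheses (muK : cancel mu mu') (mu'K : cancel mu' mu).
Variable m : int.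
Local Notation R := (stalk m (twist mu (regbim A))).
Local Notation relem := (relem mu m).

Fact inv_monoid : monoid_morphism mu'.
Proof.
by split=> [|x y]; apply: (can_inj muK); rewrite ?rmorph1 ?rmorphM /= ?mu'K.
Qed.

Lemma inv_rmorphism : exists g : {rmorphism A -> A}, g =1 mu'.
Proof.
have H1 := GRing.isLinear.Build k A A _ mu' (inverse_linear muK mu'K).
have H2 := GRing.isMonoidMorphism.Build A A mu' inv_monoid.
pose g : {lrmorphism A -> A} := HB.pack mu' H1 H2.
by exists (g : {rmorphism A -> A}).
Qed.

Lemma relem_val (x : R m) : x = relem (stalk_val x).
Proof. exact: val_inj. Qed.

Lemma relem_eq0 x : relem x = 0 -> x = 0.
Proof. by move=> /(congr1 val). Qed.

Lemma left_relem e : (e \ox (1 : A^c)) *: relem 1 = relem (mu e).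
Proof. by rewrite relem_act !mulr1. Qed.
Lemma right_relem (b : A^c) : ((1 : A) \ox b) *: relem 1 = relem (b : A).
Proof. by rewrite relem_act rmorph1 !mul1r. Qed.

Lemma left_conc : concentrated m (left_part R).
Proof. exact: (@stalk_concentrated _ m (twist mu (regbim A))). Qed.
Lemma right_conc : concentrated m (right_part R).
Proof. exact: (@stalk_concentrated _ m (twist mu (regbim A))). Qed.

Definition lgen : left_part R m := relem 1.
Definition rgen : right_part R m := relem 1.

Lemma left_gen (x : left_part R m) : exists e, x = e *: lgen.
Proof.
exists (mu' (stalk_val (x : R m))).
by rewrite -[RHS]/((mu' _ \ox (1 : A^c)) *: relem 1) left_relem mu'K -relem_val.
Qed.
Lemma left_free e : e *: lgen = 0 -> e = 0.
Proof.
rewrite -[e *: lgen]/((e \ox (1 : A^c)) *: relem 1) left_relem => /relem_eq0 e0.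
by apply: (can_inj muK); rewrite e0 linear0.
Qed.
Lemma right_gen (x : right_part R m) : exists e, x = e *: rgen.
Proof.
exists (stalk_val (x : R m) : A^c).
by rewrite -[RHS]/(((1 : A) \ox _) *: relem 1) right_relem -relem_val.
Qed.
Lemma right_free e : e *: rgen = 0 -> e = 0.
Proof.
by rewrite -[e *: rgen]/(((1 : A) \ox e) *: relem 1) right_relem => /relem_eq0.
Qed.

Lemma left_injdim n : injdim_le (A^o : lmodType A) n -> finite_injdim (left_part R).
Proof.
have [g gE] := inv_rmorphism.
have gK : cancel mu g by move=> x; rewrite gE muK.
have Kg : cancel g mu by move=> x; rewrite gE mu'K.
pose alpha (x : left_part R m) : A^o := stalk_val (x : R m).
apply: (injdim_transport (alpha := alpha) gK Kg left_conc) => [e x y|].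
  rewrite /alpha -[stalk_val _]/((e \ox (1 : A^c)) *: stalk_val (x : R m) + stalk_val (y : R m)).
  by rewrite [X in X + _]twist_act mulr1.
by exists relem => x; rewrite /alpha // -relem_val.
Qed.

Lemma right_injdim n :
  injdim_le (A^c^o : lmodType A^c) n -> finite_injdim (right_part R).
Proof.
pose alpha (x : right_part R m) : A^c^o := stalk_val (x : R m).
have idK : cancel (idfun : A^c -> A^c) (idfun : A^c -> A^c) by [].
apply: (injdim_transport (sig := idfun : {rmorphism A^c -> A^c})
  (sig' := idfun : {rmorphism A^c -> A^c}) (alpha := alpha) idK idK right_conc) => [e x y|].
  rewrite /alpha -[stalk_val _]/(((1 : A) \ox e) *: stalk_val (x : R m) + stalk_val (y : R m)).
  by rewrite [X in X + _]twist_act rmorph1 mul1r.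
by exists relem => x; rewrite /alpha // -relem_val.
Qed.

Lemma stalk_conc : concentrated m R. Proof. exact: stalk_concentrated. Qed.

Section Canonical.
Variables (I : complex Ae) (f : cmap R I).
Hypothesis fI : inj_resolution f.

Lemma res_qiso : qiso f. Proof. by have [] := fI. Qed.

Lemma res_cocycle (x : R m) : cocycle (f m x).
Proof. by rewrite /cocycle -cmapC linear0. Qed.

Lemma res_surj (y : I m) : cocycle y -> exists x : A, coboundary (y - f m (relem x)).
Proof.
move=> /(res_qiso m).2 [x [_ H]]; exists (stalk_val x).
by rewrite -relem_val.
Qed.

Lemma res_inj (x : A) : coboundary (f m (relem x)) -> x = 0.
Proof.
move=> /(res_qiso m).1 H; have [|y] := H; first by [].
by move=> /(congr1 val).
Qed.

(** Over A the twist is free on 1 because mu is bijective, and right multiplications of 1 exhaust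
    the cohomology of I. *)
Lemma left_canonical : left_canonical_iso f.
Proof.
have glin i e (x y : left_part R i) :
  f i (e *: x + y) = (e \ox (1 : A^c)) *: f i x + f i y by exact: linearP.
exists (canon_map left_conc left_gen glin (res_cocycle (relem 1))); split.
  move=> a i r; rewrite canon_mapE; apply/esym; exact: linearZ_LR.
apply: canon_map_qiso => [e|i im|y /res_surj [x H]|a].
- exact: left_free.
- exact: (qiso_exact_off stalk_conc res_qiso).
- exists (x : A^c); move: H; rewrite -right_relem.
  by rewrite (_ : f m _ = (1 \ox (x : A^c)) *: f m (relem 1)) //; exact: linearZ_LR.
rewrite (_ : (1 \ox a) *: _ = f m (relem (a : A))); first exact: res_inj.
rewrite -right_relem; apply/esym; exact: linearZ_LR.
Qed.

(** On this side a sends the generator to mu(a), so preimages are found through mu'. The swap puts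
    the acting algebra in the second tensor factor. *)
Lemma right_canonical : right_canonical_iso f.
Proof.
pose J := crestr (tswap A^c A) I.
have JE i (e : A^c) (a : A) (y : J i) : (e \ox a) *: y = (a \ox e) *: (y : I i).
  by rewrite -[LHS]/(tswap A^c A (e \ox a) *: (y : I i)) tswapE.
have glin i (e : A^c) (x y : right_part R i) :
    f i (e *: x + y) = (e \ox (1 : A)) *: (f i x : J i) + (f i y : J i) :> J i.
  rewrite JE; exact: (linearP (f i)).
exists (canon_map (Y := J) right_conc right_gen glin (res_cocycle (relem 1))); split.
  move=> a i r; rewrite canon_mapE JE; apply/esym; exact: linearZ_LR.
apply: canon_map_qiso => [e|i im|y /res_surj [x H]|a].
- exact: right_free.
- exact: (qiso_exact_off stalk_conc res_qiso).
- exists (mu' x); rewrite JE; move: H; rewrite -{1}(mu'K x) -left_relem.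
  by rewrite (_ : f m _ = (mu' x \ox (1 : A^c)) *: f m (relem 1)) //; exact: linearZ_LR.
rewrite JE (_ : (a \ox 1) *: _ = f m (relem (mu a))).
  by move=> /res_inj a0; apply: (can_inj muK); rewrite a0 linear0.
rewrite -left_relem; apply/esym; exact: linearZ_LR.
Qed.
End Canonical.

(** On each side R is a shift of A, up to mu, so every condition is inherited from the regular
    module. *)
Lemma twist_dualising n n' : injdim_le (A^o : lmodType A) n ->
  injdim_le (A^c^o : lmodType A^c) n' -> dualising R.
Proof.
move=> il ir; split.
- exists m, m => i im x _; rewrite (stalk_conc _ x); first exact: coboundary0.
  by case: im => im; rewrite ?(lt_eqF im) ?(gt_eqF im).
- by split; [exact: left_injdim il | exact: right_injdim ir].
- by split; [exact: fg_cohomology_cyclic left_conc left_gen |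
             exact: fg_cohomology_cyclic right_conc right_gen].
have [I [f fI]] := inj_resolution_exists stalk_conc.
by exists I, f; split; [|exact: left_canonical|exact: right_canonical].
Qed.

End DualisingTwist.

(** * Rigidity and uniqueness *)

Section Rigidity.
Variables (k : fieldType) (A : algType k) (H : hopf A) (d : nat).
Hypothesis A_Gor : AS_Gorenstein (counit H) d.
Variable pi0 : {lrmorphism A -> k^o}.
Hypothesis pi0_int : left_integral_char A (counit H) d pi0.
Local Notation Ae := (talg A A^c).
Local Notation m := (- d%:Z).
Local Notation nu := (nakayama_aut H pi0).

(* Ext^d_{A^e}(A, R (x) R^op) for R the twist by mu: as a bimodule it is A    *)
(* with b . y . a = mu(b) y nu(mu^-1(a)).                                      *)
Lemma ext_twisted (mu : {lrmorphism A -> A}) (mu' : A -> A)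
    (I : complex (talg Ae Ae))
    (f : cmap (tensor_op (stalk m (twist mu (regbim A)))) I) :
  cancel mu mu' -> cancel mu' mu -> inj_resolution f ->
  let Hc := hom_complex (E := Ae) (F := Ae) (stalk 0 (regbim A)) I in
  (forall n, n != m -> acyclic_at Hc n) /\
  exists phi : A -> Hc m, [/\ forall y, cocycle (phi y),
    forall y y', coboundary (phi (y + y') - (phi y + phi y')),
    forall y, coboundary (phi y) -> y = 0,
    forall x, cocycle x -> exists y, coboundary (x - phi y) &
    forall (b : A) (a : A^c) y,
      coboundary ((b \ox a) *: phi y - phi (mu b * y * nu (mu' a)))].
Proof.
move=> muK mu'K fI Hc; have [[nA _] [_ ext] _] := A_Gor.
have [|x y|a x|r [D rD]] := free_resolution_exists
  (aug := fun a => counit H a = 0) nA.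
- exact: linear0.
- by move=> x0 y0; rewrite rmorphD /= x0 y0 addr0.
- by move=> x0; rewrite rmorphM /= x0 mulr0.
have [E1 E0] := ext _ _ (aug_mapP rD).
have [z [z_cocycle z_nontriv z_gen]] := col_generator E1.
have col_ex n u := @col_exact _ _ _ _ _ rD _ E0 n u.
have z_chi := col_integral rD pi0_int z_cocycle.
split; first by move=> n; exact: (ext_acyclic rD col_ex muK mu'K fI).
exists (ext_class rD z_cocycle fI); split.
- exact: ext_class_cocycle.
- exact: ext_classD.
- exact: ext_class_inj.
- exact: ext_class_surj.
exact: ext_class_act.
Qed.


Section ExtClass.
Variables (mu : {lrmorphism A -> A}) (mu' : A -> A) (X : complex Ae).
Variable phi : A -> X m.
Hypothesis phi_cocycle : forall y, cocycle (phi y).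
Hypothesis phiD : forall y y', coboundary (phi (y + y') - (phi y + phi y')).
Hypothesis phi_inj : forall y, coboundary (phi y) -> y = 0.
Hypothesis phi_act : forall (b : A) (a : A^c) y,
  coboundary ((b \ox a) *: phi y - phi (mu b * y * nu (mu' a))).

Lemma cob_trans (x y w : X m) :
  coboundary (x - y) -> coboundary (y - w) -> coboundary (x - w).
Proof. by move=> xy /(coboundaryD xy); rewrite addrA subrK. Qed.
Lemma cob_sym (x y : X m) : coboundary (x - y) -> coboundary (y - x).
Proof. by move=> /coboundaryN; rewrite opprB. Qed.
Lemma cob_add (x y x' y' : X m) : coboundary (x - y) -> coboundary (x' - y') ->
  coboundary ((x + x') - (y + y')).
Proof. by move=> xy /(coboundaryD xy); rewrite addrACA -opprD. Qed.
Lemma cob_scale c (x y : X m) : coboundary (x - y) -> coboundary (c *: x - c *: y).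
Proof. by move=> /(coboundaryZ c); rewrite scalerBr. Qed.
Lemma cob_refl (x : X m) : coboundary (x - x).
Proof. by rewrite subrr; exact: coboundary0. Qed.

Lemma phi0 : coboundary (phi 0).
Proof.
have := phiD 0 0; rewrite addr0 opprD addrA subrr sub0r => /coboundaryN.
by rewrite opprK.
Qed.

Lemma phi_eq y y' : coboundary (phi y - phi y') -> y = y'.
Proof.
move=> yy'; apply/eqP; rewrite -subr_eq0; apply/eqP; apply: phi_inj.
have := phiD (y - y') y'; rewrite subrK => /cob_sym H1.
by have := cob_trans H1 yy'; rewrite addrK.
Qed.

Hypothesis phi_surj : forall x, cocycle x -> exists y, coboundary (x - phi y).

(** When nu mu' is the identity, the structure b . y . a = mu(b) y nu(mu'(a)) is that of the twist
    by mu. *)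
Lemma ext_cohomology_map : (forall a, nu (mu' a) = a) ->
  @cohomology_map Ae X m (twist mu (regbim A)) phi.
Proof.
move=> numu'; split=> // c y y'.
apply: cob_trans (phiD _ _) _; apply: cob_add; last exact: cob_refl.
elim/talg_ind: c => [|c a b u IH].
  by rewrite !scale0r subr0; exact: phi0.
rewrite -atenZl !scalerDl; apply: cob_trans (phiD _ _) _; apply: cob_add => //.
rewrite twist_act; apply: cob_sym; have := phi_act (c *: a) b y.
by rewrite numu' mulrA.
Qed.

(** Let tau be psi read in A through [phi], and c = tau(1). Linearity on the two sides gives tau(a)
    = a c and tau(a) = c nu(mu^-1(a)), hence mu(a) c = c nu(a). Surjectivity of psi gives w with
    tau(w) = 1, so c is a unit. *)
Lemma ext_class_unique (psi : A -> X m) : cancel mu mu' -> cancel mu' mu ->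
  @cohomology_map Ae X m (twist mu (regbim A)) psi ->
  exists u v : A, [/\ u * v = 1, v * u = 1 & forall a, mu a = u * nu a * v].
Proof.
move=> muK mu'K psiP.
have [tau tauP] := choice (fun y : A => phi_surj (coh_cocycle psiP y)).
have tau_eq y w : coboundary (psi y - phi w) -> tau y = w.
  by move=> yw; apply: phi_eq; apply: cob_trans yw; exact/cob_sym/tauP.
have psi_scale (c : Ae) (y : twist mu (regbim A)) :
    coboundary (psi (c *: y) - c *: psi y).
  have := coh_linear psiP c y 0; rewrite addr0 => /cob_trans; apply.
  by rewrite addrAC subrr add0r; exact: (coh_zero psiP).
have tauM (b a y : A) : tau (mu b * (y * a)) = mu b * tau y * nu (mu' a).
  apply: tau_eq; rewrite -(@twist_act _ _ mu b a y).
  apply: cob_trans (psi_scale _ _) _.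
  apply: cob_trans (cob_scale (b \ox (a : A^c)) (tauP y)) _.
  exact: phi_act.
have tau_l a : tau a = a * tau 1.
  have := tauM (mu' a) 1 1; rewrite mu'K !mulr1 => ->.
  by rewrite -[in mu' 1](rmorph1 mu) muK rmorph1 mulr1.
have tau_r a : tau a = tau 1 * nu (mu' a).
  by have := tauM 1 a 1; rewrite rmorph1 !mul1r.
have [w wP] := coh_surj psiP (phi_cocycle 1).
have tw : tau w = 1 by apply: tau_eq; exact: cob_sym.
have lw : w * tau 1 = 1 by rewrite -tau_l.
have rw : tau 1 * nu (mu' w) = 1 by rewrite -tau_r.
(* A left and a right inverse of [tau 1] coincide. *)
have wE : w = nu (mu' w) by rewrite -[LHS]mulr1 -rw mulrA lw mul1r.
have rw' : tau 1 * w = 1 by rewrite wE.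
exists (tau 1), w; split=> // a.
by rewrite -[a in nu a]muK -tau_r tau_l -mulrA rw' mulr1.
Qed.
End ExtClass.


(** For mu = nu the bimodule of [ext_twisted] is the twist itself, and a complex with a single
    cohomology module is isomorphic to it in the derived category. *)
Lemma nakayama_aut_nakayama : bijective (antipode H) -> nakayama d nu.
Proof.
move=> /(nakayama_aut_bij pi0) [nu' nuK nu'K]; split; first by exists nu'.
have [_ [[il _] _] [[ir _] _]] := A_Gor.
split; first by have := twist_dualising nuK nu'K m il ir; exact.
have [I [f fI]] := inj_resolution_exists (@tensor_op_concentrated k A nu m).
exists I, f; split => //.
have [acyc [phi [p1 p2 p3 p4 p5]]] := ext_twisted nuK nu'K fI.
have coh := ext_cohomology_map p1 p2 p3 p5 p4 nu'K.
exact: derived_iso_concentrated acyc _ coh.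
Qed.

(** Rigidity of the twist by mu identifies it with the bimodule of [ext_twisted]; [ext_class_unique]
    extracts the unit. *)
Lemma nakayama_unique (mu : {lrmorphism A -> A}) : nakayama d mu ->
  exists u v : A, [/\ u * v = 1, v * u = 1 & forall a, mu a = u * nu a * v].
Proof.
move=> [[mu' muK mu'K] [_ [I [f [fI iso]]]]].
have [_ [phi [p1 p2 p3 p4 p5]]] := ext_twisted muK mu'K fI.
have [psi psiP] := derived_iso_cohomology iso.
exact: (ext_class_unique p1 p2 p3 p5 p4 muK mu'K psiP).
Qed.

End Rigidity.

Theorem theorem0p3 (k : closedFieldType) (A : algType k) (H : hopf A) (d : nat)
    (S_bij : bijective (antipode H))
    (A_Gor : AS_Gorenstein (counit H) d)
    (pi0 : {lrmorphism A -> k^o})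
    (pi0_int : left_integral_char A (counit H) d pi0) :
  exists nu : {lrmorphism A -> A},
    [/\ forall a, nu a = antipode H (antipode H (left_winding H pi0 a)),
        nakayama d nu &
        forall mu : {lrmorphism A -> A}, nakayama d mu ->
          exists u v : A, [/\ u * v = 1, v * u = 1 &
            forall a, mu a = u * nu a * v]].
Proof.
exists (nakayama_aut H pi0); split=> // [|mu].
  exact: (nakayama_aut_nakayama A_Gor pi0_int S_bij).
exact: (nakayama_unique A_Gor pi0_int).
Qed.
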